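(* There is an absolute constant $c\in(0,1)$ such that the following holds, with ''sparse'' meaning sparse with constant $c$. Let $0<\alpha<1$ and $1+\alpha<r<2$. Almost surely, there is a finite (random) constant $C$ such that for all finitely supported functions $f,g$ on $\mathbb{Z}$ there is a sparse collection $\mathcal{S}$ of intervals in $\mathbb{Z}$ with $$|\langle H_\alpha f,g\rangle|\le C\,\Lambda_r(f,g),\qquad \Lambda_r(f,g)=\sum_{I\in\mathcal{S}}\langle f\rangle_{I,r}\langle g\rangle_{I,r}|I| .$$ The same holds with $M_\alpha$ in place of $H_\alpha$. Moreover, the sparse collection $\mathcal{S}$ (which depends on $f,g$) can be taken non-random, only the constant $C$ being random.
   Context: Let $\{X_n: n\in\mathbb{Z},\,n\ne0\}$ be independent Bernoulli ($\{0,1\}$-valued) random variables with $\mathbb{P}(X_n=1)=|n|^{-\alpha}$. The random Hilbert transform and random maximal function are, for functions $f$ on $\mathbb{Z}$, $$H_\alpha f(x)=\sum_{n\neq0}\frac{X_n}{\operatorname{sgn}(n)|n|^{1-\alpha}}f(x-n),\qquad M_\alpha f(x)=\sup_{N>0}\Big|\frac1{S_N}\sum_{n=1}^NX_nf(x-n)\Big|,\quad S_N=\sum_{n=1}^NX_n .$$ The pairing is $\langle u,v\rangle=\sum_{x\in\mathbb{Z}}u(x)v(x)$. An interval in $\mathbb{Z}$ is a finite set of consecutive integers; $|I|$ is its cardinality and $3I$ is the concentric interval with $3|I|$ elements; $\langle f\rangle_{I,r}=\big(|3I|^{-1}\sum_{x\in3I}|f(x)|^r\big)^{1/r}$. A collection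 $\mathcal{S}$ of intervals is sparse (with constant $c$) if for each $I\in\mathcal{S}$ there is $E_I\subset I$ with $|E_I|>c|I|$ and the sets $E_I$, $I\in\mathcal{S}$, are pairwise disjoint. *)

(* Defs.v *)
From HB Require Import structures.
From mathcomp Require Import all_boot all_order all_algebra finmap.
From mathcomp Require Import all_classical all_reals all_analysis.
From mathcomp Require Import complex.

Set Implicit Arguments.
Unset Strict Implicit.
Unset Printing Implicit Defensive.

Import Order.TTheory GRing.Theory Num.Theory.
Local Open Scope classical_set_scope.
Local Open Scope ring_scope.
Local Open Scope complex_scope.

Definition mutually_independent (R : realType) (d d' : measure_display)
    (T : measurableType d) (T' : measurableType d') (P : probability T R)
    (I : choiceType) (D : set I) (X : I -> {RV P >-> T'}) : Prop :=
  forall (J : {fset I}) (A : I -> set T'),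
    [set` J] `<=` D -> (forall i, measurable (A i)) ->
    P (\bigcap_(i in [set` J]) (X i @^-1` A i))
    = (\prod_(i <- J) P (X i @^-1` A i))%E.

(* Values in {0,1} are booleans, coerced to 0 and 1. The variable [X 0] is
   unconstrained and is used nowhere. *)
Definition selectors (R : realType) (d : measure_display)
    (T : measurableType d) (P : probability T R) (alpha : R)
    (X : int -> {RV P >-> bool}) : Prop :=
  mutually_independent [set n | n != 0] X /\
  forall n : int, n != 0 ->
    P [set w | X n w = true] = (((`|n|%N)%:R : R) `^ (- alpha))%:E.

Section Operators.
Variable R : realType.
Implicit Types (alpha r c : R) (f g u v : int -> R[i]) (X : int -> bool).

Definition modulus (z : R[i]) : R := Normc.normc z.

Definition finitely_supported f : Prop := finite_set [set x | f x != 0].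

(* In [\sum_(n \in A)] only the nonzero terms count. There are finitely many of
   them in [hilbert] when [f] is finitely supported, and in [pairing] when
   [u] or [v] is. *)
Definition hilbert alpha X f (x : int) : R[i] :=
  \sum_(n \in [set n : int | n != 0])
    (((X n)%:R / ((sgz n)%:~R * ((`|n|%N)%:R : R) `^ (1 - alpha)))%:C
     * f (x - n)).

Definition selector_count X (N : nat) : nat := (\sum_(1 <= n < N.+1) X n%:Z)%N.

(* The set is nonempty, and it is bounded when [f] is finitely supported. If
   [S_N = 0], the average is 0; this has probability zero, since
   [P (X_1 = 1) = 1]. *)
Definition maximal X f (x : int) : R :=
  sup [set modulus (((selector_count X N)%:R)^-1
                    * \sum_(1 <= n < N.+1) (X n%:Z)%:R * f (x - n%:Z))
      | N in [set N : nat | (0 < N)%N]].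

Definition pairing u v : R[i] := \sum_(x \in [set: int]) (u x * v x).

(* [(a, n)] stands for [{a, a + 1, ..., a + n - 1}]; the pairs with [n = 0] all
   stand for the empty set, and belong to no sparse collection. *)
Definition zinterval := (int * nat)%type.

Definition points (I : zinterval) : seq int :=
  [seq I.1 + k%:Z | k <- iota 0 I.2].

Definition triple (I : zinterval) : zinterval := (I.1 - I.2%:Z, (3 * I.2)%N).

Definition average r f (I : zinterval) : R :=
  ((((triple I).2)%:R)^-1 * \sum_(x <- points (triple I)) modulus (f x) `^ r)
    `^ r^-1.

Definition sparse c (S : set zinterval) : Prop :=
  exists E : zinterval -> {fset int},
    [/\ forall I, S I -> {subset E I <= points I},
        forall I, S I -> c * I.2%:R < #|` E I|%:R
      & forall I J, S I -> S J -> I <> J -> [disjoint E I & E J]%fset].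

Definition sparse_form r (S : set zinterval) f g : \bar R :=
  \esum_(I in S) (average r f I * average r g I * I.2%:R)%:E.

End Operators.

(* Main.v *)
Require Import Defs.
From HB Require Import structures.
From mathcomp Require Import all_boot all_order all_algebra finmap.
From mathcomp Require Import all_classical all_reals all_analysis.
From mathcomp Require Import complex.
From mathcomp Require Import zify ring lra.

Set Implicit Arguments.
Unset Strict Implicit.
Unset Printing Implicit Defensive.

Import Order.TTheory GRing.Theory Num.Theory.
Local Open Scope classical_set_scope.
Local Open Scope ring_scope.
Local Open Scope complex_scope.

(** Fix [f] and [g], put [u = |f|] and [v = |g|], and let [D] bound every sparse
form of [u] and [v] ([sparse_bound]). The analytic content is that almost surely
[|<Hf, g>| <= C * D] and [|<Mf, g>| <= C * D] for all [f], [g] and all such [D],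
with [C] depending on the sample only. This is enough: the smallest [D] is the
supremum of the sparse forms, and a sparse family that attains half of it
dominates both pairings; when the supremum is infinite, some sparse form exceeds
[||f||_1 * ||g||_1], which dominates both pairings for every sample
([near_maximizer]). The family is chosen from [f] and [g] alone, so it is not
random.

For [H], write [X_n = n^(-alpha) + (X_n - n^(-alpha))]. The means produce the
discrete Hilbert kernel [1/n], the differences a random kernel
([hilbert_kernel_split]).

The kernel [1/n] is treated by stopping times. In a dyadic interval [I], stop at
the maximal dyadic subintervals on which the [r]-average of [u] or of [v] exceeds
a fixed multiple of the one on [I]. By the Vitali covering argument they fill at
most half of [I], so that iterating the selection yields a sparse family
([collection_sparse]). It remains to see that the form truncated at the scale of
[I], minus the forms truncated at the scales of the stopped cells, is at most a
constant times [<f>_I <g>_I |I|] ([local_estimate]): replacing [f] and [g] by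
their averages on the cells costs little by cancellation against the smooth
kernel, and the averages are bounded functions, for which the [l^2] inequality of
Hilbert suffices ([hilbert_inequality]).

The random kernel is cut into the blocks [2^k <= n < 2^(k+1)]. An exponential
moment bound at [2^(k+3)] frequencies together with the Borel-Cantelli lemma shows
that almost surely the Fourier transform of block [k] is at most
[C (k+1) 2^(-k(1-alpha)/2)] ([random_fourier]); hence so is the norm of the block
on [l^2]. Its kernel is at most [2^(-k(1-alpha))]. Interpolating the two bounds at
exponent [r], on the intervals of length [2^(k+1)], gives a constant that decays
geometrically in [k] exactly when [r > 1 + alpha] ([interpolation_exponent]).
The dyadic intervals of one length are disjoint, hence a sparse family, and each
block contributes at most its constant times [D] ([single_scale_sparse]).

For [M], the zero frequency of the same bound shows that [S_N] has order
[N^(1-alpha)], so that the average at [N] is dominated by a geometrically weighted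
sum of the contributions of the blocks. Each contribution is at most the modulus
of a fluctuation, which pairs with [g] as above, plus an ordinary average of
[|f|] over a ball, and the ordinary maximal function obeys the same stopping time
argument ([maximal_sparse], [maximal_bound]). *)

(** * Sums over integer intervals *)
Section Points.
Variable R : realType.

Lemma mem_points (b : int) (n : nat) (x : int) :
  (x \in points (b, n)) = (b <= x < b + n%:Z).
Proof.
apply/mapP/idP => [[k]|/andP[h1 h2]]; first by rewrite mem_iota /= => hk -> /=; lia.
by exists (absz (x - b)); [rewrite mem_iota /=; lia|rewrite /=; lia].
Qed.

Lemma mem_pointsE (I : zinterval) (x : int) :
  (x \in points I) = (I.1 <= x < I.1 + I.2%:Z).
Proof. by rewrite {1}(surjective_pairing I) mem_points. Qed.

Lemma uniq_points I : uniq (points I).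
Proof. by rewrite map_inj_uniq ?iota_uniq // => i j; lia. Qed.

Lemma size_points I : size (points I) = I.2.
Proof. by rewrite size_map size_iota. Qed.

Lemma sum_points (V : nmodType) (b : int) n (F : int -> V) :
  \sum_(x <- points (b, n)) F x = \sum_(0 <= i < n) F (b + i%:Z).
Proof. by rewrite big_map /index_iota subn0. Qed.

Lemma sumr_le_sub (T : eqType) (s t : seq T) (P Q : pred T) (F : T -> R) :
  uniq s -> (forall x, x \in s -> P x -> (x \in t) && Q x) ->
  (forall x, 0 <= F x) ->
  \sum_(x <- s | P x) F x <= \sum_(x <- t | Q x) F x.
Proof.
move=> us st F0.
rewrite -big_filter -[leRHS]big_filter.
set s' := seq.filter _ s; set t' := seq.filter _ t.
have us' : uniq s' by rewrite filter_uniq.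
have st' : {subset s' <= t'}.
  by move=> x; rewrite !mem_filter => /andP[Px xs]; rewrite andbC; apply: st.
elim: s' t' us' st' {us st} => [|x s' IH] t' /=.
  by move=> _ _; rewrite big_nil sumr_ge0.
move=> /andP[xs' us'] st'.
have xt : x \in t' by apply: st'; rewrite mem_head.
rewrite big_cons (perm_big _ (perm_to_rem xt)) /= big_cons lerD2l.
apply: IH => // y ys'; have := st' y; rewrite inE ys' orbT => /(_ isT) yt.
rewrite (perm_mem (perm_to_rem xt)) inE in yt.
by case/orP: yt => // /eqP yx; rewrite -yx ys' in xs'.
Qed.

Lemma ler_sum_seq (V : numDomainType) (T : eqType) (s : seq T) (P : pred T) (F G : T -> V) :
  (forall x, x \in s -> P x -> F x <= G x) ->
  \sum_(x <- s | P x) F x <= \sum_(x <- s | P x) G x.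
Proof.
move=> FG; rewrite big_seq_cond [leRHS]big_seq_cond.
by apply: ler_sum => x /andP[]; apply: FG.
Qed.

Lemma le_of_eq (x y : R) : x = y -> x <= y.
Proof. by move=> ->. Qed.

Lemma eq_sum_sub (V : nmodType) (T : eqType) (s t : seq T) (P Q : pred T) (F : T -> V) :
  uniq s -> uniq t -> (forall x, (x \in s) && P x = (x \in t) && Q x) ->
  \sum_(x <- s | P x) F x = \sum_(x <- t | Q x) F x.
Proof.
move=> us ut st; rewrite -big_filter -[RHS]big_filter.
apply: perm_big; apply: uniq_perm; rewrite ?filter_uniq // => x.
by rewrite !mem_filter ![_ && (x \in _)]andbC.
Qed.

Lemma count_ball (s : seq int) (x : int) (m : nat) : uniq s ->
  \sum_(y <- s | (`|x - y| <= m)%N) (1 : R) <= (m.*2.+1)%:R.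
Proof.
move=> us.
apply: (@le_trans _ _ (\sum_(y <- points ((x - m%:Z)%R, (m.*2.+1)%N) | true) (1:R))).
  by apply: sumr_le_sub => // y _ h; rewrite mem_points; lia.
by rewrite big_const_seq count_predT size_points iter_addr_0.
Qed.

(** The tail of [F] against the square of the distance is a dyadic sum: each
annulus of radius [l * 2 ^ K] contributes [a / (l * 2 ^ K)]. This is how the
regularity of the kernel is paid for. *)
Lemma tail_sum (F : int -> R) (s : seq int) (x : int) (l : nat) (a : R) :
  (0 < l)%N -> 0 <= a -> (forall y, 0 <= F y) ->
  (forall m, (l <= m)%N -> \sum_(y <- s | (`|x - y| <= m)%N) F y <= a * m%:R) ->
  \sum_(y <- s | (l <= `|x - y|)%N) F y / (`|x - y|%N%:R) ^+ 2 <= 4 * a / l%:R.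
Proof.
move=> l0 a0 F0 H.
have l0R : 0 < l%:R :> R by rewrite ltr0n.
(* The factor [1 - 2 ^ (-K)] keeps track of the partial geometric sum, which makes
   the induction on the number of annuli close. *)
have key : forall K : nat, \sum_(y <- s | (l <= `|x - y| < l * 2 ^ K)%N)
      F y / (`|x - y|%N%:R) ^+ 2 <= 4 * a / l%:R * (1 - (2 ^ K)%:R^-1).
  elim=> [|K IH].
    by rewrite big1 ?expn0 ?invr1 ?subrr ?mulr0 // => y; lia.
  rewrite (bigID (fun y => `|x - y| < l * 2 ^ K)%N) /=.
  rewrite (eq_bigl (fun y => l <= `|x - y| < l * 2 ^ K)%N); last first.
    by move=> y; rewrite expnS; lia.
  have -> : 4 * a / l%:R * (1 - (2 ^ K.+1)%:R^-1) =
     4 * a / l%:R * (1 - (2 ^ K)%:R^-1) + 2 * a / (l * 2 ^ K)%:R :> R.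
    rewrite expnS !natrM; have : (2 ^ K)%:R != 0 :> R by rewrite pnatr_eq0 expn_eq0.
    by move=> h; field; rewrite h (gt_eqF l0R).
  apply: lerD => //.
  have M0 : 0 < (l * 2 ^ K)%:R :> R by rewrite ltr0n muln_gt0 l0 expn_gt0.
  apply: (@le_trans _ _ (\sum_(y <- s | (`|x - y| <= l * 2 ^ K.+1)%N)
       F y / (l * 2 ^ K)%:R ^+ 2)).
    rewrite [leRHS](bigID (fun y => (l <= `|x - y| < l * 2 ^ K.+1)%N
         && ~~ (`|x - y| < l * 2 ^ K)%N)) /=.
    apply: ler_wpDr; first by apply: sumr_ge0 => y _; rewrite divr_ge0 // exprn_ge0 // ler0n.
    rewrite [leRHS](eq_bigl (fun y => (l <= `|x - y| < l * 2 ^ K.+1)%N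
         && ~~ (`|x - y| < l * 2 ^ K)%N)); last by move=> y; rewrite expnS; lia.
    apply: ler_sum => y h; apply: ler_wpM2l => //.
    rewrite lef_pV2 ?posrE ?exprn_gt0 //; last by rewrite ltr0n; lia.
    by rewrite ler_sqr ?nnegrE ?ler0n // ler_nat; lia.
  rewrite -mulr_suml.
  apply: (@le_trans _ _ (a * (l * 2 ^ K.+1)%:R / (l * 2 ^ K)%:R ^+ 2)).
    apply: ler_wpM2r; first by rewrite invr_ge0 exprn_ge0 // ltW.
    by apply: H; rewrite leq_pmulr // expn_gt0.
  rewrite expnS mulnCA natrM; apply: le_of_eq.
  by move: M0; move: (l * 2 ^ K)%:R => M M0; field; rewrite gt_eqF.
have [K HK] : exists K, all (fun y => `|x - y| < l * 2 ^ K)%N s.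
  elim: s {H key} => [|y s [K HK]]; first by exists 0%N.
  exists (maxn K `|x - y|%N) => /=; apply/andP; split.
    apply: (@leq_trans (2 ^ `|x - y|)%N); first exact: ltn_expl.
    by rewrite -[leqLHS]mul1n leq_mul ?leq_pexp2l ?leq_maxr.
  apply: sub_all HK => z hz; apply: (leq_trans hz).
  by rewrite leq_mul2l leq_pexp2l ?orbT // leq_maxl.
apply: le_trans (_ : 4 * a / l%:R * (1 - (2 ^ K)%:R^-1) <= _); last first.
  by rewrite ler_piMr ?divr_ge0 ?mulr_ge0 ?ler0n // gerBl invr_ge0 ler0n.
apply: le_trans (key K); rewrite big_seq_cond [leRHS]big_seq_cond.
apply: le_of_eq; apply: eq_bigl => y.
case ys: (y \in s) => //=; have := allP HK y ys; lia.
Qed.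
End Points.

(** * Interaction of an interval with its complement *)
Section Boundary.
Variable R : realType.

(** The only information on [F] and [G] that the stopping times provide: below the
radius [ell x], nothing is known around [x]. *)
Definition ball_bounded (s t : seq int) (ell : int -> nat) (F : int -> R) (a : R) :=
  forall (x : int) m, x \in s -> (ell x <= m)%N ->
     \sum_(y <- t | (`|x - y| <= m)%N) F y <= a * m%:R.

(** The points outside the interval [(q, w)] interact with it through the
singularity of the kernel, without cancellation. At distance about [2 ^ K] only
the points within about [2 ^ K] of an end of the interval take part: the masses of [F]
and [G] there are [a * 2 ^ K] and [b * 2 ^ K], the kernel is [2 ^ (-K)], and the
sum over [2 ^ K <= 3 * w] is geometric. The hypotheses only control balls of
radius at least [ell x] around [x]; for a scale [2 ^ K] at which some pair is
counted this is enough, by centring all balls at one such [x]. *)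
Lemma near_boundary (F G : int -> R) (s t : seq int) (ell : int -> nat)
    (q : int) (w : nat) (a b : R) :
  (forall y, 0 <= F y) -> (forall y, 0 <= G y) -> 0 <= a -> 0 <= b ->
  uniq s -> {subset s <= t} -> (0 < w)%N ->
  ball_bounded s t ell F a -> ball_bounded s t ell G b ->
  \sum_(x <- s | x \notin points (q, w))
    \sum_(y <- t | (y \in points (q, w)) && (ell x <= `|x - y| <= 3 * w)%N)
      F y * G x / (`|x - y|%N)%:R <= 96 * a * b * w%:R.
Proof.
move=> F0 G0 a0 b0 us st w0 hF hG.
pose sd (d : bool) (x : int) := if d then (q + w%:Z <= x) else (x < q).
have term0 x y : 0 <= F y * G x / (`|x - y|%N)%:R.
  by rewrite divr_ge0 ?mulr_ge0 ?ler0n.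
have side d K : \sum_(x <- s | sd d x)
    \sum_(y <- t | (y \in points (q, w)) && (ell x <= `|x - y| < 2 ^ K)%N)
      F y * G x / (`|x - y|%N)%:R <= 8 * a * b * (2 ^ K)%:R.
  elim: K => [|K IH].
    rewrite big1 ?mulr_ge0 ?ler0n // => x _; rewrite big1 // => y /andP[_].
    rewrite expn0 => h; have -> : `|x - y|%N = 0%N by lia.
    by rewrite invr0 mulr0.
  pose sh (x y : int) := (y \in points (q, w)) &&
     ((ell x <= `|x - y|) && (2 ^ K <= `|x - y| < 2 ^ K.+1))%N.
  have -> : 8 * a * b * (2 ^ K.+1)%:R =
     8 * a * b * (2 ^ K)%:R + 8 * a * b * (2 ^ K)%:R by rewrite expnS natrM; ring.
  apply: (@le_trans _ _ (\sum_(x <- s | sd d x)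
    (\sum_(y <- t | (y \in points (q, w)) && (ell x <= `|x - y| < 2 ^ K)%N)
      F y * G x / (`|x - y|%N)%:R +
     \sum_(y <- t | sh x y) F y * G x / (`|x - y|%N)%:R))).
    apply: ler_sum => x _.
    rewrite (bigID (fun y => `|x - y| < 2 ^ K)%N) /= le_eqVlt; apply/orP; left.
    by apply/eqP; congr (_ + _); apply: eq_bigl => y;
      rewrite /sh mem_points expnS; lia.
  rewrite big_split /=; apply: lerD => //.
  have K0 : 0 < (2 ^ K)%:R :> R by rewrite ltr0n expn_gt0.
  rewrite (bigID (fun x => has (sh x) t)) /= [X in _ + X]big1 ?addr0; last first.
    by move=> x /andP[_ /hasPn h]; rewrite big_seq_cond big1 // => y /andP[/h /negP].
  (* One admissible point [x0] of this scale serves as the centre of all the balls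
     below, so that the bound on [ell x0] is used instead of those on [ell x]. *)
  have [/hasP[x0 x0s /andP[sx0 /hasP[y0 y0t shy0]]]|/hasPn none] :=
    boolP (has (fun x => sd d x && has (sh x) t) s); last first.
    rewrite big_seq_cond big1 ?mulr_ge0 ?ler0n // => x /andP[xs hx].
    by have := none x xs; rewrite hx.
  have ex0 : (ell x0 <= 2 ^ K.+1)%N by case/and3P: shy0 => _ h1 h2; lia.
  apply: (@le_trans _ _ (\sum_(x <- s | sd d x && has (sh x) t)
     G x * ((2 ^ K)%:R^-1 * (a * (4 * 2 ^ K)%:R)))).
    apply: ler_sum => x /andP[sx /hasP[y1 y1t shy1]].
    apply: (@le_trans _ _ (\sum_(y <- t | (`|x0 - y| <= 4 * 2 ^ K)%N)
        G x * ((2 ^ K)%:R^-1 * F y))).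
      rewrite [leRHS](bigID (sh x)) /=; apply: ler_wpDr.
        by apply: sumr_ge0 => y _; rewrite !mulr_ge0 // invr_ge0 ler0n.
      rewrite [leRHS](eq_bigl (sh x)); last first.
        move=> y; apply/andP/idP => [[]//|shy]; split=> //.
        move: shy shy0 shy1; rewrite /sh !mem_points !expnS; move: sx sx0.
        by rewrite /sd; case: (d); lia.
      apply: ler_sum => y /and3P[_ _ /andP[h _]].
      rewrite (_ : G x * _ = F y * G x * (2 ^ K)%:R^-1); last by ring.
      rewrite ler_wpM2l ?mulr_ge0 //.
      by rewrite lef_pV2 ?posrE // ?ler_nat // ltr0n (leq_trans _ h) ?expn_gt0.
    rewrite -mulr_sumr ler_wpM2l // -mulr_sumr ler_wpM2l ?invr_ge0 ?ler0n //.
    by apply: hF => //; rewrite (leq_trans ex0) // expnS leq_mul2r orbT.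
  rewrite -mulr_suml.
  apply: (@le_trans _ _ ((b * (2 ^ K.+1)%:R) * ((2 ^ K)%:R^-1 * (a * (4 * 2 ^ K)%:R)))).
    apply: ler_wpM2r; first by rewrite !mulr_ge0 ?invr_ge0 ?ler0n.
    apply: (le_trans _ (hG x0 _ x0s ex0)).
    apply: sumr_le_sub => // x xs /andP[sx /hasP[y1 y1t shy1]].
    rewrite (st _ xs) /=.
    move: shy0 shy1; rewrite /sh !mem_points !expnS; move: sx sx0.
    by rewrite /sd; case: (d); lia.
  rewrite expnS !natrM; apply: le_of_eq.
  by move: K0; move: (2 ^ K)%:R => M M0; field; rewrite gt_eqF.
(* The power of two just above [3 * w], the largest distance that is counted. *)
have [K [K1 K2]] : exists K, (3 * w < 2 ^ K)%N /\ (2 ^ K <= 6 * w)%N.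
  exists (trunc_log 2 (3 * w)).+1; split; first exact: trunc_log_ltn.
  by rewrite expnS; have := @trunc_logP 2 (3 * w)%N isT ltac:(lia); lia.
apply: (@le_trans _ _ (16 * a * b * (2 ^ K)%:R)); last first.
  rewrite (_ : 96 * a * b * w%:R = 16 * a * b * (6 * w)%:R); last by rewrite natrM; ring.
  by rewrite ler_wpM2l ?mulr_ge0 ?ler0n // ler_nat.
apply: (@le_trans _ _ (\sum_(x <- s | sd true x)
    \sum_(y <- t | (y \in points (q, w)) && (ell x <= `|x - y| < 2 ^ K)%N)
      F y * G x / (`|x - y|%N)%:R + \sum_(x <- s | sd false x)
    \sum_(y <- t | (y \in points (q, w)) && (ell x <= `|x - y| < 2 ^ K)%N)
      F y * G x / (`|x - y|%N)%:R)); last first.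
  by apply: (le_trans (lerD (side true K) (side false K))); rewrite -subr_ge0; lra.
rewrite (bigID (sd true)) /=; apply: lerD.
  rewrite (eq_bigl (sd true)); last by move=> x; rewrite mem_points /sd; lia.
  apply: ler_sum => x _; rewrite [leRHS](bigID (fun y => `|x - y| <= 3 * w)%N) /=.
  apply: ler_wpDr; first exact: sumr_ge0.
  apply: le_of_eq; apply: eq_bigl => y;
  rewrite mem_points; lia.
rewrite (eq_bigl (sd false)); last by move=> x; rewrite mem_points /sd; lia.
apply: ler_sum => x _; rewrite [leRHS](bigID (fun y => `|x - y| <= 3 * w)%N) /=.
apply: ler_wpDr; first exact: sumr_ge0.
apply: le_of_eq; apply: eq_bigl => y;
  rewrite mem_points; lia.
Qed.
End Boundary.

(** * Hilbert's inequality for bounded functions *)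
Section HilbertInequality.
Variable R : realType.

(** The inverse of zero being zero, the diagonal vanishes. *)
Definition kernel (x y : int) : R := ((x - y)%:~R)^-1.

Lemma kernelxx x : kernel x x = 0.
Proof. by rewrite /kernel subrr invr0. Qed.

Lemma kernelC x y : kernel x y = - kernel y x.
Proof. by rewrite /kernel -opprB mulrNz invrN. Qed.

Lemma norm_kernel x y : `|kernel x y| = (`|x - y|%N%:R)^-1.
Proof. by rewrite /kernel normfV -intr_norm -abszE. Qed.

Lemma kernel_sqr x y : kernel x y ^+ 2 = (`|x - y|%N%:R ^+ 2)^-1.
Proof. by rewrite -[LHS]ger0_norm ?sqr_ge0 // normrX norm_kernel exprVn. Qed.

Lemma sum_inv_sqr (s : seq int) (x : int) : uniq s ->
  \sum_(y <- s) kernel x y ^+ 2 <= 12.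
Proof.
move=> us; rewrite (bigID (fun y => 1 <= `|x - y|)%N) /= [X in _ + X]big1; last first.
  move=> y h; have -> : y = x by lia.
  by rewrite kernelxx expr0n.
rewrite addr0 (eq_bigr (fun y => 1 / (`|x - y|%N%:R) ^+ 2)); last first.
  by move=> y _; rewrite kernel_sqr div1r.
have := @tail_sum R (fun=> 1) s x 1 3 isT; rewrite divr1.
move=> /(_ _ _ _)/le_trans -> //; last by lra.
move=> m m1; apply: (le_trans (count_ball R x m us)).
by rewrite -natrM ler_nat; lia.
Qed.

Section Window.
Variables (b : int) (n : nat).
Hypothesis n0 : (0 < n)%N.
Let s := points (b, n).
Let W := points ((b - n%:Z)%R, (3 * n)%N).
Let hW (y : int) := \sum_(x <- W) kernel x y.

(** The sum over the translated window differs by its two end terms, and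
both are at distance at least [n] from [y]. *)
Let hW_step (y : int) : b <= y -> y + 1 < b + n%:Z -> `|hW (y + 1) - hW y| <= 2 / n%:R.
Proof.
move=> by1 by2; rewrite /hW /W !sum_points.
pose u (i : nat) : R := kernel (b - n%:Z + i%:Z) (y + 1).
rewrite (_ : \sum_(0 <= i < 3 * n) kernel (b - n%:Z + i%:Z) y =
             \sum_(0 <= i < 3 * n) u i.+1); last first.
  by apply: eq_bigr => i _; rewrite /u /kernel; congr (_%:~R^-1); lia.
have E : \sum_(0 <= i < 3 * n) u i + u (3 * n)%N = u 0%N + \sum_(0 <= i < 3 * n) u i.+1.
  by rewrite -big_nat_recr // big_nat_recl.
have -> : \sum_(0 <= i < 3 * n) kernel (b - n%:Z + i%:Z) (y + 1) =
   u 0%N + \sum_(0 <= i < 3 * n) u i.+1 - u (3 * n)%N by rewrite -E addrK.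
rewrite addrAC addrK.
apply: (le_trans (ler_normB _ _)).
have -> : 2 / n%:R = n%:R^-1 + n%:R^-1 :> R by rewrite mulrDl div1r.
have nR : 0 < n%:R :> R by rewrite ltr0n.
by apply: lerD; rewrite /u norm_kernel lef_pV2 ?posrE ?ltr0n ?ler_nat; lia.
Qed.

Let hW_lip (y z : int) : y \in s -> z \in s ->
  `|hW y - hW z| <= 2 / n%:R * `|y - z|%N%:R.
Proof.
wlog yz : y z / y <= z.
  move=> H ys zs; have /orP[h|h] := le_total y z; first exact: H.
  by rewrite distrC (_ : `|y - z|%N = `|z - y|%N); [apply: H|lia].
rewrite /s !mem_points => /andP[y1 _] /andP[_ z2].
have [m zE] : exists m : nat, z = y + m%:Z by exists `|z - y|%N; lia.
rewrite zE in z2 *; rewrite (_ : absz (y - (y + m%:Z))%R = m); last by lia.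
elim: m z2 {z zE yz} => [|m IH] z2; first by rewrite addr0 subrr normr0 mulr0.
have -> : y + m.+1%:Z = y + m%:Z + 1 by lia.
rewrite -(subrKA (hW (y + m%:Z))).
apply: (le_trans (ler_normD _ _)).
rewrite -(natr1 m) mulrDr mulr1; apply: lerD; first by apply: IH; lia.
by rewrite distrC; apply: hW_step; lia.
Qed.

Let gram (y z : int) := \sum_(x <- W) kernel x y * kernel x z.

(** For [y <> z] the identity
[1/((x-y)(x-z)) = (1/(x-y) - 1/(x-z)) / (y-z)] turns the Gram entry into a
difference of sums of the kernel over the window, which is of order
[|y-z| / n] because sliding the window by one changes only its two end terms. The
term [2 / (y-z)^2] comes from the two values of [x] for which the identity fails. *)
Let gram_le (y z : int) : y \in s -> z \in s ->
  `|gram y z| <= 12 * (y == z)%:R + 2 / n%:R + 2 * kernel y z ^+ 2.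
Proof.
move=> ys zs; have [<-|yz] := eqVneq y z.
  rewrite kernelxx expr0n mulr0 addr0 mulr1; apply: ler_wpDr.
    by rewrite divr_ge0 ?ler0n.
  rewrite ger0_norm; last by apply: sumr_ge0 => x _; rewrite -expr2 sqr_ge0.
  apply: le_trans (sum_inv_sqr y (uniq_points (b - n%:Z, (3 * n)%N))).
  apply: le_of_eq; apply: eq_bigr => x _.
  by rewrite -expr2 kernelC sqrrN.
have yz0 : (y - z)%:~R != 0 :> R by rewrite intr_eq0 subr_eq0.
have inW x : x \in s -> x \in W by rewrite /s /W !mem_points; lia.
have -> : gram y z = (hW y - hW z) * kernel y z + 2 * kernel y z ^+ 2.
  rewrite -sumrB mulr_suml.
  have D c w : w \in W -> \sum_(x <- W) (x == w)%:R * c = c :> R.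
    move=> wW; rewrite (bigD1_seq w) ?uniq_points //= eqxx mul1r big1 ?addr0 //.
    by move=> x /negbTE ->; rewrite mul0r.
  rewrite mulrDl mul1r -{1}(D (kernel y z ^+ 2) y (inW _ ys)).
  rewrite -{2}(D (kernel y z ^+ 2) z (inW _ zs)) -!big_split /=.
  apply: eq_bigr => x _.
  have [->|xy] := eqVneq x y; first by rewrite kernelxx (negbTE yz) /=; ring.
  have [->|xz] := eqVneq x z; first by rewrite kernelxx (kernelC z y) /=; ring.
  have xy0 : (x - y)%:~R != 0 :> R by rewrite intr_eq0 subr_eq0.
  have xz0 : (x - z)%:~R != 0 :> R by rewrite intr_eq0 subr_eq0.
  rewrite /kernel /=.
  have E : (x - z)%:~R = (x - y)%:~R + (y - z)%:~R :> R.
    by rewrite -intrD; congr (_%:~R); lia.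
  move: xz0 xy0 yz0; rewrite E.
  move: ((x - y)%:~R : R) ((y - z)%:~R : R) => p q pq p0 q0.
  by field; rewrite pq p0 q0.
apply: (le_trans (ler_normD _ _)); apply: lerD.
  rewrite normrM norm_kernel mulr0 add0r.
  apply: (le_trans (ler_wpM2r _ (hW_lip ys zs))); first by rewrite invr_ge0 ler0n.
  by rewrite mulfK // pnatr_eq0; lia.
by rewrite ger0_norm // mulr_ge0 ?sqr_ge0.
Qed.

(** The Gram matrix of the columns of the kernel has rows with bounded sum, so that
the operator is bounded on [l^2]; for bounded functions on an interval of length [n]
this yields the bound [n]. Testing the image of [f] on the window of triple length
makes the Gram matrix nearly diagonal. *)
Lemma hilbert_inequality (f g : int -> R) (a c : R) : 0 <= a -> 0 <= c ->
  (forall y, y \in s -> `|f y| <= a) -> (forall x, x \in s -> `|g x| <= c) ->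
  `|\sum_(x <- s) \sum_(y <- s) f y * g x * kernel x y| <= 20 * a * c * n%:R.
Proof.
move=> a0 c0 fa gc.
have nR : 0 < n%:R :> R by rewrite ltr0n.
have [a00|an0] := eqVneq a 0.
  rewrite big_seq_cond big1; last first.
    move=> x /andP[xs _]; rewrite big_seq_cond big1 // => y /andP[/fa].
    by rewrite a00 normr_le0 => /eqP ->; rewrite !mul0r.
  by rewrite normr0 !mulr_ge0.
have ap : 0 < a by rewrite lt_def an0.
pose h (x : int) := \sum_(y <- s) f y * kernel x y.
have sumc : \sum_(y <- s) (1 : R) = n%:R.
  by rewrite big_const_seq count_predT size_points iter_addr_0.
have H2 : \sum_(x <- W) h x ^+ 2 <= 38 * a ^+ 2 * n%:R.
  have -> : \sum_(x <- W) h x ^+ 2 = \sum_(y <- s) \sum_(z <- s) f y * f z * gram y z.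
    under eq_bigr => x _ do rewrite expr2 /h mulr_suml.
    rewrite exchange_big /=; apply: eq_bigr => y _.
    under eq_bigr => x _ do rewrite mulr_sumr.
    rewrite exchange_big /=; apply: eq_bigr => z _.
    rewrite /gram mulr_sumr; apply: eq_bigr => x _; ring.
  apply: (@le_trans _ _ (\sum_(y <- s) \sum_(z <- s)
     a ^+ 2 * (12 * (y == z)%:R + 2 / n%:R + 2 * kernel y z ^+ 2))).
    apply: ler_sum_seq => y ys _.
    apply: ler_sum_seq => z zs _.
    apply: (le_trans (ler_norm _)); rewrite normrM; apply: ler_pM => //.
      by rewrite normrM expr2 ler_pM // fa.
    exact: gram_le.
  apply: (@le_trans _ _ (\sum_(y <- s) 38 * a ^+ 2)); last first.
    by rewrite -sumc mulr_sumr; apply: le_of_eq; apply: eq_bigr => i _; rewrite mulr1.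
  apply: ler_sum_seq => y ys _.
  rewrite -mulr_sumr mulrC ler_wpM2r ?exprn_ge0 // !big_split /=.
  have -> : 38 = 12 + 2 + 2 * 12 :> R by lra.
  apply: lerD; [apply: lerD|].
  - rewrite (bigD1_seq y) ?uniq_points //= eqxx mulr1 big1 ?addr0 //.
    by move=> z /negbTE; rewrite eq_sym => ->; rewrite mulr0.
  - by rewrite -[X in \sum_(_ <- _) X]mulr1 -mulr_sumr sumc divfK // gt_eqF.
  - by rewrite -mulr_sumr ler_wpM2l // sum_inv_sqr // uniq_points.
(* The arithmetic-geometric mean inequality [|h| <= (a + h ^ 2 / a) / 2] stands
   in for the inequality of Cauchy and Schwarz. *)
apply: (@le_trans _ _ (\sum_(x <- s) c * ((a + h x ^+ 2 / a) / 2))).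
  apply: (le_trans (ler_norm_sum _ _ _)).
  apply: ler_sum_seq => x xs _.
  have -> : \sum_(y <- s) f y * g x * kernel x y = g x * h x.
    by rewrite /h mulr_sumr; apply: eq_bigr => y _; ring.
  rewrite normrM; apply: ler_pM => //; first exact: gc.
  rewrite -subr_ge0.
  have -> : (a + h x ^+ 2 / a) / 2 - `|h x| = (a - `|h x|) ^+ 2 / (2 * a).
    by rewrite -normr_id -(@real_normK _ (h x)) ?num_real // normr_id; field.
  by rewrite divr_ge0 ?sqr_ge0 // mulr_ge0.
rewrite -mulr_sumr -mulr_suml big_split /= -mulr_suml.
have -> : \sum_(x <- s) a = a * n%:R.
  by rewrite -sumc mulr_sumr; apply: eq_bigr => i _; rewrite mulr1.
have H3 : (\sum_(x <- s) h x ^+ 2) / a <= 38 * a * n%:R.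
  rewrite ler_pdivrMr //; apply: le_trans (_ : 38 * a ^+ 2 * n%:R <= _); last first.
    by apply: le_of_eq; ring.
  apply: le_trans H2; apply: sumr_le_sub; [exact: uniq_points| |].
    by move=> x; rewrite /s /W !mem_points; lia.
  by move=> x; rewrite sqr_ge0.
rewrite (_ : 20 * a * c * n%:R = c * (20 * a * n%:R)); last by ring.
rewrite ler_wpM2l //; have := mulr_ge0 a0 (ltW nR); move: H3.
by move: (\sum_(x <- s) _) => S H3 an; lra.
Qed.
End Window.
End HilbertInequality.

(** * Truncated Hilbert forms on a partition into cells *)
Section Localization.
Variable R : realType.

Lemma sum_cover (T : eqType) (t : seq T) (P Q1 Q2 : pred T) (F : T -> R) :
  (forall y, 0 <= F y) -> (forall y, y \in t -> P y -> Q1 y || Q2 y) ->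
  \sum_(y <- t | P y) F y <= \sum_(y <- t | Q1 y) F y + \sum_(y <- t | Q2 y) F y.
Proof.
move=> F0 H; rewrite (big_mkcond P) (big_mkcond Q1) (big_mkcond Q2) -big_split /=.
apply: ler_sum_seq => y yt _; have := H y yt; have := F0 y.
by case: (P y); case: (Q1 y); case: (Q2 y) => //= y0 h;
  rewrite ?addr0 ?add0r ?lerDl ?addr_ge0 //; have := h isT.
Qed.

Lemma uniq_flatten_inj (T T' : eqType) (f : T -> seq T') (ps : seq T) P Q x :
  uniq (flatten (map f ps)) -> P \in ps -> Q \in ps ->
  x \in f P -> x \in f Q -> P = Q.
Proof.
have sub ps' P' y : P' \in ps' -> y \in f P' -> y \in flatten (map f ps').
  by move=> h1 h2; apply/flattenP; exists (f P') => //; apply: map_f.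
elim: ps => [//|P0 ps IH] /=; rewrite cat_uniq => /and3P[_ /hasPn dis us].
rewrite !inE => /predU1P[->|Pps] /predU1P[->|Qps] // xP xQ.
- by have /dis/negP := sub _ _ _ Qps xQ.
- by have /dis/negP := sub _ _ _ Pps xP.
- exact: IH.
Qed.

(** Outside the union of [ps] the cell is the empty interval [(0, 0)]. *)
Definition cell (ps : seq zinterval) (x : int) : zinterval :=
  nth (0, 0%N) ps (find (fun P => x \in points P) ps).

Definition cell_average (ps : seq zinterval) (f : int -> R) (x : int) : R :=
  (\sum_(z <- points (cell ps x)) f z) / ((cell ps x).2)%:R.

(** The gap is at least the longer of the two lengths: then the kernel is smooth
at the scale of both cells. *)
Definition separated (P Q : zinterval) : bool :=
  (P.1 + P.2%:Z + (maxn P.2 Q.2)%:Z <= Q.1) || (Q.1 + Q.2%:Z + (maxn P.2 Q.2)%:Z <= P.1).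

Lemma separatedC P Q : separated P Q = separated Q P.
Proof. by rewrite /separated orbC maxnC. Qed.

Lemma separated_dist (P Q : zinterval) (x y : int) :
  x \in points P -> y \in points Q -> separated P Q ->
  (maxn P.2 Q.2 <= `|x - y|)%N && (P.2 <= `|P.1 - y|)%N.
Proof. by rewrite !mem_pointsE /separated; lia. Qed.

Lemma near_dist (P Q : zinterval) (x y : int) :
  x \in points P -> y \in points Q -> ~~ separated P Q ->
  (`|x - y| <= 3 * P.2)%N || (`|x - y| <= 3 * Q.2)%N.
Proof. by rewrite !mem_pointsE /separated; lia. Qed.

Section Cells.
Variables (I : zinterval) (ps : seq zinterval).
Hypothesis ps0 : forall P : zinterval, P \in ps -> (0 < P.2)%N.
Hypothesis psI : perm_eq (flatten (map points ps)) (points I).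
Local Notation len x := ((cell ps x).2).

Lemma cells_uniq : uniq (flatten (map points ps)).
Proof. by rewrite (perm_uniq psI) uniq_points. Qed.

Lemma cellP x : x \in points I -> (cell ps x \in ps) && (x \in points (cell ps x)).
Proof.
rewrite -(perm_mem psI) => /flattenP[_ /mapP[P Pps ->] xP].
have h : has (fun P => x \in points P) ps by apply/hasP; exists P.
by rewrite mem_nth -?has_find // (nth_find _ h).
Qed.

Lemma cell_subset (P : zinterval) : P \in ps -> {subset points P <= points I}.
Proof.
move=> Pps x xP; rewrite -(perm_mem psI); apply/flattenP.
by exists (points P) => //; apply: map_f.
Qed.

Lemma cell_eq (P : zinterval) (x : int) : P \in ps -> x \in points P -> cell ps x = P.
Proof.
move=> Pps xP; have /andP[h1 h2] := cellP (cell_subset Pps xP).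
exact: uniq_flatten_inj cells_uniq _ _ h2 xP.
Qed.

Lemma cell_le (P : zinterval) : P \in ps -> (I.1 <= P.1) && (P.1 + P.2%:Z <= I.1 + I.2%:Z).
Proof.
move=> Pps; have P0 := ps0 Pps.
have : P.1 \in points I by apply: (cell_subset Pps); rewrite mem_pointsE; lia.
have : P.1 + P.2%:Z - 1 \in points I.
  by apply: (cell_subset Pps); rewrite mem_pointsE; lia.
by rewrite !mem_pointsE; lia.
Qed.

Lemma cell_bounds (x : int) : x \in points I ->
  [/\ (0 < len x)%N, (cell ps x).1 <= x, x < (cell ps x).1 + (len x)%:Z,
      I.1 <= (cell ps x).1 & (cell ps x).1 + (len x)%:Z <= I.1 + I.2%:Z].
Proof.
move=> xI; have /andP[cps xc] := cellP xI; have /andP[h1 h2] := cell_le cps.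
move: xc; rewrite mem_pointsE => /andP[h3 h4].
by split=> //; apply: ps0.
Qed.

Lemma sum_cells (V : nmodType) (H : int -> V) :
  \sum_(x <- points I) H x = \sum_(P <- ps) \sum_(x <- points P) H x.
Proof. by rewrite -(perm_big _ psI) /= big_flatten big_map. Qed.

Lemma sum_cells_cond (V : nmodType) (p : pred int) (H : int -> V) :
  \sum_(x <- points I | p x) H x = \sum_(P <- ps) \sum_(x <- points P | p x) H x.
Proof.
by rewrite big_mkcond sum_cells; apply: eq_bigr => P _; rewrite [RHS]big_mkcond.
Qed.

Lemma sum_len : \sum_(P <- ps) (P.2)%:R = I.2%:R :> R.
Proof.
have E (J : zinterval) : \sum_(x <- points J) (1 : R) = J.2%:R.
  by rewrite big_const_seq count_predT size_points iter_addr_0.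
by rewrite -E sum_cells; apply: eq_bigr => P _; rewrite E.
Qed.

Lemma cell_average_out f x : x \notin points I -> cell_average ps f x = 0.
Proof.
move=> xI; rewrite /cell_average /cell nth_default ?big_nil ?mul0r //.
rewrite leqNgt -has_find; apply/negP => /hasP[P Pps xP].
by rewrite (cell_subset Pps xP) in xI.
Qed.

Let t := points (triple I).

Let It : {subset points I <= t}.
Proof.
move=> x; rewrite /t !mem_pointsE /=; lia.
Qed.

(** The interaction of each cell with its neighbourhood of three times its length,
summed over the cells: the lengths of the cells add up to the length of [I]. *)
Lemma near_cells (F G : int -> R) (ell : int -> nat) (a b : R) :
  (forall y, 0 <= F y) -> (forall y, 0 <= G y) -> 0 <= a -> 0 <= b ->
  ball_bounded (points I) t ell F a -> ball_bounded (points I) t ell G b ->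
  \sum_(x <- points I)
    \sum_(y <- points I | (x \notin points (cell ps y)) && (ell x <= `|x - y| <= 3 * len y)%N)
      F y * G x / (`|x - y|%N)%:R <= 96 * a * b * I.2%:R.
Proof.
move=> F0 G0 a0 b0 hF hG.
apply: (@le_trans _ _ (\sum_(x <- points I) \sum_(P <- ps) \sum_(y <- points P |
   (x \notin points P) && (ell x <= `|x - y| <= 3 * P.2)%N) F y * G x / (`|x - y|%N)%:R)).
  apply: le_of_eq; apply: eq_bigr => x _.
  rewrite sum_cells_cond; apply: eq_big_seq => P Pps; rewrite big_seq_cond [RHS]big_seq_cond.
  by apply: eq_bigl => y; case yP: (y \in points P) => //=; rewrite (cell_eq Pps yP).
rewrite exchange_big /= -sum_len mulr_sumr.
apply: ler_sum_seq => P Pps _.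
rewrite (bigID (fun x => x \in points P)) /= big1 ?add0r; last first.
  by move=> x xP; rewrite big1 // => y; rewrite xP.
have := @near_boundary R F G (points I) t ell P.1 P.2 a b F0 G0 a0 b0 (uniq_points I) It (ps0 Pps) hF hG.
rewrite -surjective_pairing; apply: le_trans.
apply: ler_sum => x xP; apply: sumr_le_sub; rewrite ?uniq_points //; last first.
  by move=> y; rewrite divr_ge0 ?mulr_ge0 ?ler0n.
move=> y yP /andP[_ ->]; rewrite yP andbT.
by rewrite It // (cell_subset Pps).
Qed.

Lemma kernel_diff (P : zinterval) (x y : int) : x \in points P ->
  (P.2 <= `|x - y|)%N -> (P.2 <= `|P.1 - y|)%N ->
  `|kernel R x y - kernel R P.1 y| <= 2 * P.2%:R / `|x - y|%N%:R ^+ 2.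
Proof.
rewrite mem_pointsE => xP d1 d2.
have P0 : (0 < P.2)%N by lia.
have xy0 : (x - y)%:~R != 0 :> R by rewrite intr_eq0; lia.
have py0 : (P.1 - y)%:~R != 0 :> R by rewrite intr_eq0; lia.
have -> : kernel R x y - kernel R P.1 y = (P.1 - x)%:~R * (kernel R x y * kernel R P.1 y).
  rewrite /kernel.
  have E : (P.1 - x)%:~R = (P.1 - y)%:~R - (x - y)%:~R :> R.
    by rewrite -intrB; congr (_%:~R); lia.
  rewrite E; move: xy0 py0; move: ((x - y)%:~R : R) ((P.1 - y)%:~R : R) => p q p0 q0.
  by field; rewrite p0 q0.
rewrite !normrM !norm_kernel -intr_norm -abszE.
have d0 : 0 < `|x - y|%N%:R :> R by rewrite ltr0n; lia.
have e0 : 0 < `|P.1 - y|%N%:R :> R by rewrite ltr0n; lia.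
have h1 : `|x - y|%N%:R <= 2 * `|P.1 - y|%N%:R :> R by rewrite -natrM ler_nat; lia.
have h2 : (`|P.1 - x|%N)%:R <= P.2%:R :> R by rewrite ler_nat; lia.
rewrite (_ : 2 * _ / _ = P.2%:R * (2 / `|x - y|%N%:R ^+ 2)); last by rewrite mulrCA mulrA.
apply: ler_pM; rewrite ?mulr_ge0 ?invr_ge0 ?ler0n //.
rewrite expr2 invfM mulrCA ler_wpM2l ?invr_ge0 ?ler0n //.
by rewrite -(invrK 2) -invfM lef_pV2 ?posrE // ?mulr_gt0 // mulrC ler_pdivrMr // mulrC.
Qed.

Lemma sum_average f (P : zinterval) : P \in ps ->
  \sum_(x <- points P) (f x - cell_average ps f x) = 0.
Proof.
move=> Pps; rewrite sumrB.
rewrite [X in _ - X](_ : _ = \sum_(x <- points P) (\sum_(z <- points P) f z) / P.2%:R); last first.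
  apply: eq_big_seq => x xP.
  by rewrite /cell_average (cell_eq Pps xP).
rewrite big_const_seq count_predT size_points iter_addr_0 -[X in _ - X]mulr_natr divfK ?subrr //.
by rewrite pnatr_eq0 -lt0n ps0.
Qed.

Lemma sum_norm_average f :
  \sum_(x <- points I) `|cell_average ps f x| <= \sum_(x <- points I) `|f x|.
Proof.
rewrite !sum_cells; apply: ler_sum_seq => P Pps _.
apply: (@le_trans _ _ (\sum_(x <- points P) (\sum_(z <- points P) `|f z|) / P.2%:R)).
  apply: ler_sum_seq => x xP _.
  rewrite /cell_average (cell_eq Pps xP) normrM normfV (ger0_norm (ler0n _ _)).
  by rewrite ler_wpM2r ?invr_ge0 ?ler0n // ler_norm_sum.
rewrite big_const_seq count_predT size_points iter_addr_0 -[leLHS]mulr_natr divfK //.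
by rewrite pnatr_eq0 -lt0n ps0.
Qed.

(** On each cell [G] minus its average has mean zero, so the kernel may be replaced
by its difference with the value at the left end of the cell, which is of order
length over distance squared; the tail of [F] is then summed by [tail_sum]. *)
Lemma separated_oscillation (F G : int -> R) (a B : R) : 0 <= a ->
  ball_bounded (points I) t (fun x => len x) (fun y => `|F y|) a ->
  \sum_(x <- points I) `|G x| <= B ->
  `|\sum_(x <- points I) \sum_(y <- points I | separated (cell ps x) (cell ps y))
      F y * (G x - cell_average ps G x) * kernel R x y| <= 16 * a * B.
Proof.
move=> a0 hF hB.
have -> : \sum_(x <- points I) \sum_(y <- points I | separated (cell ps x) (cell ps y))
      F y * (G x - cell_average ps G x) * kernel R x y =
  \sum_(P <- ps) \sum_(x <- points P) \sum_(y <- points I | separated P (cell ps y))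
      F y * (G x - cell_average ps G x) * (kernel R x y - kernel R P.1 y).
  rewrite sum_cells; apply: eq_big_seq => P Pps.
  transitivity (\sum_(x <- points P) \sum_(y <- points I | separated P (cell ps y))
      F y * (G x - cell_average ps G x) * kernel R x y).
    apply: eq_big_seq => x xP.
    by rewrite (cell_eq Pps xP).
  rewrite exchange_big [RHS]exchange_big /=; apply: eq_bigr => y _.
  under [RHS]eq_bigr => x _ do rewrite mulrBr.
  rewrite sumrB -mulr_suml -mulr_sumr sum_average // mulr0 mul0r subr0.
  by [].
apply: (@le_trans _ _ (\sum_(P <- ps) \sum_(x <- points P)
   8 * a * (`|G x| + `|cell_average ps G x|))); last first.
  rewrite -sum_cells -mulr_sumr big_split /=.
  have := sum_norm_average G; set A := \sum_(_ <- _) _ => hA.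
  rewrite (_ : 16 * a * B = 8 * a * (B + B)); last by ring.
  by rewrite ler_wpM2l ?mulr_ge0 // lerD // (le_trans hA).
apply: (le_trans (ler_norm_sum _ _ _)).
apply: ler_sum_seq => P Pps _.
apply: (le_trans (ler_norm_sum _ _ _)).
apply: ler_sum_seq => x xP _.
apply: (le_trans (ler_norm_sum _ _ _)).
have P0 : (0 < P.2)%N by apply: ps0.
have P0R : 0 < P.2%:R :> R by rewrite ltr0n.
have xI := cell_subset Pps xP.
apply: (@le_trans _ _ (\sum_(y <- t | (P.2 <= `|x - y|)%N)
   (`|G x| + `|cell_average ps G x|) * (2 * P.2%:R) * (`|F y| / `|x - y|%N%:R ^+ 2))).
  apply: (@le_trans _ _ (\sum_(y <- points I | separated P (cell ps y))
   (`|G x| + `|cell_average ps G x|) * (2 * P.2%:R) * (`|F y| / `|x - y|%N%:R ^+ 2))).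
    apply: ler_sum_seq => y yI sep.
    rewrite [leLHS]normrM [ `|F y * _|]normrM.
    have dd : (P.2 <= `|x - y|)%N && (P.2 <= `|P.1 - y|)%N.
      have /andP[_ yc] := cellP yI.
      by have := separated_dist xP yc sep; rewrite geq_max -andbA => /and3P[-> _ ->].
    have /andP[d1 d2] := dd.
    rewrite (_ : (_ + _) * _ * _ = `|F y| * (`|G x| + `|cell_average ps G x|) *
       (2 * P.2%:R / `|x - y|%N%:R ^+ 2)); last by rewrite !mulrA; ring.
    apply: ler_pM => //; first by rewrite ler_wpM2l // ler_normB.
    exact: kernel_diff.
  apply: sumr_le_sub; rewrite ?uniq_points // => y.
  move=> yI sep; rewrite It //=.
  have /andP[_ yc] := cellP yI.
  by have := separated_dist xP yc sep; rewrite geq_max -andbA => /and3P[-> _ _].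
rewrite -mulr_sumr.
have := @tail_sum R (fun y => `|F y|) t x P.2 a P0 a0 (fun _ => normr_ge0 _).
move=> H.
apply: (@le_trans _ _ ((`|G x| + `|cell_average ps G x|) * (2 * P.2%:R) * (4 * a / P.2%:R))).
  apply: ler_wpM2l; first by rewrite !mulr_ge0 ?addr_ge0 ?ler0n.
  by apply: H => m Pm; apply: hF => //; rewrite (cell_eq Pps xP).
by apply: le_of_eq; field; rewrite gt_eqF.
Qed.

(** Truncating at the length of [J] makes the forms of an interval and of its
cells comparable: their difference contains the pairs at distance at least the
length of the cell of [x]. *)
Definition truncated_form (F G : int -> R) (J : zinterval) : R :=
  \sum_(x <- points J) \sum_(y <- points (triple J) | (`|x - y| < J.2)%N)
    F y * G x * kernel R x y.

Lemma sum_truncated_form (F G : int -> R) :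
  \sum_(P <- ps) truncated_form F G P =
  \sum_(x <- points I) \sum_(y <- t | (`|x - y| < len x)%N) F y * G x * kernel R x y.
Proof.
rewrite sum_cells; apply: eq_big_seq => P Pps.
rewrite /truncated_form; apply: eq_big_seq => x xP.
rewrite (cell_eq Pps xP); apply: eq_sum_sub; rewrite ?uniq_points // => y.
have /andP[h1 h2] := cell_le Pps.
by move: xP; rewrite /t !mem_pointsE /=; lia.
Qed.

Lemma norm_term (F G : int -> R) x y :
  `|F y * G x * kernel R x y| = `|F y| * `|G x| / `|x - y|%N%:R.
Proof. by rewrite normrM [ `|F y * _|]normrM norm_kernel. Qed.

(** Pairs in a common cell cancel by antisymmetry of the kernel, the functions being
constant there; the other pairs that are not separated lie within three lengths
of one of their cells and fall under [near_cells]. *)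
Lemma step_near (f g : int -> R) (a b : R) : 0 <= a -> 0 <= b ->
  (forall x, x \in points I -> `|f x| <= a) -> (forall x, x \in points I -> `|g x| <= b) ->
  (forall x y, x \in points I -> y \in points I -> cell ps x = cell ps y -> f x = f y) ->
  (forall x y, x \in points I -> y \in points I -> cell ps x = cell ps y -> g x = g y) ->
  `|\sum_(x <- points I) \sum_(y <- points I | ~~ separated (cell ps x) (cell ps y))
      f y * g x * kernel R x y| <= 1728 * a * b * I.2%:R.
Proof.
move=> a0 b0 fa gb fc gc.
pose D := \sum_(x <- points I) \sum_(y <- points I | cell ps x == cell ps y)
      f y * g x * kernel R x y.
have D0 : D = 0.
  have DN : D = - D.
    rewrite {1}/D (eq_bigr (fun x => \sum_(y <- points I)
       if cell ps x == cell ps y then f y * g x * kernel R x y else 0)); last first.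
      by move=> x _; rewrite big_mkcond.
    rewrite exchange_big /= /D -sumrN; apply: eq_big_seq => x xI.
    rewrite -sumrN [RHS]big_mkcond; apply: eq_big_seq => y yI; rewrite eq_sym.
    case: eqP => // e; rewrite kernelC (fc y x) // (gc y x) //; ring.
  by move: DN; lra.
have near (c d : R) : 0 <= c -> 0 <= d -> \sum_(x <- points I)
    \sum_(y <- points I | (x \notin points (cell ps y)) && (1 <= `|x - y| <= 3 * len y)%N)
      c * d / (`|x - y|%N)%:R <= 864 * c * d * I.2%:R.
  move=> c0 d0.
  have cnt (e : R) : 0 <= e -> forall (x : int) m, x \in points I -> (1 <= m)%N ->
     \sum_(y <- t | (`|x - y| <= m)%N) e <= 3 * e * m%:R.
    move=> e0 x m _ m1; rewrite (eq_bigr (fun=> e * 1)); last by move=> *; rewrite mulr1.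
    rewrite -mulr_sumr [3 * e]mulrC -mulrA ler_wpM2l //.
    apply: (le_trans (count_ball R x m (uniq_points _))).
    by rewrite -natrM ler_nat; lia.
  apply: (le_trans (@near_cells (fun=> c) (fun=> d) (fun=> 1%N) (3 * c) (3 * d)
     (fun=> c0) (fun=> d0) _ _ (cnt _ c0) (cnt _ d0))); rewrite ?mulr_ge0 //.
  by apply: le_of_eq; ring.
rewrite (_ : \sum_(x <- points I) _ = D + \sum_(x <- points I) \sum_(y <- points I |
    ~~ separated (cell ps x) (cell ps y) && (cell ps x != cell ps y)) f y * g x * kernel R x y).
  rewrite D0 add0r; apply: (@le_trans _ _ (\sum_(x <- points I)
    (\sum_(y <- points I | (x \notin points (cell ps y)) && (1 <= `|x - y| <= 3 * len y)%N)
      a * b / (`|x - y|%N)%:R + \sum_(y <- points I | (y \notin points (cell ps x)) && (1 <= `|y - x| <= 3 * len x)%N)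
      b * a / (`|y - x|%N)%:R))); last first.
    rewrite big_split /= [X in _ + X](_ : _ = \sum_(y <- points I)
        \sum_(x <- points I | (y \notin points (cell ps x)) && (1 <= `|y - x| <= 3 * len x)%N)
      b * a / (`|y - x|%N)%:R); last first.
      rewrite (eq_bigr (fun x => \sum_(y <- points I) if (y \notin points (cell ps x)) && (1 <= `|y - x| <= 3 * len x)%N then b * a / (`|y - x|%N)%:R else 0)); last by move=> x _; rewrite big_mkcond.
      by rewrite exchange_big /=; apply: eq_bigr => y _; rewrite [RHS]big_mkcond.
    have -> : 1728 * a * b * I.2%:R = 864 * a * b * I.2%:R + 864 * b * a * I.2%:R :> R by ring.
    by apply: lerD; apply: near.
  apply: (le_trans (ler_norm_sum _ _ _)).
  apply: ler_sum_seq => x xI _.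
  apply: (le_trans (ler_norm_sum _ _ _)).
  apply: (@le_trans _ _ (\sum_(y <- points I |
     ~~ separated (cell ps x) (cell ps y) && (cell ps x != cell ps y)) a * b / (`|x - y|%N)%:R)).
    apply: ler_sum_seq => y yI _.
    by rewrite norm_term ler_wpM2r ?invr_ge0 ?ler0n // ler_pM ?fa ?gb.
  rewrite [X in _ <= _ + X](eq_bigr (fun y => a * b / (`|x - y|%N)%:R)); last first.
    by move=> y _; rewrite (mulrC b) distnC.
  apply: sum_cover; first by move=> y; rewrite divr_ge0 ?mulr_ge0 ?ler0n.
  move=> y yI /andP[ns ne].
  have /andP[xc xx] := cellP xI; have /andP[yc yy] := cellP yI.
  have xny : x \notin points (cell ps y) by apply: contra ne => /(cell_eq yc) ->.
  have ynx : y \notin points (cell ps x) by apply: contra ne => /(cell_eq xc) ->.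
  rewrite xny ynx /=; move: ns xx yy xny ynx; rewrite /separated !mem_pointsE.
  move: (cell ps x) (cell ps y) => P Q; lia.
rewrite /D -big_split; apply: eq_bigr => x _ /=.
rewrite (bigID (fun y => cell ps x == cell ps y)) /=; congr (_ + _).
rewrite big_seq_cond [RHS]big_seq_cond; apply: eq_bigl => y.
have [yI|//] := boolP (y \in points I); case: eqP => [->|_]; rewrite ?andbF ?andbT //=.
have [h _ _ _ _] := cell_bounds yI; rewrite /separated maxnn; move: (cell ps y) h => P; lia.
Qed.

Lemma cell_average_bound (G : int -> R) (b : R) x : x \in points I ->
  ball_bounded (points I) t (fun x => len x) (fun y => `|G y|) b ->
  `|cell_average ps G x| <= b.
Proof.
move=> xI hG; have [l0 _ _ _ _] := cell_bounds xI.
rewrite /cell_average normrM normfV (ger0_norm (ler0n _ _)) ler_pdivrMr ?ltr0n //.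
apply: (le_trans (ler_norm_sum _ _ _)); apply: le_trans (hG x (len x) xI (leqnn _)).
have /andP[cx xc] := cellP xI.
apply: sumr_le_sub; rewrite ?uniq_points // => z zc _.
rewrite It ?(cell_subset cx) //=; move: xc zc; rewrite !mem_pointsE.
by move: (cell ps x) => P; lia.
Qed.

Lemma sum_norm_bound (G : int -> R) (b : R) : (0 < I.2)%N ->
  ball_bounded (points I) t (fun x => len x) (fun y => `|G y|) b ->
  \sum_(x <- points I) `|G x| <= b * I.2%:R.
Proof.
move=> I0 hG; have xI : I.1 \in points I by rewrite mem_pointsE; lia.
apply: le_trans (hG I.1 I.2 xI _); last first.
  by have [_ _ _] := cell_bounds xI; move: (cell ps I.1) => P; lia.
apply: sumr_le_sub; rewrite ?uniq_points // => z zI _; rewrite It //=.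
by move: zI; rewrite mem_pointsE; lia.
Qed.

(** Locked, like [ball_constant] below, to keep the numeral away from normalization:
only its sign and its independence of the functions matter. *)
Definition local_constant : R := locked 2200.

Lemma local_constant_ge0 : 0 <= local_constant.
Proof. by rewrite /local_constant -lock ler0n. Qed.

(** The core of the stopping time argument. The difference of the truncated forms
splits into the pairs in separated cells and the rest, which is at a bounded
multiple of the cell lengths or next to the ends of [I]. For separated cells write
[F G = F (G - g) + (F - f) g + f g] with [f], [g] the averages over the cells: the
first two terms have mean zero on the cells, and the last one is Hilbert's
inequality for functions bounded by [a] and [b], up to the pairs that are not
separated. The hypotheses say that the maximal averages of [F] and [G] at
scales above the cells are at most [a] and [b]. *)
Lemma local_estimate (F G : int -> R) (a b : R) : (0 < I.2)%N -> 0 <= a -> 0 <= b ->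
  ball_bounded (points I) t (fun x => len x) (fun y => `|F y|) a ->
  ball_bounded (points I) t (fun x => len x) (fun y => `|G y|) b ->
  `|truncated_form F G I - \sum_(P <- ps) truncated_form F G P| <= local_constant * a * b * I.2%:R.
Proof.
rewrite /local_constant -lock.
move=> I0 a0 b0 hF hG.
pose T x y := F y * G x * kernel R x y.
pose f := cell_average ps F; pose g := cell_average ps G.
pose sep x y := separated (cell ps x) (cell ps y).
pose c (x y : int) := (len x <= `|x - y| < I.2)%N && ~~ ((y \in points I) && sep x y).
have L0 : 0 <= I.2%:R :> R by rewrite ler0n.
have diffE : truncated_form F G I - \sum_(P <- ps) truncated_form F G P =
    \sum_(x <- points I) \sum_(y <- points I | sep x y) T x y +
    \sum_(x <- points I) \sum_(y <- t | c x y) T x y.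
  rewrite sum_truncated_form /truncated_form -sumrB -big_split /=.
  apply: eq_big_seq => x xI.
  have [l0 xl xr cl cr] := cell_bounds xI.
  rewrite (bigID (fun y => `|x - y| < len x)%N) /=.
  rewrite (eq_bigl (fun y => `|x - y| < len x)%N); last first.
    by move=> y; move: cl cr; case: (cell ps x) => p w /=; lia.
  rewrite addrAC subrr add0r (bigID (fun y => (y \in points I) && sep x y)) /=.
  congr (_ + _); last by apply: eq_bigl => y; rewrite /c -leqNgt [X in X && _]andbC.
  apply: eq_sum_sub; rewrite ?uniq_points // => y.
  have [yI|yI] /= := boolP (y \in points I); rewrite ?andbF // It //=.
  have [sxy|//] := boolP (sep x y); rewrite ?andbF ?andbT //.
  have /andP[_ yc] := cellP yI; have /andP[_ xc] := cellP xI.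
  have /andP[] := separated_dist xc yc sxy.
  move: xI yI; rewrite !mem_pointsE; lia.
have far1 : `|\sum_(x <- points I) \sum_(y <- points I | sep x y)
      F y * (G x - g x) * kernel R x y| <= 16 * a * (b * I.2%:R).
  by apply: separated_oscillation => //; apply: sum_norm_bound.
have far2 : `|\sum_(x <- points I) \sum_(y <- points I | sep x y)
      (F y - f y) * g x * kernel R x y| <= 16 * (3 * b) * (a * I.2%:R).
  rewrite (_ : \sum_(x <- points I) _ = - \sum_(x <- points I) \sum_(y <- points I | sep x y)
      g y * (F x - f x) * kernel R x y).
    rewrite normrN; apply: separated_oscillation; rewrite ?mulr_ge0 //.
      move=> x m xI lm; apply: (@le_trans _ _ (\sum_(y <- t | (`|x - y| <= m)%N) b * 1)).
        apply: ler_sum => y _; rewrite mulr1.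
        have [yI|yI] := boolP (y \in points I); first exact: cell_average_bound.
        by rewrite /g cell_average_out // normr0.
      rewrite -mulr_sumr [3 * b]mulrC -mulrA ler_wpM2l //.
      apply: (le_trans (count_ball R x m (uniq_points _))).
      have [l0 _ _ _ _] := cell_bounds xI.
      by rewrite -natrM ler_nat; lia.
    exact: sum_norm_bound.
  rewrite (eq_bigr (fun x => \sum_(y <- points I)
      if sep x y then (F y - f y) * g x * kernel R x y else 0)); last first.
    by move=> x _; rewrite big_mkcond.
  rewrite exchange_big /= -sumrN; apply: eq_bigr => x _.
  rewrite -big_mkcond -sumrN; apply: eq_big => y; first by rewrite /sep separatedC.
  by rewrite kernelC => _; ring.
have far3 : `|\sum_(x <- points I) \sum_(y <- points I | sep x y)
      f y * g x * kernel R x y| <= 20 * a * b * I.2%:R + 1728 * a * b * I.2%:R.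
  have -> : \sum_(x <- points I) \sum_(y <- points I | sep x y) f y * g x * kernel R x y =
     \sum_(x <- points I) \sum_(y <- points I) f y * g x * kernel R x y -
     \sum_(x <- points I) \sum_(y <- points I | ~~ sep x y) f y * g x * kernel R x y.
    rewrite -sumrB; apply: eq_bigr => x _.
    by rewrite [X in X - _](bigID (sep x)) /= addrK.
  have fa x : x \in points I -> `|f x| <= a by move=> xI; apply: cell_average_bound.
  have gb x : x \in points I -> `|g x| <= b by move=> xI; apply: cell_average_bound.
  apply: (le_trans (ler_normB _ _)); apply: lerD.
    have := @hilbert_inequality R I.1 I.2 I0 f g a b a0 b0; rewrite -surjective_pairing.
    exact.
  apply: step_near => // x y _ _ e; rewrite /f /g /cell_average e //.
have near : `|\sum_(x <- points I) \sum_(y <- t | c x y) T x y| <=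
    (96 * a * b * I.2%:R + 96 * a * b * I.2%:R) + (3 * a * (b * I.2%:R) + 96 * a * b * I.2%:R).
  pose U x y := `|F y| * `|G x| / `|x - y|%N%:R.
  have U0 x y : 0 <= U x y by rewrite /U divr_ge0 ?mulr_ge0.
  (* The two outer thirds of the tripled interval: the points [y] outside [I]. *)
  pose Ql : zinterval := (I.1 - I.2%:Z, I.2); pose Qr : zinterval := (I.1 + I.2%:Z, I.2).
  have side (Q : zinterval) : Q.2 = I.2 -> (forall x, x \in points I -> x \notin points Q) ->
     \sum_(x <- points I) \sum_(y <- t | (y \in points Q) && (len x <= `|x - y| <= 3 * I.2)%N)
       U x y <= 96 * a * b * I.2%:R.
    move=> Q2 IQ.
    have := @near_boundary R (fun y => `|F y|) (fun y => `|G y|) (points I) t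
      (fun x => len x) Q.1 Q.2 a b (fun _ => normr_ge0 _) (fun _ => normr_ge0 _) a0 b0
      (uniq_points I) It.
    rewrite Q2 => /(_ I0 hF hG); apply: le_trans.
    apply: le_of_eq.
    rewrite -Q2 -surjective_pairing big_seq_cond [RHS]big_seq_cond.
    apply: eq_bigl => x; case xI: (x \in points I) => //=; by rewrite IQ.
  apply: (@le_trans _ _ (\sum_(x <- points I)
    ((\sum_(y <- t | (y \in points Ql) && (len x <= `|x - y| <= 3 * I.2)%N) U x y +
      \sum_(y <- t | (y \in points Qr) && (len x <= `|x - y| <= 3 * I.2)%N) U x y) +
     (\sum_(y <- t | (len x <= `|x - y| <= 3 * len x)%N) U x y +
      \sum_(y <- points I | (x \notin points (cell ps y)) &&
          (len x <= `|x - y| <= 3 * len y)%N) U x y)))).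
    apply: (le_trans (ler_norm_sum _ _ _)).
    apply: ler_sum_seq => x xI _.
    apply: (le_trans (ler_norm_sum _ _ _)).
    under eq_bigr => y _ do rewrite /T norm_term.
    rewrite [X in _ + (_ + X)](@eq_sum_sub _ _ (points I) t _ (fun y => (y \in points I) &&
        ((x \notin points (cell ps y)) && (len x <= `|x - y| <= 3 * len y)%N)));
      rewrite ?uniq_points //; last first.
      by move=> y; case yI: (y \in points I); rewrite /= ?andbF // It.
    apply: (le_trans (@sum_cover _ t _
       (fun y => ((y \in points Ql) && (len x <= `|x - y| <= 3 * I.2)%N) ||
                 ((y \in points Qr) && (len x <= `|x - y| <= 3 * I.2)%N))
       (fun y => (len x <= `|x - y| <= 3 * len x)%N || ((y \in points I) &&
         ((x \notin points (cell ps y)) && (len x <= `|x - y| <= 3 * len y)%N))) _ _ _)) => //.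
      move=> y yt /andP[/andP[h1 h2] h3].
      rewrite h1 /=; have [yI|yI] /= := boolP (y \in points I); last first.
        by move: xI yI yt h2; rewrite /t /Ql /Qr !mem_pointsE /=; clear; move: (cell ps x) => P; lia.
      move: h3; rewrite yI /= => ns.
      have /andP[xc xx] := cellP xI; have /andP[yc yy] := cellP yI.
      have [e|ne] := eqVneq (cell ps x) (cell ps y).
        have d : (`|x - y| <= 3 * len x)%N.
          by move: xx yy; rewrite -e !mem_pointsE; clear; move: (cell ps x) => P; lia.
        by rewrite d orbT.
      have -> /= : x \notin points (cell ps y) by apply: contra ne => /(cell_eq yc) ->.
      by have /orP[->|->] := near_dist xx yy ns; rewrite !orbT.
    by apply: lerD; apply: sum_cover => //.
  rewrite !big_split /=; apply: lerD; apply: lerD.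
  - by apply: side => // x; rewrite /Ql /Qr !mem_pointsE /=; clear; lia.
  - by apply: side => // x; rewrite /Ql /Qr !mem_pointsE /=; clear; lia.
  - apply: (@le_trans _ _ (\sum_(x <- points I) 3 * a * `|G x|)); last first.
      by rewrite -mulr_sumr ler_wpM2l ?mulr_ge0 // sum_norm_bound.
    apply: ler_sum_seq => x xI _.
    have [l0 _ _ _ _] := cell_bounds xI.
    have l0R : 0 < (len x)%:R :> R by rewrite ltr0n.
    apply: (@le_trans _ _ (\sum_(y <- t | (`|x - y| <= 3 * len x)%N)
        (`|G x| / (len x)%:R) * `|F y|)).
      rewrite [leRHS](bigID (fun y => len x <= `|x - y|)%N) /=; apply: ler_wpDr.
        by apply: sumr_ge0 => y _; rewrite mulr_ge0 // divr_ge0.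
      rewrite [leRHS](eq_bigl (fun y => len x <= `|x - y| <= 3 * len x)%N); last by move=> y; rewrite andbC.
      apply: ler_sum => y /andP[h _]; rewrite /U.
      rewrite (_ : _ / _ * _ = `|F y| * `|G x| * (len x)%:R^-1); last by ring.
      rewrite ler_wpM2l ?mulr_ge0 // lef_pV2 ?posrE ?ler_nat // ltr0n.
      exact: leq_trans l0 h.
    rewrite -mulr_sumr; apply: (le_trans (ler_wpM2l _ (hF x (3 * len x)%N xI _))).
    + by rewrite divr_ge0.
    + by rewrite leq_pmull.
    + by rewrite natrM; apply: le_of_eq; field; rewrite gt_eqF.
  - by apply: near_cells.
rewrite diffE.
have -> : \sum_(x <- points I) \sum_(y <- points I | sep x y) T x y =
   (\sum_(x <- points I) \sum_(y <- points I | sep x y) F y * (G x - g x) * kernel R x y +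
    \sum_(x <- points I) \sum_(y <- points I | sep x y) (F y - f y) * g x * kernel R x y) +
    \sum_(x <- points I) \sum_(y <- points I | sep x y) f y * g x * kernel R x y.
  rewrite -!big_split; apply: eq_bigr => x _ /=; rewrite -!big_split /=.
  by apply: eq_bigr => y _; rewrite /T; ring.
apply: (le_trans (ler_normD _ _)).
apply: (le_trans (lerD (le_trans (ler_normD _ _) (lerD (le_trans (ler_normD _ _)
   (lerD far1 far2)) far3)) near)).
have := mulr_ge0 (mulr_ge0 a0 b0) L0; set X := a * b * I.2%:R => X0.
rewrite -subr_ge0 (_ : _ - _ = 97 * X); first by rewrite mulr_ge0.
rewrite /X; ring.
Qed.

End Cells.
End Localization.

(** * Stopping times and sparse families *)
Section Sparse.
Variable R : realType.

(** [average] for a nonnegative real function. *)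
Definition raverage (r : R) (u : int -> R) (I : zinterval) : R :=
  (((triple I).2)%:R^-1 * \sum_(x <- points (triple I)) u x `^ r) `^ r^-1.

Definition mass (H : int -> R) (I : zinterval) : R := \sum_(x <- points (triple I)) H x.

Lemma mass_ge0 H I : (forall x, 0 <= H x) -> 0 <= mass H I.
Proof. by move=> H0; apply: sumr_ge0. Qed.

Lemma raverage_ge0 r u I : 0 <= raverage r u I.
Proof. exact: powR_ge0. Qed.

(** Instead of Hölder's inequality: [t <= 1 + t ^ r] for [t = u x / A], where
[A] is the average. The factor 6 is twice the dilation 3. *)
Lemma sum_le_raverage (r : R) (u : int -> R) (I : zinterval) :
  1 < r -> (forall x, 0 <= u x) -> (0 < I.2)%N ->
  mass u I <= 6 * I.2%:R * raverage r u I.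
Proof.
move=> r1 u0 I0; have r0 : 0 < r by lra.
have rn0 : r != 0 by rewrite gt_eqF.
pose n : R := ((triple I).2)%:R.
have n0 : 0 < n by rewrite ltr0n /=; lia.
pose S := \sum_(x <- points (triple I)) u x `^ r.
have S0 : 0 <= S by apply: sumr_ge0 => x _; rewrite powR_ge0.
pose A := raverage r u I.
have Ar : n * A `^ r = S.
  rewrite /A /raverage -powRrM mulVf // powRr1 ?mulr_ge0 ?invr_ge0 ?ler0n //.
  by rewrite mulrA mulfV ?mul1r // gt_eqF.
have A0 : 0 <= A := raverage_ge0 r u I.
rewrite /mass; have [Az|Anz] := eqVneq A 0.
  rewrite -/A Az mulr0 big_seq_cond big1 // => x /andP[xt _].
  have Sz : S == 0 by rewrite -Ar Az powR0 // mulr0.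
  move: Sz; rewrite psumr_eq0; last by move=> y _; rewrite powR_ge0.
  by move=> /allP/(_ x xt); rewrite powR_eq0 => /andP[/eqP ->].
have Ap : 0 < A by rewrite lt_def Anz.
apply: (@le_trans _ _ (\sum_(x <- points (triple I)) A * (1 + u x `^ r / A `^ r))).
  apply: ler_sum => x _; rewrite -ler_pdivrMl //.
  have -> : u x `^ r / A `^ r = (A^-1 * u x) `^ r.
    by rewrite powRM ?invr_ge0 // -(powR_inv1 A0) powRAC powR_inv1 ?powR_ge0 // mulrC.
  have z0 : 0 <= A^-1 * u x by rewrite mulr_ge0 ?invr_ge0.
  move: (A^-1 * u x) z0 => z z0.
  have [z1|z1] := leP z 1; first by rewrite ler_wpDr ?powR_ge0.
  by apply: ler_wpDl => //; rewrite le1r_powR // ltW.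
rewrite -mulr_sumr big_split /= -mulr_suml.
have -> : \sum_(x <- points (triple I)) (1:R) = n.
  by rewrite big_const_seq count_predT size_points iter_addr_0.
rewrite -/S -Ar -/A mulfK ?(gt_eqF (powR_gt0 _ Ap)) //; apply: le_of_eq.
by rewrite /n /= natrM; ring.
Qed.

Lemma raverage_mono r u I (c : R) (J : zinterval) : 1 < r -> (forall x, 0 <= u x) ->
  (0 < I.2)%N -> (0 < J.2)%N -> 1 <= c ->
  I.2%:R * mass (fun x => u x `^ r) J <= c * J.2%:R * mass (fun x => u x `^ r) I ->
  raverage r u J <= c * raverage r u I.
Proof.
move=> r1 u0 I0 J0 c1 H; have r0 : 0 < r by lra.
have c0 : 0 <= c by lra.
have H0 K : 0 <= mass (fun x => u x `^ r) K by apply: mass_ge0 => x; rewrite powR_ge0.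
apply: (@le_trans _ _ (c `^ r^-1 * raverage r u I)); last first.
  rewrite ler_wpM2r ?raverage_ge0 // ler1_powR // invf_le1 // ltW //.
rewrite /raverage -!/(mass (fun x => u x `^ r) _) -powRM //; last first.
  by rewrite mulr_ge0 ?invr_ge0 ?ler0n ?H0.
have m0 K : 0 <= (triple K).2%:R^-1 * mass (fun x => u x `^ r) K.
  by rewrite mulr_ge0 ?invr_ge0 ?ler0n ?H0.
apply: ge0_ler_powR; rewrite ?nnegrE ?invr_ge0 ?(ltW r0) ?m0 ?mulr_ge0 ?m0 //.
have I0R : 0 < I.2%:R :> R by rewrite ltr0n.
have J0R : 0 < J.2%:R :> R by rewrite ltr0n.
move: H; rewrite /= !natrM.
move: (mass _ I) (mass _ J) => X Y H.
move: (I.2%:R) (J.2%:R) I0R J0R H => i j i0 j0 H.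
rewrite -subr_ge0 (_ : _ - _ = (c * j * X - i * Y) / (3 * i * j)); last first.
  by field; rewrite !gt_eqF.
by rewrite divr_ge0 ?subr_ge0 // !mulr_ge0 // ltW.
Qed.

(** It is the triples that must meet, since averages are taken over triples. *)
Definition meets (I J : zinterval) : bool :=
  ((triple I).1 < (triple J).1 + (triple J).2%:Z) && ((triple J).1 < (triple I).1 + (triple I).2%:Z).

(** Greedy selection: keep the longest interval and discard all those whose
triples meet its triple. *)
Lemma vitali_selection (ps : seq zinterval) : (forall P : zinterval, P \in ps -> (0 < P.2)%N) ->
  exists ts, [/\ {subset ts <= ps}, uniq (flatten (map (points \o triple) ts)) &
    forall J : zinterval, J \in ps -> exists2 K : zinterval, K \in ts & (J.2 <= K.2)%N && meets J K].
Proof.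
have [n] := ubnP (size ps); elim: n ps => // n IH ps szn pos.
case ps0: (ps == [::]); first by exists [::]; move/eqP: ps0 => ->.
have [J Jps Jmax] : exists2 J : zinterval, J \in ps & forall K : zinterval, K \in ps -> (K.2 <= J.2)%N.
  elim: ps {IH szn pos} ps0 => // P ps IH _.
  case ps0: (ps == [::]).
    by exists P; rewrite ?mem_head // (eqP ps0) => K; rewrite inE => /eqP ->.
  have [J Jps Jm] := IH ps0; have [h|h] := leqP P.2 J.2.
    by exists J => [|K]; rewrite inE ?Jps ?orbT // => /predU1P[-> //|/Jm].
  exists P; rewrite ?mem_head // => K; rewrite inE => /predU1P[-> //|/Jm h'].
  exact: leq_trans h' (ltnW h).
pose ps' := [seq K <- ps | ~~ meets K J].
have ps'ps : {subset ps' <= ps} by move=> K; rewrite mem_filter => /andP[].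
have [] := IH ps'.
- rewrite -ltnS; apply: leq_trans szn; rewrite ltnS size_filter.
  rewrite -(count_predC (fun K => ~~ meets K J) ps) -addn1 leq_add2l -has_count.
  by apply/hasP; exists J => //=; rewrite negbK /meets /=; have := pos _ Jps; lia.
- by move=> K /ps'ps; apply: pos.
move=> ts [tsps uts cov]; exists (J :: ts); split.
- by move=> K; rewrite inE => /predU1P[->//|/tsps/ps'ps].
- rewrite /= cat_uniq uniq_points uts andbT /=; apply/hasPn => x.
  move=> /flattenP[_ /mapP[K Kts ->] xK] /=; apply/negP.
  have : ~~ meets K J by have := tsps _ Kts; rewrite mem_filter => /andP[].
  by move: xK; rewrite /comp !mem_pointsE /meets; lia.
- move=> K Kps; have [KJ|KJ] := boolP (meets K J).
    by exists J; rewrite ?mem_head // KJ Jmax.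
  have [|L Lts h] := cov K; first by rewrite mem_filter KJ.
  by exists L => //; rewrite inE Lts orbT.
Qed.

(** The intervals are covered by the sevenfold dilations of a subfamily with disjoint
triples, whence the factor 7. *)
Lemma vitali_bound (H : int -> R) (I : zinterval) (ps : seq zinterval) (c : R) :
  (forall x, 0 <= H x) -> 0 <= c ->
  (forall P : zinterval, P \in ps -> (0 < P.2)%N) -> uniq (flatten (map points ps)) ->
  (forall P, P \in ps -> {subset points (triple P) <= points (triple I)}) ->
  (forall P, P \in ps -> c * P.2%:R <= mass H P) ->
  c * \sum_(P <- ps) P.2%:R <= 7 * mass H I.
Proof.
move=> H0 c0 pos ups sub big.
have [ts [tsps uts cov]] := vitali_selection pos.
pose dil (K : zinterval) : zinterval := (K.1 - (3 * K.2)%N%:Z, (7 * K.2)%N).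
have szE (f : zinterval -> zinterval) (qs : seq zinterval) :
    size (flatten (map (points \o f) qs)) = (\sum_(K <- qs) (f K).2)%N.
  elim: qs => [|K qs IH] /=; first by rewrite big_nil.
  by rewrite size_cat IH big_cons size_points.
have h1 : (\sum_(P <- ps) P.2 <= \sum_(K <- ts) 7 * K.2)%N.
  rewrite -(szE id) -(szE dil); apply: uniq_leq_size => // x.
  move=> /flattenP[_ /mapP[P Pps ->] xP].
  have [K Kts /andP[PK mt]] := cov P Pps; apply/flattenP.
  exists (points (dil K)); first exact: (map_f (points \o dil)).
  by move: xP mt; rewrite /meets !mem_pointsE /=; lia.
apply: (@le_trans _ _ (c * \sum_(K <- ts) 7 * K.2%:R)).
  have -> : \sum_(K <- ts) 7 * K.2%:R = (\sum_(K <- ts) 7 * K.2)%N%:R :> R.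
    by rewrite natr_sum; apply: eq_bigr => K _; rewrite natrM.
  by rewrite ler_wpM2l // -natr_sum ler_nat.
rewrite -mulr_sumr mulrCA ler_wpM2l // mulr_sumr.
apply: (@le_trans _ _ (\sum_(K <- ts) mass H K)).
  by rewrite big_seq_cond [leRHS]big_seq_cond; apply: ler_sum => K /andP[/tsps/big].
rewrite /mass (_ : \sum_(K <- ts) _ = \sum_(x <- flatten (map (points \o triple) ts)) H x).
  apply: sumr_le_sub => // x /flattenP[_ /mapP[K Kts ->] xK] _.
  by rewrite andbT; apply: sub xK; apply: tsps.
by rewrite big_flatten big_map.
Qed.

(** The maximal dyadic subintervals of [{b, ..., b + 2 ^ k - 1}] that satisfy [Q],
completed by single points to a partition. A pair [(b, k)] encodes the interval
of length [2 ^ k] that starts at [b]; it need not be aligned with the multiples of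
[2 ^ k]. *)
Fixpoint dyadic_cells (Q : int -> nat -> bool) (k : nat) (b : int) : seq (int * nat) :=
  if Q b k then [:: (b, k)]
  else if k is k'.+1 then
    dyadic_cells Q k' b ++ dyadic_cells Q k' (b + (2 ^ k')%N%:Z)
  else [:: (b, 0%N)].

Definition ival (N : int * nat) : zinterval := (N.1, (2 ^ N.2)%N).

Lemma points_cat b m n : points (b, (m + n)%N) = points (b, m) ++ points (b + m%:Z, n).
Proof.
rewrite /points /= iotaD map_cat add0n; congr (_ ++ _).
rewrite -{1}[m]addn0 iotaDl -map_comp; apply: eq_map => i /=; lia.
Qed.

Lemma flatten_dyadic_cells Q k b :
  flatten (map points (map ival (dyadic_cells Q k b))) = points (b, (2 ^ k)%N).
Proof.
elim: k b => [|k IH] b /=; case: (Q b _) => /=; rewrite ?cats0 //.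
by rewrite !map_cat flatten_cat !IH -points_cat addnn -mul2n expnS.
Qed.

Lemma dyadic_cells_prop Q k b N : N \in dyadic_cells Q k b ->
  (N.2 <= k)%N /\ (Q N.1 N.2 \/ N.2 = 0%N).
Proof.
elim: k b => [|k IH] b /=.
  by case Qb: (Q b 0%N); rewrite inE => /eqP ->; split=> //; [left|right].
case Qb: (Q b k.+1); first by rewrite inE => /eqP ->; split=> //; left.
by rewrite mem_cat => /orP[] /IH[h1 h2]; split=> //; apply: leqW.
Qed.

(** Maximality: no strictly larger dyadic interval that contains a cell satisfies
[Q]. *)
Lemma dyadic_cells_ancestor Q k b (N : int * nat) j (x : int) : N \in dyadic_cells Q k b ->
  x \in points (ival N) -> (N.2 < j <= k)%N ->
  exists b' : int, [/\ b <= b', b' + (2 ^ j)%N%:Z <= b + (2 ^ k)%N%:Z,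
     b' <= x < b' + (2 ^ j)%N%:Z & ~~ Q b' j].
Proof.
elim: k b => [|k IH] b /=; first by move=> _ _; lia.
case Qb: (Q b k.+1); first by rewrite inE => /eqP -> _ /=; lia.
move=> NC xN /andP[Nj]; rewrite leq_eqVlt => /predU1P[jk|].
  exists b; rewrite jk; split=> //; last by rewrite Qb.
  have : x \in points (b, (2 ^ k.+1)%N); last by rewrite mem_points.
  rewrite -(flatten_dyadic_cells Q) /= Qb; apply/flattenP; exists (points (ival N)) => //.
  by do 2! apply: map_f.
rewrite ltnS => jk; move: NC; rewrite mem_cat => /orP[] NC.
- have [|b' [h1 h2 h3 h4]] := IH _ NC xN; first by rewrite Nj.
  by exists b'; split=> //; rewrite expnS; lia.
- have [|b' [h1 h2 h3 h4]] := IH _ NC xN; first by rewrite Nj.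
  by exists b'; split=> //; rewrite ?expnS; lia.
Qed.

Lemma uniq_flatten_filter (T T' : eqType) (f : T -> seq T') (p : pred T) s :
  uniq (flatten (map f s)) -> uniq (flatten (map f (seq.filter p s))).
Proof.
elim: s => //= x s IH; rewrite cat_uniq => /and3P[ux /hasPn dis us].
case: (p x); rewrite /= ?IH // cat_uniq ux IH // andbT; apply/hasPn => y yf.
apply: dis; move: yf => /flattenP[_ /mapP[z zs ->] yz]; apply/flattenP.
by exists (f z) => //; apply: map_f; move: zs; rewrite mem_filter => /andP[].
Qed.

Lemma uniq_flatten_sub (T T' : eqType) (f g : T -> seq T') s :
  uniq (flatten (map f s)) -> (forall x, x \in s -> uniq (g x)) ->
  (forall x, x \in s -> {subset g x <= f x}) -> uniq (flatten (map g s)).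
Proof.
elim: s => //= x s IH; rewrite cat_uniq => /and3P[ux /hasPn dis us] ug sub.
rewrite cat_uniq ug ?mem_head // IH //; last 2 first.
- by move=> y ys; apply: ug; rewrite inE ys orbT.
- by move=> y ys; apply: sub; rewrite inE ys orbT.
rewrite andbT /=; apply/hasPn => y /flattenP[_ /mapP[z zs ->] yz].
have zs' : z \in x :: s by rewrite inE zs orbT.
have /dis : y \in flatten (map f s).
  by apply/flattenP; exists (f z); [apply: map_f|apply: sub yz].
by apply: contra => /sub; apply; rewrite mem_head.
Qed.

Lemma uniq_flatten_uniq (T T' : eqType) (f : T -> seq T') s :
  uniq (flatten (map f s)) -> (forall x, x \in s -> f x != [::]) -> uniq s.
Proof.
elim: s => //= x s IH; rewrite cat_uniq => /and3P[_ /hasPn dis us] ne.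
rewrite IH ?andbT //; last by move=> y ys; apply: ne; rewrite inE ys orbT.
apply/negP => xs; have := ne x (mem_head _ _).
case fx: (f x) => [//|y l] _.
have /dis/negP : y \in flatten (map f s).
  by apply/flattenP; exists (f x); [apply: map_f|rewrite fx mem_head].
by apply; rewrite fx mem_head.
Qed.

Section Stopping.
Variables (r : R) (u v : int -> R).
Hypotheses (u0 : forall x, 0 <= u x) (v0 : forall x, 0 <= v x).

(** The average of [w ^ r] over the triple of [J] exceeds 28 times that over the
triple of [I]. With the Vitali factor 7 this leaves a quarter of the length of
[I] for the heavy intervals of each of [u] and [v], hence half of it in all. *)
Definition heavy (w : int -> R) (I J : zinterval) : bool :=
  28 * J.2%:R * mass (fun x => w x `^ r) I < I.2%:R * mass (fun x => w x `^ r) J.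

Definition stopping (b : int) (k : nat) (b' : int) (j : nat) : bool :=
  (j < k)%N && (heavy u (ival (b, k)) (ival (b', j)) || heavy v (ival (b, k)) (ival (b', j))).

Definition stop_cells (b : int) (k : nat) := dyadic_cells (stopping b k) k b.

(** Single points may belong to the partition without having been stopped. *)
Definition stops (b : int) (k : nat) : seq (int * nat) :=
  [seq N <- stop_cells b k | stopping b k N.1 N.2].

Lemma ival_gt0 N : (0 < (ival N).2)%N.
Proof. by rewrite expn_gt0. Qed.

Lemma stop_cells_gt0 b k (P : zinterval) :
  P \in map ival (stop_cells b k) -> (0 < P.2)%N.
Proof. by move=> /mapP[N _ ->]; exact: ival_gt0. Qed.

Lemma stop_cells_perm b k :
  perm_eq (flatten (map points (map ival (stop_cells b k)))) (points (ival (b, k))).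
Proof. by rewrite flatten_dyadic_cells. Qed.

Lemma stop_cell_le b k N : N \in stop_cells b k ->
  (b <= N.1) && (N.1 + (2 ^ N.2)%N%:Z <= b + (2 ^ k)%N%:Z).
Proof.
move=> NC.
exact: (cell_le (@stop_cells_gt0 b k) (stop_cells_perm b k) (map_f ival NC)).
Qed.

Lemma heavy_sum (w : int -> R) b k : (forall x, 0 <= w x) ->
  \sum_(N <- stop_cells b k | heavy w (ival (b, k)) (ival N)) (2 ^ N.2)%:R <=
  (2 ^ k)%:R / 4 :> R.
Proof.
move=> w0; set I := ival (b, k).
pose H x := w x `^ r; have H0 x : 0 <= H x by rewrite powR_ge0.
have m0 : 0 <= mass H I by apply: mass_ge0.
have sub N : N \in stop_cells b k -> {subset points (triple (ival N)) <= points (triple I)}.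
  by move=> /stop_cell_le => h x; move: h; rewrite !mem_pointsE /=; lia.
have I0 : 0 < I.2%:R :> R by rewrite ltr0n ival_gt0.
have [mz|mnz] := eqVneq (mass H I) 0.
  rewrite big_seq_cond big1 ?divr_ge0 // => N /andP[NC]; rewrite /heavy -/H mz mulr0.
  have : mass H (ival N) <= mass H I.
    by apply: sumr_le_sub; rewrite ?uniq_points // => x xN _; rewrite (sub _ NC).
  by rewrite mz => h1 h2; have := mulr_ge0_le0 (ltW I0) h1; rewrite leNgt h2.
have mp : 0 < mass H I by rewrite lt_def mnz.
rewrite -big_filter; set ns := seq.filter _ _.
have := @vitali_bound H I (map ival ns) (28 * mass H I / I.2%:R) H0.
rewrite big_map => vb.
rewrite -(ler_pM2l (_ : 0 < 28 * mass H I / I.2%:R)); last first.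
  by rewrite divr_gt0 // mulr_gt0.
apply: (le_trans (vb _ _ _ _ _)).
- by rewrite divr_ge0 ?mulr_ge0 // ltW.
- by move=> P /mapP[N _ ->]; exact: ival_gt0.
- rewrite -map_comp; apply: uniq_flatten_filter; rewrite map_comp.
  by rewrite flatten_dyadic_cells uniq_points.
- by move=> P /mapP[N]; rewrite mem_filter => /andP[_ /sub h] ->.
- move=> P /mapP[N]; rewrite mem_filter => /andP[/ltW hN _] ->.
  rewrite mulrAC ler_pdivrMr // [leRHS]mulrC; apply: le_trans hN.
  by apply: le_of_eq; rewrite mulrAC.
- apply: le_of_eq.
  by rewrite /I /=; move: I0 => /= I0; field; rewrite gt_eqF.
Qed.

Lemma stops_sum b k : \sum_(N <- stops b k) (2 ^ N.2)%:R <= (2 ^ k)%:R / 2 :> R.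
Proof.
rewrite big_filter (_ : _ / 2 = (2 ^ k)%:R / 4 + (2 ^ k)%:R / 4); last by field.
apply: le_trans (lerD (heavy_sum b k u0) (heavy_sum b k v0)).
by apply: sum_cover => // N _; rewrite /stopping => /andP[_]; case: N.
Qed.

(** The part of the interval that is not covered by the stopped subintervals: at
least half of it, and disjoint from the major parts of all later generations. *)
Definition major (b : int) (k : nat) : seq int :=
  [seq x <- points (ival (b, k)) | x \notin flatten (map points (map ival (stops b k)))].

Lemma size_major b k : (2 ^ k <= 2 * size (major b k))%N.
Proof.
set fl := flatten (map points (map ival (stops b k))).
have h : (size (seq.filter (mem fl) (points (ival (b, k)))) <= size fl)%N.
  apply: uniq_leq_size; first by rewrite filter_uniq ?uniq_points.
  by move=> x; rewrite mem_filter => /andP[].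
have h2 : (2 * size fl <= 2 ^ k)%N.
  have -> : size fl = (\sum_(N <- stops b k) 2 ^ N.2)%N.
    rewrite /fl; elim: (stops b k) => [|N ns IH] /=; first by rewrite big_nil.
    by rewrite size_cat IH big_cons size_points.
  have := stops_sum b k; rewrite -natr_sum ler_pdivlMr // -natrM ler_nat mulnC.
  exact.
have := count_predC (mem fl) (points (ival (b, k))).
rewrite size_points -!size_filter /major -/fl /=.
rewrite (@eq_filter _ (predC (mem fl)) (fun x => x \notin fl)) //.
by move: h h2; move: (size _) (size _) (size _) => p q p'; lia.
Qed.

(** The stopped intervals of the first [n] generations below [N]. Lengths decrease
strictly, so [k] generations exhaust an interval of length [2 ^ k]. *)
Fixpoint collection (n : nat) (N : int * nat) : seq (int * nat) :=
  N :: if n is n'.+1 then flatten (map (collection n') (stops N.1 N.2)) else [::].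

Let major' (N : int * nat) := major N.1 N.2.

Lemma flatten_map_flatten (T T' : Type) (f : T -> seq T') (ss : seq (seq T)) :
  flatten (map f (flatten ss)) = flatten (map (fun s => flatten (map f s)) ss).
Proof. by elim: ss => //= s ss IH; rewrite map_cat flatten_cat IH. Qed.

Lemma collection_major n N :
  uniq (flatten (map major' (collection n N))) /\
  {subset flatten (map major' (collection n N)) <= points (ival N)}.
Proof.
have um M : uniq (major' M) by rewrite filter_uniq ?uniq_points.
have sm M : {subset major' M <= points (ival M)}.
  by case: M => b k x; rewrite mem_filter => /andP[].
elim: n N => [|n IH] N /=; first by rewrite cats0; split; [apply: um|apply: sm].
rewrite flatten_map_flatten -map_comp.
set rest := flatten _.
have subr : {subset rest <= flatten (map points (map ival (stops N.1 N.2)))}.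
  move=> x /flattenP[_ /mapP[M Ms ->] /= xM]; apply/flattenP.
  exists (points (ival M)); first by do 2! apply: map_f.
  by have [_] := IH M; apply.
split.
  rewrite cat_uniq um /=; apply/andP; split.
    by apply/hasPn => x /subr xr; rewrite /= mem_filter xr.
  apply: (@uniq_flatten_sub _ _ (points \o ival)).
  - apply: uniq_flatten_filter; rewrite map_comp flatten_dyadic_cells.
    exact: uniq_points.
  - by move=> M _; have [] := IH M.
  - by move=> M _; have [] := IH M.
move=> x; rewrite mem_cat => /orP[/sm //|/subr].
move=> /flattenP[_ /mapP[P /mapP[M Ms ->] ->]].
move: Ms; rewrite mem_filter => /andP[_ /stop_cell_le].
by rewrite !mem_pointsE /=; lia.
Qed.

Lemma major_neq0 N : major' N != [::].
Proof.
have p0 : (0 < 2 ^ N.2)%N by rewrite expn_gt0.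
have := leq_trans p0 (size_major N.1 N.2); rewrite /major' -size_eq0.
by case: (size _).
Qed.

Lemma collection_uniq n N : uniq (collection n N).
Proof.
have [h _] := collection_major n N; apply: uniq_flatten_uniq h _ => M _.
exact: major_neq0.
Qed.

Lemma ival_inj : injective ival.
Proof. by move=> [b k] [b' k'] [-> /eqP]; rewrite eqn_exp2l // => /eqP ->. Qed.

Lemma collection_sparse n N : sparse (4^-1 : R) [set` map ival (collection n N)].
Proof.
(* The exponent is recovered from the length by the logarithm. The size of the
   major part is at least one half of the length, which is strictly more than a
   quarter, as the strict inequality in the definition of sparseness requires. *)
pose E (I : zinterval) : {fset int} := [fset x in major I.1 (trunc_log 2 I.2)]%fset.
have EE M : E (ival M) = [fset x in major' M]%fset by rewrite /E /= trunc_expnK.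
exists E; split.
- move=> I /= /mapP[M _ ->] x; rewrite EE !inE /= => xM.
  by move: xM; rewrite mem_filter => /andP[].
- move=> I /= /mapP[M _ ->]; rewrite EE card_fseq undup_id ?filter_uniq ?uniq_points //=.
  have := size_major M.1 M.2; rewrite -/(major' M) => h.
  rewrite mulrC ltr_pdivrMr // -natrM ltr_nat.
  have : (0 < 2 ^ M.2)%N by rewrite expn_gt0.
  by move: h; move: (2 ^ M.2)%N (size _) => p q; lia.
- move=> I J /= /mapP[M Mc ->] /mapP[M' Mc' ->] ne; rewrite !EE.
  apply/fdisjointP => x; rewrite !inE /= => xM; apply/negP => xM'; apply: ne.
  have [h _] := collection_major n N.
  by rewrite (uniq_flatten_inj h Mc Mc' xM xM').
Qed.

End Stopping.

(** The smallest [D] is the supremum of the sparse forms, possibly infinite. Working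
with an arbitrary upper bound makes every estimate below an inequality between
real numbers and lets one family serve all of them at the end. *)
Definition sparse_bound (c r : R) (u v : int -> R) (D : R) : Prop :=
  forall S : set zinterval, sparse c S ->
    (\esum_(I in S) (raverage r u I * raverage r v I * I.2%:R)%:E <= D%:E)%E.

Lemma sparse_bound_seq c r u v D (s : seq zinterval) : sparse_bound c r u v D ->
  uniq s -> sparse c [set` s] ->
  \sum_(I <- s) raverage r u I * raverage r v I * I.2%:R <= D.
Proof.
move=> H us /H; rewrite esum_fset; last 2 first.
  by apply/finite_seqP; exists s.
  by move=> I _; rewrite lee_fin !mulr_ge0 ?raverage_ge0.
by rewrite -fsbig_seq // sumEFin lee_fin.
Qed.

(** A quantity that is dominated on [I] by the term of [I] plus its values on the
stopped subintervals is dominated by the sparse form of the whole collection. *)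
Lemma sparse_iteration (r : R) (u v : int -> R) (D C : R) (B : int -> nat -> R) :
  1 < r -> (forall x, 0 <= u x) -> (forall x, 0 <= v x) -> 0 <= C ->
  sparse_bound 4^-1 r u v D ->
  (forall b k, B b k <= C * (raverage r u (ival (b, k)) * raverage r v (ival (b, k)) * (2 ^ k)%:R)
     + \sum_(N <- stops r u v b k) B N.1 N.2) ->
  forall b k, B b k <= C * D.
Proof.
move=> r1 u0 v0 C0 HD step b k.
pose term N := raverage r u (ival N) * raverage r v (ival N) * (2 ^ N.2)%:R.
have key n N : (N.2 <= n)%N -> B N.1 N.2 <= C * \sum_(M <- collection r u v n N) term M.
  have lt N' M : M \in stops r u v N'.1 N'.2 -> (M.2 < N'.2)%N.
    by rewrite mem_filter => /andP[/andP[]].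
  elim: n N => [|n IH] [b' k'] /= kn.
    apply: (le_trans (step _ _)); rewrite big_seq1 [X in _ + X]big_seq_cond big1 ?addr0 //.
    by move=> M /andP[/(lt (b', k')) /=]; lia.
  apply: (le_trans (step _ _)); rewrite big_cons mulrDr lerD2l.
  rewrite big_flatten big_map mulr_sumr big_seq_cond [leRHS]big_seq_cond.
  apply: ler_sum => M /andP[/(lt (b', k')) /= h _]; apply: IH; lia.
apply: (le_trans (key k (b, k) (leqnn _))); rewrite ler_wpM2l //.
have := sparse_bound_seq HD _ (@collection_sparse r u v u0 v0 k (b, k)).
rewrite map_inj_uniq; last exact: ival_inj.
by rewrite collection_uniq // big_map; apply.
Qed.

End Sparse.

(** * Sparse bounds for the Hilbert kernel and for the maximal function *)
Section Deterministic.
Variables (R : realType) (r : R) (u v : int -> R) (D : R).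
Hypotheses (r1 : 1 < r) (u0 : forall x, 0 <= u x) (v0 : forall x, 0 <= v x).
Hypothesis HD : sparse_bound 4^-1 r u v D.

Local Notation cells b k := (map ival (stop_cells r u v b k)).

(** The product of 6 from [sum_le_raverage], 28 from [heavy], and 2 for the
rounding of radii to powers of two. *)
Definition ball_constant : R := locked 336.

Lemma ball_constant_ge0 : 0 <= ball_constant.
Proof. by rewrite /ball_constant -lock ler0n. Qed.

(** A ball around [x] that is larger than the cell of [x] sits inside the triple of a
dyadic interval of comparable length that was not stopped. *)
Lemma ball_mass (w : int -> R) b k (x : int) (m : nat) : (forall x, 0 <= w x) ->
  (forall b' j, (j < k)%N -> ~~ stopping r u v b k b' j ->
     ~~ heavy r w (ival (b, k)) (ival (b', j))) ->
  x \in points (ival (b, k)) -> ((cell (cells b k) x).2 <= m)%N ->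
  \sum_(y <- points (triple (ival (b, k))) | (`|x - y| <= m)%N) w y <=
  ball_constant * raverage r w (ival (b, k)) * m%:R.
Proof.
rewrite /ball_constant -lock; move=> w0 Hw xI; set I := ival (b, k); set A := raverage r w I.
have A0 : 0 <= A := raverage_ge0 r w I.
have I0 : (0 < I.2)%N := ival_gt0 (b, k).
have /andP[/mapP[N NC cE] xN] := cellP (@stop_cells_perm R r u v b k) xI.
rewrite cE in xN *; move=> Nm.
have [km|mk] := leqP (2 ^ k)%N m.
  apply: (@le_trans _ _ (mass w I)).
    by apply: sumr_le_sub; rewrite ?uniq_points // => y ->.
  apply: (le_trans (sum_le_raverage r1 w0 I0)).
  apply: (@le_trans _ _ (6 * m%:R * A)).
    by rewrite ler_wpM2r // ler_wpM2l // ler_nat.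
  rewrite -subr_ge0 (_ : _ - _ = 330 * (m%:R * A)); last by ring.
  by rewrite !mulr_ge0 ?ler0n.
pose j := (trunc_log 2 m).+1.
have m0 : (0 < m)%N by apply: leq_trans Nm; rewrite expn_gt0.
have mj : (m < 2 ^ j)%N by rewrite trunc_log_ltn.
have jm : (2 ^ j <= 2 * m)%N by rewrite expnS leq_mul2l trunc_logP.
have Nj : (N.2 < j)%N.
  by rewrite -(@ltn_exp2l 2) // (leq_ltn_trans Nm).
have jk : (j <= k)%N.
  rewrite /j ltnNge; apply/negP => h; move: mk; rewrite ltnNge; apply/negP; rewrite negbK.
  by apply: leq_trans (trunc_logP (isT : 1 < 2)%N m0); rewrite leq_exp2l.
have [|b' [h1 h2 h3 h4]] := dyadic_cells_ancestor NC xN (j := j); first by rewrite Nj.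
pose J := ival (b', j).
have AJ : raverage r w J <= 28 * A.
  apply: raverage_mono => //; first exact: (ival_gt0 (b', j)); first by lra.
  move: jk; rewrite leq_eqVlt => /predU1P[jk|jk]; last first.
    by have := Hw _ _ jk h4; rewrite /heavy -leNgt.
  have bE : b' = b by move: h1 h2; rewrite jk; lia.
  rewrite /J /I jk bE; rewrite -mulrA; apply: le_trans (_ : _ <= 1 * _) _; first by rewrite mul1r.
  rewrite ler_wpM2r //; last by lra.
  by rewrite mulr_ge0 // mass_ge0 // => y; rewrite powR_ge0.
apply: (@le_trans _ _ (mass w J)).
  apply: sumr_le_sub; rewrite ?uniq_points // => y _ h; rewrite andbT mem_pointsE /=.
  by move: h h3 mj; lia.
apply: (le_trans (sum_le_raverage r1 w0 (ival_gt0 (b', j)))).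
apply: (@le_trans _ _ (6 * (2 * m)%N%:R * (28 * A))).
  apply: ler_pM; rewrite ?mulr_ge0 ?raverage_ge0 //.
  by rewrite ler_wpM2l // ler_nat.
by rewrite natrM; apply: le_of_eq; ring.
Qed.

Lemma ball_mass_u b k (x : int) (m : nat) :
  x \in points (ival (b, k)) -> ((cell (cells b k) x).2 <= m)%N ->
  \sum_(y <- points (triple (ival (b, k))) | (`|x - y| <= m)%N) u y <=
  ball_constant * raverage r u (ival (b, k)) * m%:R.
Proof. by apply: ball_mass => // b' j jk; rewrite /stopping jk negb_or => /andP[]. Qed.

Lemma ball_mass_v b k (x : int) (m : nat) :
  x \in points (ival (b, k)) -> ((cell (cells b k) x).2 <= m)%N ->
  \sum_(y <- points (triple (ival (b, k))) | (`|x - y| <= m)%N) v y <=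
  ball_constant * raverage r v (ival (b, k)) * m%:R.
Proof. by apply: ball_mass => // b' j jk; rewrite /stopping jk negb_or => /andP[]. Qed.

(** The cells that were not stopped are single points, where the quantities that are
iterated vanish. *)
Lemma sum_stops (B : int * nat -> R) b k : (forall b', B (b', 0%N) = 0) ->
  \sum_(N <- stop_cells r u v b k) B N = \sum_(N <- stops r u v b k) B N.
Proof.
move=> B0; rewrite /stops big_filter [RHS]big_mkcond; apply: eq_big_seq => N NC; case: ifP => // /negbT h.
have [_ [h'|e]] := dyadic_cells_prop NC; first by rewrite h' in h.
by case: N e {NC h} => b' j /= ->; rewrite B0.
Qed.

(** On a single point the truncation leaves only the diagonal, where the kernel is
zero; so the iteration of [local_estimate] ends. *)
Lemma hilbert_sparse (F G : int -> R) b k :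
  (forall x, `|F x| <= u x) -> (forall x, `|G x| <= v x) ->
  `|truncated_form F G (ival (b, k))| <= local_constant R * ball_constant * ball_constant * D.
Proof.
move=> Fu Gv.
have C0 : 0 <= local_constant R * ball_constant * ball_constant :> R by rewrite !mulr_ge0 ?local_constant_ge0 ?ball_constant_ge0.
apply: (sparse_iteration (B := fun b k => `|truncated_form F G (ival (b, k))|) r1 u0 v0 C0 HD).
move=> {}b {}k; set I := ival (b, k).
have le : `|truncated_form F G I - \sum_(P <- cells b k) truncated_form F G P|
   <= local_constant R * (ball_constant * raverage r u I) * (ball_constant * raverage r v I) * I.2%:R.
  apply: local_estimate; rewrite ?mulr_ge0 ?raverage_ge0 ?ball_constant_ge0 //.
  - exact: stop_cells_gt0.
  - exact: stop_cells_perm.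
  - exact: ival_gt0.
  - by move=> x m xI lm; apply: le_trans (ball_mass_u xI lm); apply: ler_sum.
  - by move=> x m xI lm; apply: le_trans (ball_mass_v xI lm); apply: ler_sum.
rewrite -(@sum_stops (fun N => `|truncated_form F G (ival (N.1, N.2))|)); last first.
  move=> b'; rewrite /truncated_form big1 ?normr0 // => x _.
  rewrite big1 // => y /=; rewrite expn0 ltnS leqn0 => h.
  have -> : y = x by move: h; lia.
  by rewrite kernelxx mulr0.
rewrite -(subrK (\sum_(P <- cells b k) truncated_form F G P) (truncated_form F G I)).
apply: (le_trans (ler_normD _ _)); apply: lerD.
  apply: (le_trans le); apply: le_of_eq.
  rewrite /I /=; move: (local_constant R) ball_constant => c1 c2.
  by move: (raverage r u _) (raverage r v _) => p q; ring.
rewrite big_map; apply: (le_trans (ler_norm_sum _ _ _)).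
by apply: ler_sum => -[].
Qed.

Definition ball_average (w : int -> R) (j : nat) (x : int) : R :=
  ((2 ^ j)%:R)^-1 * \sum_(y <- points (x - (2 ^ j)%N%:Z, (2 * 2 ^ j).+1)) w y.

(** The linearized maximal function, with an arbitrary choice of the scale at each
point. Scales above the cell of [x] are controlled by [ball_mass], and those
below it are left to the iteration. *)
Lemma maximal_sparse (scale : int -> nat) b k :
  \sum_(x <- points (ival (b, k)))
     v x * (if (scale x < k)%N then ball_average u (scale x) x else 0) <= 6 * ball_constant * D.
Proof.
pose B b k := \sum_(x <- points (ival (b, k)))
     v x * (if (scale x < k)%N then ball_average u (scale x) x else 0).
have C0 : 0 <= 6 * ball_constant :> R by rewrite mulr_ge0 ?ball_constant_ge0.
apply: (sparse_iteration (B := B) r1 u0 v0 C0 HD).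
move=> {}b {}k; set I := ival (b, k).
rewrite -(@sum_stops (fun N => B N.1 N.2)); last first.
  by move=> b'; rewrite /B big1 // => x _; rewrite mulr0.
have A0 : 0 <= raverage r u I := raverage_ge0 r u I.
apply: (@le_trans _ _ (\sum_(x <- points I) v x * (ball_constant * raverage r u I) +
   \sum_(N <- stop_cells r u v b k) B N.1 N.2)); last first.
  have A1 : 0 <= ball_constant * raverage r u I by rewrite mulr_ge0 ?ball_constant_ge0.
  rewrite lerD2r -mulr_suml.
  apply: (@le_trans _ _ (mass v I * (ball_constant * raverage r u I))).
    rewrite ler_wpM2r //.
    apply: sumr_le_sub; rewrite ?uniq_points // => x; rewrite !mem_pointsE /=; lia.
  apply: (le_trans (ler_wpM2r _ (sum_le_raverage r1 v0 (ival_gt0 (b, k))))) => //.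
  apply: le_of_eq; rewrite /I /=; move: ball_constant => c.
  by move: (raverage r u _) (raverage r v _) => p q; ring.
have -> : \sum_(N <- stop_cells r u v b k) B N.1 N.2 =
   \sum_(P <- cells b k) \sum_(x <- points P)
      v x * (if (2 ^ scale x < P.2)%N then ball_average u (scale x) x else 0).
  rewrite big_map; apply: eq_bigr => N _; rewrite /B; case: N => b' j /=.
  by apply: eq_bigr => x _; rewrite ltn_exp2l.
have -> : \sum_(P <- cells b k) \sum_(x <- points P)
      v x * (if (2 ^ scale x < P.2)%N then ball_average u (scale x) x else 0) =
  \sum_(x <- points I) v x * (if (2 ^ scale x < (cell (cells b k) x).2)%N
     then ball_average u (scale x) x else 0).
  rewrite (sum_cells (@stop_cells_perm R r u v b k)).
  apply: eq_big_seq => P PC.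
  apply: eq_big_seq => x xP.
  by rewrite (cell_eq (@stop_cells_perm R r u v b k) PC xP).
rewrite -big_split /B /=; apply: ler_sum_seq => x xI _; rewrite -mulrDr ler_wpM2l //.
case: ltnP => [sk|_]; last first.
  case: ifP => _; rewrite ?addr_ge0 ?mulr_ge0 ?invr_ge0 ?ler0n ?ball_constant_ge0 ?sumr_ge0 //.
case: ltnP => [_|cs]; first by rewrite lerDr mulr_ge0 ?ball_constant_ge0.
rewrite addr0 /ball_average ler_pdivrMl ?ltr0n ?expn_gt0 // mulrC.
apply: le_trans (ball_mass_u xI cs).
apply: sumr_le_sub; rewrite ?uniq_points // => y.
have : (2 ^ scale x < 2 ^ k)%N by rewrite ltn_exp2l.
by move: xI; rewrite !mem_pointsE /=; lia.
Qed.

End Deterministic.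

(** * Fourier analysis on a cyclic group *)
Section Fourier.
Variable R : realType.
Local Notation C := R[i].

(** Iterated square roots of [-1]. *)
Lemma pow2_prim_root k : exists z : C, (2 ^ k.+1).-primitive_root z.
Proof.
have [z zk] : exists z : C, z ^+ (2 ^ k) = -1.
  elim: k => [|k [z zk]]; first by exists (-1); rewrite expr1.
  by exists (sqrtC z); rewrite expnS exprM sqrtCK.
have z1 : z ^+ (2 ^ k.+1) = 1 by rewrite expnSr exprM zk sqrrN expr1n.
have [m mz] := prim_order_exists (expn_gt0 2 k.+1 : (0 < 2 ^ k.+1)%N) z1.
move=> /(dvdn_pfactor _ _ (isT : prime 2)) [j jk mE].
move: jk; rewrite leq_eqVlt => /predU1P[jk|jk]; first by exists z; rewrite -jk -mE.
have : z ^+ (2 ^ k) = 1.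
  apply/eqP; rewrite -(prim_order_dvd mz) mE dvdn_exp2l //.
by rewrite zk => /eqP; rewrite eqr_oppLR -subr_eq0 opprK -[1 + 1]/(2%:R) pnatr_eq0.
Qed.

Section Roots.
Variables (N : nat) (z : C).
Hypothesis zN : N.-primitive_root z.

Let N0 : (0 < N)%N.
Proof. exact: prim_order_gt0 zN. Qed.

Lemma prim_root_norm : `|z| = 1.
Proof.
apply/eqP; rewrite -(@pexpr_eq1 _ _ N) -?normrX ?(prim_expr_order zN) ?normr1 //.
Qed.

Let z0 : z != 0.
Proof. by rewrite -normr_eq0 prim_root_norm oner_eq0. Qed.

Lemma conj_root (m : int) : Num.conj (z ^ m) = z ^ (- m).
Proof.
have -> : z ^ (- m) = (z ^ m)^-1 by rewrite invr_expz.
have n1 : `|z ^ m| = 1.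
  by case: m => n; rewrite ?NegzE -?invr_expz ?normfV -?exprnP normrX prim_root_norm expr1n ?invr1.
by rewrite [RHS]invC_norm n1 expr1n invr1 mul1r.
Qed.

Lemma root_orthogonality (m : int) : (`|m| < N)%N ->
  \sum_(xi < N) (z ^ m) ^+ xi = (N * (m == 0))%:R.
Proof.
move=> mN; have [->|m0] := eqVneq m 0.
  rewrite expr0z muln1 (eq_bigr (fun=> 1)); last by move=> xi _; rewrite expr1n.
  by rewrite sumr_const card_ord.
rewrite muln0 mulr0n.
have w1 : z ^ m != 1.
  suff : z ^+ `|m| != 1.
    by case: m {mN m0} => n //=; rewrite NegzE -invr_expz -exprnP invr_eq1.
  by rewrite -(prim_order_dvd zN) gtnNdvd // absz_gt0.
have := subrX1 (z ^ m) N.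
have -> : (z ^ m) ^+ N = 1.
  by rewrite exprnP exprzAC -exprnP (prim_expr_order zN) exp1rz.
rewrite subrr => /esym/eqP; rewrite mulf_eq0 subr_eq0 (negbTE w1) /= => /eqP.
exact.
Qed.

(** The discrete Fourier transform modulo [N] sees functions supported in a set of
diameter less than [N] faithfully. *)
Lemma parseval (s : seq int) (F : int -> R) : uniq s ->
  (forall x y, x \in s -> y \in s -> (`|x - y| < N)%N) ->
  \sum_(xi < N) `|\sum_(x <- s) (F x)%:C * (z ^ x) ^+ xi| ^+ 2 =
  (N%:R * \sum_(x <- s) F x ^+ 2)%:C.
Proof.
move=> us sN.
have E xi : `|\sum_(x <- s) (F x)%:C * (z ^ x) ^+ xi| ^+ 2 =
    \sum_(x <- s) \sum_(y <- s) (F x * F y)%:C * (z ^ (x - y)) ^+ xi.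
  rewrite normCK rmorph_sum mulr_suml; apply: eq_bigr => x _.
  rewrite mulr_sumr; apply: eq_bigr => y _.
  rewrite rmorphM rmorphXn /= conj_root.
  have -> : Num.conj (F y)%:C = (F y)%:C by exact: conjc_real.
  by rewrite rmorphM /= expfzDr // exprMn; ring.
under eq_bigr => xi _ do rewrite E.
rewrite exchange_big /= rmorphM /= rmorph_sum mulr_sumr.
apply: eq_big_seq => x xs.
rewrite exchange_big /= (bigD1_seq x) //= -mulr_sumr root_orthogonality; last by rewrite subrr.
rewrite subrr eqxx muln1 big_seq_cond big1 ?addr0; last first.
  move=> y /andP[ys yx]; rewrite -mulr_sumr root_orthogonality; last exact: sN.
  by rewrite subr_eq0 eq_sym (negbTE yx) muln0 mulr0.
by rewrite mulrC rmorph_nat expr2.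
Qed.

End Roots.

Lemma cauchy_schwarz (I : finType) (a b : I -> R) :
  (\sum_i a i * b i) ^+ 2 <= (\sum_i a i ^+ 2) * (\sum_i b i ^+ 2).
Proof.
have : 0 <= \sum_i \sum_j (a i * b j - a j * b i) ^+ 2.
  by apply: sumr_ge0 => i _; apply: sumr_ge0 => j _; rewrite sqr_ge0.
rewrite (_ : \sum_i _ = 2 * ((\sum_i a i ^+ 2) * (\sum_i b i ^+ 2) - (\sum_i a i * b i) ^+ 2)).
  by rewrite pmulr_rge0 // subr_ge0.
have E (p q : I -> R) : (\sum_i p i) * (\sum_i q i) = \sum_i \sum_j p i * q j.
  by rewrite mulr_suml; apply: eq_bigr => i _; rewrite mulr_sumr.
rewrite expr2 !E mulrBr mulrDl !mul1r.
rewrite [X in _ + X - _]exchange_big /= mulr_sumr -big_split -sumrB /=.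
apply: eq_bigr => i _.
by rewrite mulr_sumr -big_split -sumrB /=; apply: eq_bigr => j _; ring.
Qed.

Definition convolver (c : nat -> R) (ns : seq nat) (m : int) : R :=
  \sum_(n <- ns) c n * (m == n%:Z)%:R.

(** The norm on [l^2] of a convolution is at most the supremum of its Fourier
transform, even when only the frequencies modulo [N] are sampled: [N] exceeds
every difference that occurs, so the cyclic convolution agrees with the one on the
integers. *)
Lemma fourier_bound (N : nat) (z : C) (c : nat -> R) (ns : seq nat) (s t : seq int)
    (F G : int -> R) (mu : R) :
  N.-primitive_root z -> uniq s -> uniq t ->
  (forall x y, x \in s -> y \in s -> (`|x - y| < N)%N) ->
  (forall x y, x \in t -> y \in t -> (`|x - y| < N)%N) ->
  (forall x y n, x \in s -> y \in t -> n \in ns -> (absz (x - y - n%:Z)%R < N)%N) ->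
  (forall xi, (xi < N)%N -> `|\sum_(n <- ns) (c n)%:C * (z ^+ n) ^+ xi| <= mu%:C) ->
  `|\sum_(x <- s) \sum_(y <- t) convolver c ns (x - y) * F y * G x| <=
  mu * (Num.sqrt (\sum_(y <- t) F y ^+ 2) * Num.sqrt (\sum_(x <- s) G x ^+ 2)).
Proof.
move=> zN us ut sN tN stN hmu.
have N0 : (0 < N)%N := prim_order_gt0 zN.
have NR : 0 < N%:R :> R by rewrite ltr0n.
have z0 : z != 0 by rewrite -normr_eq0 (prim_root_norm zN) oner_eq0.
have mu0 : 0 <= mu by rewrite -lecR; apply: le_trans (hmu 0%N N0); rewrite normr_ge0.
set S := \sum_(x <- s) _.
pose m (xi : nat) : C := \sum_(n <- ns) (c n)%:C * (z ^+ n) ^+ xi.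
pose Fh (xi : nat) : C := \sum_(y <- t) (F y)%:C * (z ^ y) ^+ xi.
(* The reflection of [G] produces the conjugate frequency. *)
pose Gh (xi : nat) : C := \sum_(x <- map -%R s) (G (- x))%:C * (z ^ x) ^+ xi.
have SE : (N%:R * S)%:C = \sum_(xi < N) m xi * Fh xi * Gh xi.
  have E (xi : nat) : m xi * Fh xi * Gh xi = \sum_(x <- s) \sum_(y <- t) \sum_(n <- ns)
      (c n * F y * G x)%:C * (z ^ (n%:Z + y - x)) ^+ xi.
    rewrite /Gh big_map mulr_sumr; apply: eq_bigr => x _.
    rewrite /Fh mulr_sumr mulr_suml; apply: eq_bigr => y _.
    rewrite /m !mulr_suml; apply: eq_bigr => n _.
    rewrite opprK !rmorphM /= !expfzDr // !exprMn -exprnP; ring.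
  under [RHS]eq_bigr => xi _ do rewrite E.
  rewrite exchange_big /= rmorphM /= rmorph_sum mulr_sumr.
  apply: eq_big_seq => x xs.
  rewrite exchange_big /= rmorph_sum mulr_sumr.
  apply: eq_big_seq => y yt.
  rewrite exchange_big /= /convolver !mulr_suml rmorph_sum mulr_sumr.
  apply: eq_big_seq => n nns.
  rewrite -mulr_sumr (root_orthogonality zN); last first.
    by have := stN _ _ _ xs yt nns; lia.
  rewrite (_ : (n%:Z + y - x == 0) = (x - y == n%:Z)); last by apply/eqP/eqP; lia.
  by rewrite natrM !rmorphM /= !rmorph_nat; ring.
have nc (w : C) : `|w| = (Normc.normc w)%:C by [].
have hF : \sum_(xi < N) Normc.normc (Fh xi) ^+ 2 = N%:R * \sum_(y <- t) F y ^+ 2.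
  have := parseval zN F ut tN; under eq_bigr => xi _ do rewrite nc -rmorphXn.
  by rewrite -rmorph_sum => -[].
have hG : \sum_(xi < N) Normc.normc (Gh xi) ^+ 2 = N%:R * \sum_(x <- s) G x ^+ 2.
  have us' : uniq (map -%R s) by rewrite map_inj_uniq //; exact: oppr_inj.
  have := parseval zN (fun x => G (- x)) us' _; under eq_bigr => xi _ do rewrite nc -rmorphXn.
  rewrite -rmorph_sum big_map; under [X in N%:R * X]eq_bigr => x _ do rewrite opprK.
  move=> h; have /h[] // : forall x y : int, x \in map -%R s -> y \in map -%R s -> (`|x - y| < N)%N.
  by move=> x y /mapP[x' xs ->] /mapP[y' ys ->]; have := sN _ _ xs ys; lia.
rewrite -(ler_pM2l NR) -[X in X * `|S|](gtr0_norm NR) -normrM.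
apply: (@le_trans _ _ (mu * \sum_(xi < N) Normc.normc (Fh xi) * Normc.normc (Gh xi))).
  rewrite -lecR.
  have -> : (`|N%:R * S|)%:C = `|(N%:R * S)%:C| :> C by rewrite normc_def /= expr0n addr0 sqrtr_sqr.
  rewrite SE; apply: (le_trans (ler_norm_sum _ _ _)).
  rewrite rmorphM /= rmorph_sum mulr_sumr; apply: ler_sum => xi _.
  rewrite !normrM -mulrA rmorphM /= -!nc; apply: ler_wpM2r; first by rewrite mulr_ge0.
  exact: hmu.
rewrite mulrCA ler_wpM2l //.
have A0 : 0 <= \sum_(y <- t) F y ^+ 2 by apply: sumr_ge0 => y _; rewrite sqr_ge0.
have B0 : 0 <= \sum_(x <- s) G x ^+ 2 by apply: sumr_ge0 => x _; rewrite sqr_ge0.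
set A := \sum_(y <- t) _ in A0 hF *; set B := \sum_(x <- s) _ in B0 hG *.
have -> : N%:R * (Num.sqrt A * Num.sqrt B) = Num.sqrt ((N%:R * A) * (N%:R * B)).
  by rewrite mulrACA -expr2 sqrtrM ?sqr_ge0 // sqrtr_sqr gtr0_norm // sqrtrM.
rewrite -hF -hG; apply: le_trans (ler_wsqrtr (cauchy_schwarz _ _)).
by rewrite sqrtr_sqr ler_norm.
Qed.

End Fourier.

(** * Interpolation and sparse bounds at a single scale *)
Section Interpolation.
Variable R : realType.

Lemma powR_expr (x : R) (n : nat) (p : R) : 0 <= x -> (x ^+ n) `^ p = (x `^ p) ^+ n.
Proof. by move=> x0; rewrite -(powR_mulrn n x0) -(powR_mulrn n (powR_ge0 x p)) powRAC. Qed.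

Lemma geometric_le (q : R) J : 0 <= q < 1 -> \sum_(i < J) q ^+ i <= (1 - q)^-1.
Proof.
move=> /andP[q0 q1]; rewrite -[leRHS]mul1r ler_pdivlMr ?subr_gt0 //.
rewrite mulrC -opprB mulNr -subrX1 opprB gerBl exprn_ge0 //.
Qed.

(** The part of [f] of size about [2 ^ i]; the values of modulus at most 1 are
collected in the piece of index 0. *)
Definition piece (f : int -> R) (i : nat) (x : int) : R :=
  if (`|f x| <= 2 ^+ i) && ((i == 0%N) || (2 ^+ i.-1 < `|f x|)) then f x else 0.

Lemma sum_piece f J x : \sum_(i < J.+1) piece f i x = if `|f x| <= 2 ^+ J then f x else 0.
Proof.
elim: J => [|J IH]; first by rewrite big_ord1 /piece andbT.
rewrite big_ord_recr /= {}IH /piece /=.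
have h : (2 : R) ^+ J <= 2 ^+ J.+1 by rewrite ler_eXn2l // ltr1n.
case: (leP `|f x| (2 ^+ J)) => h1; last by rewrite andbT add0r.
by rewrite andbF addr0 (le_trans h1 h).
Qed.

Lemma piece_decomposition (f : int -> R) (s : seq int) :
  exists J, forall x, x \in s -> f x = \sum_(i < J) piece f i x.
Proof.
have [J HJ] : exists J, all (fun x => `|f x| <= 2 ^+ J) s.
  elim: s => [|x s [J HJ]]; first by exists 0%N.
  have [m hm] : exists m : nat, `|f x| <= 2 ^+ m.
    exists (Num.bound `|f x|); apply: ltW; apply: (lt_trans (archi_boundP (normr_ge0 _))).
    by rewrite -natrX ltr_nat ltn_expl.
  exists (maxn J m) => /=; apply/andP; split.
    by apply: (le_trans hm); rewrite ler_eXn2l ?ltr1n // leq_maxr.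
  apply: sub_all HJ => y /le_trans; apply; rewrite ler_eXn2l ?ltr1n //; exact: leq_maxl.
by exists J.+1 => x xs; rewrite sum_piece (allP HJ x xs).
Qed.

Section Pieces.
Variables (r : R) (f : int -> R) (t : seq int) (n : nat).
Hypotheses (r12 : 1 < r < 2) (tn : (size t <= n)%N).
Hypothesis fr : \sum_(x <- t) `|f x| `^ r <= n%:R.

Let size_le : \sum_(x <- t) (1 : R) <= n%:R.
Proof. by rewrite big_const_seq count_predT iter_addr_0 ler_nat. Qed.

Lemma piece_l2 i : \sum_(x <- t) piece f i x ^+ 2 <= n%:R * (2 `^ ((2 - r) / 2)) ^+ (2 * i).
Proof.
have /andP[r1 r2] := r12.
case: i => [|i].
  rewrite muln0 expr0 mulr1; apply: le_trans size_le; apply: ler_sum => x _.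
  rewrite /piece andbT expr0; case: ifP => h; last by rewrite expr0n ler01.
  by rewrite -[_ ^+ 2]ger0_norm ?sqr_ge0 // normrX expr_le1.
apply: (@le_trans _ _ (\sum_(x <- t) `|f x| `^ r * (2 `^ ((2 - r) / 2)) ^+ (2 * i.+1))).
  apply: ler_sum => x _; rewrite /piece /=; case: ifP => h; last first.
    by rewrite expr0n mulr_ge0 ?exprn_ge0 ?powR_ge0.
  have /andP[h1 h2] := h.
  have f0 : 0 < `|f x| by apply: le_lt_trans h2; rewrite exprn_ge0.
  have -> : f x ^+ 2 = `|f x| `^ r * `|f x| `^ (2 - r).
    rewrite -powRD; last by rewrite (gt_eqF f0) implybT.
    by rewrite addrC subrK powR_mulrn // real_normK ?num_real.
  rewrite ler_wpM2l ?powR_ge0 //.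
  have -> : (2 `^ ((2 - r) / 2)) ^+ (2 * i.+1) = (2 ^+ i.+1) `^ (2 - r) :> R.
    by rewrite exprM -(powR_mulrn 2 (powR_ge0 _ _)) -powRrM divfK // powR_expr.
  by apply: ge0_ler_powR; rewrite ?nnegrE ?exprn_ge0 //; lra.
by rewrite -mulr_suml ler_wpM2r ?exprn_ge0 ?powR_ge0.
Qed.

Lemma piece_l1 i : \sum_(x <- t) `|piece f i x| <= 2 * n%:R * (2 `^ (1 - r)) ^+ i.
Proof.
have /andP[r1 r2] := r12.
case: i => [|i].
  rewrite expr0 mulr1; apply: (@le_trans _ _ n%:R); last by have := ler0n R n; lra.
  apply: le_trans size_le; apply: ler_sum => x _.
  by rewrite /piece andbT expr0; case: ifP => h //; rewrite normr0 ler01.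
apply: (@le_trans _ _ (\sum_(x <- t) `|f x| `^ r * (2 * (2 `^ (1 - r)) ^+ i.+1))); last first.
  by rewrite -mulr_suml mulrA [2 * _]mulrC -!mulrA ler_wpM2r // mulr_ge0 ?exprn_ge0 ?powR_ge0.
apply: ler_sum => x _; rewrite /piece /=; case: ifP => h; last first.
  by rewrite normr0 !mulr_ge0 ?exprn_ge0 ?powR_ge0.
have /andP[h1 h2] := h.
have p0 : 0 < 2 ^+ i :> R by rewrite exprn_gt0.
have f0 : 0 < `|f x| by apply: lt_trans h2.
have {1}-> : `|f x| = `|f x| `^ r * `|f x| `^ (1 - r).
  rewrite -powRD; last by rewrite (gt_eqF f0) implybT.
  by rewrite addrC subrK powRr1.
rewrite ler_wpM2l ?powR_ge0 //.
apply: (@le_trans _ _ ((2 ^+ i) `^ (1 - r))).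
  rewrite -[1 - r]opprB !powRN lef_pV2 ?posrE ?powR_gt0 //.
  by apply: ge0_ler_powR; rewrite ?nnegrE ?(ltW p0) ?(ltW h2) //; lra.
rewrite powR_expr // exprS mulrA ler_peMl ?exprn_ge0 ?powR_ge0 //.
have : 2 `^ (-1) <= 2 `^ (1 - r) :> R by apply: ler_powR; [rewrite ler1n|lra].
by rewrite powR_inv1 //; lra.
Qed.

End Pieces.

Lemma interpolation_le (b X Y theta : R) : 0 <= b -> 0 <= theta <= 1 -> b <= X -> b <= Y ->
  b <= X `^ (1 - theta) * Y `^ theta.
Proof.
move=> b0 /andP[t0 t1] bX bY.
have -> : b = b `^ (1 - theta) * b `^ theta.
  have [->|bn] := eqVneq b 0; last by rewrite -powRD ?subrK ?powRr1 // bn implybT.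
  have [->|tn] := eqVneq theta 0; last by rewrite [0 `^ theta]powR0 // mulr0.
  by rewrite subr0 powRr1 // mul0r.
apply: ler_pM; rewrite ?powR_ge0 //.
- by apply: ge0_ler_powR; rewrite ?nnegrE ?subr_ge0 // (le_trans b0).
- by apply: ge0_ler_powR; rewrite ?nnegrE // (le_trans b0).
Qed.

Section Form.
Variables (r theta : R) (K : int -> int -> R) (s t : seq int) (n : nat) (M1 M2 : R).
Hypotheses (r12 : 1 < r < 2) (th01 : 0 < theta < 1) (th : (2 - r) / r < theta).
Hypotheses (sn : (size s <= n)%N) (tn : (size t <= n)%N) (M10 : 0 <= M1) (M20 : 0 <= M2).
Hypothesis KM1 : forall x y, x \in s -> y \in t -> `|K x y| <= M1.
Hypothesis KM2 : forall F G : int -> R, `|\sum_(x <- s) \sum_(y <- t) K x y * F y * G x| <=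
   M2 * (Num.sqrt (\sum_(y <- t) F y ^+ 2) * Num.sqrt (\sum_(x <- s) G x ^+ 2)).

Let form (F G : int -> R) := \sum_(x <- s) \sum_(y <- t) K x y * F y * G x.

(** The loss per level of the decomposition into [piece]s: the bound on [l^2] grows
like [2 ^ ((2 - r) / 2)] and the bound on [l^1] decays like [2 ^ (1 - r)]. Their
geometric mean decays exactly when [theta > (2 - r) / r]. *)
Definition interpolation_ratio : R :=
  (2 `^ ((2 - r) / 2)) `^ (1 - theta) * (2 `^ (1 - r)) `^ theta.
Local Notation q := interpolation_ratio.

Lemma interpolation_ratio_lt1 : 0 <= q < 1.
Proof.
rewrite mulr_ge0 ?powR_ge0 //= /interpolation_ratio -!powRrM -powRD; last by rewrite pnatr_eq0 implybT.
have /andP[r1 r2] := r12; have /andP[t0 t1] := th01.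
have r0 : 0 < r by lra.
have h : 2 - r < theta * r by move: th; rewrite ltr_pdivrMr.
rewrite -[ltRHS](powRr0 2) /powR pnatr_eq0 /= ltr_expR mul0r.
rewrite pmulr_llt0 ?ln_gt0 ?ltr1n //; nra.
Qed.

(** Decompose [F] and [G] by size, estimate each pair of pieces on [l^2] through [M2]
and on [l^1] through [M1], take the geometric mean and sum both geometric series.
This real interpolation costs only the open range of [theta]. *)
Lemma interpolation_normalized (F G : int -> R) :
  \sum_(y <- t) `|F y| `^ r <= n%:R -> \sum_(x <- s) `|G x| `^ r <= n%:R ->
  `|form F G| <= (1 - q)^-1 ^+ 2 * (M2 `^ (1 - theta) * (4 * M1 * n%:R) `^ theta * n%:R).
Proof.
move=> hF hG; have /andP[r1 r2] := r12; have /andP[t0 t1] := th01.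
have [J HJ] := piece_decomposition F t; have [J' HJ'] := piece_decomposition G s.
have nR : 0 <= n%:R :> R by rewrite ler0n.
set a : R := 2 `^ ((2 - r) / 2); set b : R := 2 `^ (1 - r).
have qX m : q ^+ m = (a `^ (1 - theta)) ^+ m * (b `^ theta) ^+ m by rewrite -exprMn.
have a0 : 0 <= a by rewrite powR_ge0.
have b0 : 0 <= b by rewrite powR_ge0.
have -> : form F G = \sum_(j < J') \sum_(i < J) form (piece F i) (piece G j).
  transitivity (\sum_(x <- s) \sum_(j < J') \sum_(i < J) \sum_(y <- t)
      K x y * piece F i y * piece G j x); last first.
    by rewrite exchange_big /=; apply: eq_bigr => j _; rewrite exchange_big.
  rewrite /form; apply: eq_big_seq => x xs.
  transitivity (\sum_(y <- t) \sum_(j < J') \sum_(i < J) K x y * piece F i y * piece G j x).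
    apply: eq_big_seq => y yt.
    rewrite {1}(HJ _ yt) {1}(HJ' _ xs) mulr_sumr; apply: eq_bigr => j _.
    by rewrite mulr_sumr mulr_suml.
  by rewrite exchange_big /=; apply: eq_bigr => j _; rewrite exchange_big.
have one i j : `|form (piece F i) (piece G j)| <=
    (M2 `^ (1 - theta) * (4 * M1 * n%:R) `^ theta * n%:R) * (q ^+ i * q ^+ j).
  have h2 : `|form (piece F i) (piece G j)| <= M2 * n%:R * a ^+ (i + j).
    apply: (le_trans (KM2 _ _)); rewrite -mulrA ler_wpM2l //.
    have S c k : 0 <= c -> c <= n%:R * a ^+ (2 * k) -> Num.sqrt c <= Num.sqrt n%:R * a ^+ k.
      move=> c0 /ler_wsqrtr /le_trans; apply.
      by rewrite sqrtrM // mulnC exprM sqrtr_sqr ger0_norm // exprn_ge0.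
    apply: (@le_trans _ _ ((Num.sqrt n%:R * a ^+ i) * (Num.sqrt n%:R * a ^+ j))).
      apply: ler_pM; rewrite ?sqrtr_ge0 //; apply: S.
      - by apply: sumr_ge0 => y _; rewrite sqr_ge0.
      - exact: piece_l2.
      - by apply: sumr_ge0 => y _; rewrite sqr_ge0.
      - exact: piece_l2.
    by rewrite mulrACA -exprD -expr2 sqr_sqrtr.
  have h1 : `|form (piece F i) (piece G j)| <= 4 * M1 * n%:R * n%:R * b ^+ (i + j).
    apply: (@le_trans _ _ (M1 * ((\sum_(y <- t) `|piece F i y|) * (\sum_(x <- s) `|piece G j x|)))).
      rewrite /form mulrA mulr_sumr; apply: (le_trans (ler_norm_sum _ _ _)).
      apply: ler_sum_seq => x xs _.
      rewrite mulr_sumr mulr_suml; apply: (le_trans (ler_norm_sum _ _ _)).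
      apply: ler_sum_seq => y yt _.
      by rewrite !normrM ler_wpM2r // ler_wpM2r // KM1.
    apply: (@le_trans _ _ (M1 * ((2 * n%:R * b ^+ i) * (2 * n%:R * b ^+ j)))).
      rewrite ler_wpM2l //; apply: ler_pM; rewrite ?sumr_ge0 //; exact: piece_l1.
    by rewrite exprD; apply: le_of_eq; ring.
  have tt : 0 <= theta <= 1 by rewrite !ltW.
  have th0 : 0 <= theta := ltW t0.
  have Y00 : 0 <= 4 * M1 * n%:R by rewrite !mulr_ge0.
  move: Y00 h1; set Y0 := 4 * M1 * n%:R => Y00 h1.
  apply: (le_trans (interpolation_le (normr_ge0 _) tt h2 h1)).
  have X1 : 0 <= M2 * n%:R by rewrite mulr_ge0.
  have Y1 : 0 <= Y0 * n%:R by rewrite mulr_ge0.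
  rewrite (powRM _ X1 (exprn_ge0 _ a0)) (powRM _ Y1 (exprn_ge0 _ b0)).
  rewrite (powRM _ M20 nR) (powRM _ Y00 nR) (powR_expr _ _ a0) (powR_expr _ _ b0).
  rewrite (exprD _ i j) (exprD _ i j) 2!qX.
  have nn : n%:R `^ (1 - theta) * n%:R `^ theta = n%:R :> R.
    have [->|nz] := eqVneq (n%:R : R) 0.
      by rewrite [0 `^ theta]powR0 ?mulr0 // gt_eqF.
    by rewrite -powRD ?subrK ?powRr1 // nz implybT.
  rewrite -[X in _ <= _ * X * _]nn; apply: le_of_eq.
  move: (n%:R `^ _) (n%:R `^ _) (M2 `^ _) (Y0 `^ _) (a `^ _) (b `^ _) => u1 u2 u3 u4 u6 u7.
  by ring.
apply: (le_trans (ler_norm_sum _ _ _)).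
apply: (@le_trans _ _ (\sum_(j < J') \sum_(i < J)
   (M2 `^ (1 - theta) * (4 * M1 * n%:R) `^ theta * n%:R) * (q ^+ i * q ^+ j))).
  apply: ler_sum => j _; apply: (le_trans (ler_norm_sum _ _ _)).
  by apply: ler_sum => i _; apply: one.
under eq_bigr => j _ do rewrite -mulr_sumr -mulr_suml.
rewrite -mulr_sumr -mulr_sumr mulrC ler_wpM2r ?mulr_ge0 ?powR_ge0 //.
have /andP[q0 q1] := interpolation_ratio_lt1.
by rewrite expr2; apply: ler_pM; rewrite ?geometric_le ?interpolation_ratio_lt1 // sumr_ge0 // => i _; rewrite exprn_ge0.
Qed.

(** Homogeneity reduces the estimate to averages equal to 1. *)
Lemma interpolation (F G : int -> R) (A B : R) : 0 <= A -> 0 <= B ->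
  \sum_(y <- t) `|F y| `^ r <= n%:R * A `^ r -> \sum_(x <- s) `|G x| `^ r <= n%:R * B `^ r ->
  `|form F G| <=
  (1 - q)^-1 ^+ 2 * (M2 `^ (1 - theta) * (4 * M1 * n%:R) `^ theta * n%:R) * (A * B).
Proof.
move=> A0 B0 hF hG; have /andP[r1 r2] := r12.
have rn0 : r != 0 by rewrite gt_eqF //; lra.
have zero (H : int -> R) (w : seq int) x : \sum_(y <- w) `|H y| `^ r <= n%:R * 0 `^ r -> x \in w -> H x = 0.
  rewrite powR0 // mulr0 => h xw.
  have : \sum_(y <- w) `|H y| `^ r == 0.
    by rewrite eq_le h sumr_ge0 // => y _; rewrite powR_ge0.
  rewrite psumr_eq0; last by move=> y _; rewrite powR_ge0.
  by move=> /allP/(_ x xw); rewrite powR_eq0 => /andP[/eqP/normr0_eq0].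
have [Az|An] := eqVneq A 0.
  rewrite Az in hF *; rewrite mul0r mulr0 /form big1 ?normr0 // => x _.
  by rewrite big_seq_cond big1 // => y /andP[yt _]; rewrite (zero _ _ _ hF yt) mulr0 mul0r.
have [Bz|Bn] := eqVneq B 0.
  rewrite Bz in hG *; rewrite !mulr0 /form big_seq_cond big1 ?normr0 // => x /andP[xs _].
  by rewrite big1 // => y _; rewrite (zero _ _ _ hG xs) mulr0.
have Ap : 0 < A by rewrite lt_def An.
have Bp : 0 < B by rewrite lt_def Bn.
have nrm (H : int -> R) (w : seq int) (c : R) : 0 < c -> \sum_(y <- w) `|H y| `^ r <= n%:R * c `^ r ->
   \sum_(y <- w) `|c^-1 * H y| `^ r <= n%:R.
  move=> c0 h; under eq_bigr => y _ do rewrite normrM normfV (gtr0_norm c0) powRM ?invr_ge0 ?(ltW c0) //.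
  rewrite -mulr_sumr -(powR_inv1 (ltW c0)) powRAC powR_inv1 ?powR_ge0 //.
  by rewrite ler_pdivrMl ?powR_gt0 // mulrC.
have E : form F G = form (fun y => A^-1 * F y) (fun x => B^-1 * G x) * (A * B).
  rewrite /form mulr_suml; apply: eq_bigr => x _; rewrite mulr_suml; apply: eq_bigr => y _.
  by field; rewrite An Bn.
rewrite E normrM [ `|A * B|]gtr0_norm ?mulr_gt0 // ler_wpM2r ?mulr_ge0 //.
by apply: interpolation_normalized; apply: nrm.
Qed.

End Form.

Definition block (k : nat) : seq nat := index_iota (2 ^ k) (2 ^ k.+1).

Lemma mem_block k n : (n \in block k) = (2 ^ k <= n < 2 ^ k.+1)%N.
Proof. by rewrite mem_index_iota. Qed.

Lemma convolver_eq0 (c : nat -> R) k (m : int) :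
  ~~ ((2 ^ k)%N%:Z <= m < (2 ^ k.+1)%N%:Z) -> convolver c (block k) m = 0.
Proof.
move=> h; rewrite /convolver big_seq_cond big1 // => n /andP[]; rewrite mem_block => h1 _.
by case: eqP => [e|_]; rewrite ?mulr0 //; move: h1 h; rewrite e; lia.
Qed.

Lemma convolver_le (c : nat -> R) k (m : int) (M1 : R) : 0 <= M1 ->
  (forall n, n \in block k -> `|c n| <= M1) -> `|convolver c (block k) m| <= M1.
Proof.
move=> M10 H; have [h|h] := boolP ((2 ^ k)%N%:Z <= m < (2 ^ k.+1)%N%:Z); last first.
  by rewrite convolver_eq0 // normr0.
have mb : `|m|%N \in block k by rewrite mem_block; lia.
rewrite /convolver (bigD1_seq `|m|%N) ?iota_uniq //= big1 ?addr0; last first.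
  move=> n nm; rewrite (_ : (m == n%:Z) = false) ?mulr0 //.
  by apply/negbTE; move: nm; apply: contra => /eqP; lia.
have -> : (m == `|m|%N%:Z) = true by apply/eqP; lia.
by rewrite mulr1 H.
Qed.

Section SingleScale.
Variables (r theta : R) (k : nat) (c : nat -> R) (M1 M2 : R) (z : R[i]).
Hypotheses (r12 : 1 < r < 2) (th01 : 0 < theta < 1) (th : (2 - r) / r < theta).
Hypotheses (M10 : 0 <= M1) (zN : (2 ^ k.+3).-primitive_root z).
Hypothesis cM1 : forall n, n \in block k -> `|c n| <= M1.
Hypothesis cM2 : forall xi, (xi < 2 ^ k.+3)%N ->
  `|\sum_(n <- block k) (c n)%:C * (z ^+ n) ^+ xi| <= M2%:C.

Definition scale_constant : R := (1 - interpolation_ratio r theta)^-1 ^+ 2 *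
   (M2 `^ (1 - theta) * (24 * (M1 * (2 ^ k)%:R)) `^ theta * 3).

Let M20 : 0 <= M2.
Proof.
have N0 : (0 < 2 ^ k.+3)%N by rewrite expn_gt0.
by rewrite -lecR; apply: le_trans (cM2 N0); rewrite normr_ge0.
Qed.

Lemma scale_constant_ge0 : 0 <= scale_constant.
Proof. by rewrite /scale_constant mulr_ge0 ?sqr_ge0 // mulr_ge0 // mulr_ge0 ?powR_ge0. Qed.

(** The triple of the interval contains every [y] at distance less than its length
[2 ^ (k+1)], so nothing is lost; all the differences that occur are less than
[2 ^ (k+3)], the order of the root of unity. *)
Lemma single_scale_local (F G : int -> R) (b : int) :
  `|\sum_(x <- points (ival (b, k.+1))) \sum_(y <- points (triple (ival (b, k.+1))))
      convolver c (block k) (x - y) * F y * G x| <=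
  scale_constant * (raverage r (fun y => `|F y|) (ival (b, k.+1)) *
    raverage r (fun x => `|G x|) (ival (b, k.+1)) * (2 ^ k.+1)%:R).
Proof.
set I := ival (b, k.+1); have /andP[r1 r2] := r12.
have rn0 : r != 0 by rewrite gt_eqF //; lra.
pose n := (3 * 2 ^ k.+1)%N.
have nn : n%:R != 0 :> R by rewrite pnatr_eq0 muln_eq0 expn_eq0.
have avE (H : int -> R) : \sum_(y <- points (triple I)) `|H y| `^ r =
    n%:R * raverage r (fun y => `|H y|) I `^ r.
  rewrite /raverage -powRrM mulVf // powRr1.
    by rewrite mulrA mulfV ?mul1r.
  by rewrite mulr_ge0 ?invr_ge0 ?ler0n // sumr_ge0 // => y _; rewrite powR_ge0.
have mem (x : int) : x \in points I -> b <= x < b + (2 ^ k.+1)%N%:Z by rewrite mem_pointsE.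
have memt (x : int) : x \in points (triple I) ->
    b - (2 ^ k.+1)%N%:Z <= x < b - (2 ^ k.+1)%N%:Z + (3 * 2 ^ k.+1)%N%:Z by rewrite mem_pointsE.
have := @interpolation r theta (fun x y => convolver c (block k) (x - y)) (points I)
  (points (triple I)) n M1 M2 r12 th01 th _ _ M10 M20 _ _ F G
  (raverage r (fun y => `|F y|) I) (raverage r (fun x => `|G x|) I) (raverage_ge0 _ _ _)
  (raverage_ge0 _ _ _).
have e8 : (2 ^ k.+3 = 4 * 2 ^ k.+1)%N by rewrite !expnS mulnA.
move=> H; apply: le_trans (H _ _ _ _ _ _) _.
- by rewrite size_points leq_pmull.
- by rewrite size_points.
- by move=> x y _ _; apply: convolver_le.
- move=> F' G'; apply: (@fourier_bound _ (2 ^ k.+3) z) => //; rewrite ?uniq_points //.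
  + by move=> x y /mem h1 /mem h2; rewrite e8; clear -h1 h2; lia.
  + by move=> x y /memt h1 /memt h2; rewrite e8; clear -h1 h2; lia.
  + move=> x y m /mem h1 /memt h2; rewrite mem_block e8 => h3; clear -h1 h2 h3; lia.
- by rewrite avE.
- rewrite -avE; apply: sumr_le_sub; rewrite ?uniq_points //.
  by move=> x /mem h _; rewrite andbT mem_pointsE /=; clear -h; lia.
rewrite /scale_constant.
have -> : 4 * M1 * n%:R = 24 * (M1 * (2 ^ k)%:R) by rewrite /n expnS !natrM; ring.
have -> : n%:R = 3 * (2 ^ k.+1)%:R :> R by rewrite natrM.
apply: le_of_eq.
move: (raverage r _ _) (raverage r _ _) (_ ^+ 2) (M2 `^ _) (_ `^ theta) (2 ^ k.+1)%:R.
by move=> u1 u2 u3 u4 u5 u6; ring.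
Qed.

Lemma level_cells l K b N : (l <= K)%N ->
  N \in dyadic_cells (fun _ j => j == l) K b -> N.2 = l.
Proof.
elim: K b => [|K IH] b /=.
  by rewrite leqn0 => /eqP ->; rewrite inE => /eqP ->.
rewrite leq_eqVlt => /predU1P[->|lK]; first by rewrite eqxx inE => /eqP ->.
rewrite (gtn_eqF lK) mem_cat => /orP[]; exact: IH.
Qed.

Lemma level_cells_sparse l K b :
  sparse (4^-1 : R) [set` map ival (dyadic_cells (fun _ j => j == l) K b)].
Proof.
have u : uniq (flatten (map points (map ival (dyadic_cells (fun _ j => j == l) K b)))).
  by rewrite flatten_dyadic_cells uniq_points.
exists (fun I => [fset x in points I]%fset); split.
- by move=> I _ x; rewrite inE.
- move=> I /= /mapP[N _ ->]; rewrite card_fseq undup_id ?uniq_points // size_points.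
  have : 0 < (ival N).2%:R :> R by rewrite ltr0n ival_gt0.
  by lra.
- move=> I J /= IS JS ne; apply/fdisjointP => x; rewrite !inE => xI; apply/negP => xJ.
  by apply: ne; apply: (uniq_flatten_inj u IS JS xI xJ).
Qed.

(** The dyadic intervals of length [2 ^ (k+1)] are disjoint, hence sparse, and a
kernel that lives at distances less than this length connects each of them only
with its triple. When the whole interval is shorter than the block, no pair is
at the right distance and the form is zero. *)
Lemma single_scale_sparse (F G : int -> R) (u v : int -> R) (D : R) (b : int) (K : nat) :
  (forall x, `|F x| <= u x) -> (forall x, `|G x| <= v x) ->
  (forall x, F x != 0 -> x \in points (ival (b, K))) ->
  sparse_bound 4^-1 r u v D -> 0 <= D ->
  `|\sum_(x <- points (ival (b, K))) \sum_(y <- points (ival (b, K)))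
      convolver c (block k) (x - y) * F y * G x| <= scale_constant * D.
Proof.
move=> Fu Gv suppF HD D0.
have [Kk|kK] := leqP K k.
  rewrite big_seq_cond big1 ?normr0 ?(mulr_ge0 scale_constant_ge0 D0) // => x /andP[xI _].
  rewrite big_seq_cond big1 // => y /andP[yI _].
  rewrite convolver_eq0 ?mul0r //.
  have : (2 ^ K <= 2 ^ k)%N by rewrite leq_exp2l.
  by move: xI yI; rewrite !mem_pointsE /=; clear; lia.
pose ns := dyadic_cells (fun _ j => j == k.+1) K b.
have nsE N : N \in ns -> N.2 = k.+1 by apply: level_cells.
rewrite -{1}(flatten_dyadic_cells (fun _ j => j == k.+1) K b) -/ns big_flatten big_map big_map.
apply: (@le_trans _ _ (\sum_(N <- ns) scale_constant *
   (raverage r u (ival N) * raverage r v (ival N) * (ival N).2%:R))); last first.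
  rewrite -mulr_sumr ler_wpM2l ?scale_constant_ge0 //.
  have := sparse_bound_seq HD _ (level_cells_sparse k.+1 K b); rewrite big_map; apply.
  apply: (@uniq_flatten_uniq _ _ points).
    by rewrite flatten_dyadic_cells uniq_points.
  move=> I /mapP[N _ ->]; rewrite -size_eq0 size_points.
  by have := ival_gt0 N; case: (ival N).2.
apply: (le_trans (ler_norm_sum _ _ _)).
apply: ler_sum_seq => N Nns _.
have NE := nsE _ Nns; case: N NE Nns => b' j /= -> Nns.
have mono (w w' : int -> R) : (forall x, 0 <= w x) -> (forall x, w x <= w' x) ->
    raverage r w (ival (b', k.+1)) <= raverage r w' (ival (b', k.+1)).
  move=> w0 ww'; have /andP[r1 _] := r12; have r0 : 0 <= r by lra.
  apply: ge0_ler_powR; rewrite ?invr_ge0 ?nnegrE ?mulr_ge0 ?invr_ge0 ?sumr_ge0 //.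
  - by move=> *; rewrite powR_ge0.
  - by move=> *; rewrite powR_ge0.
  rewrite ler_wpM2l ?invr_ge0 //; apply: ler_sum => x _.
  by apply: ge0_ler_powR; rewrite ?nnegrE // (le_trans (w0 x)).
apply: (@le_trans _ _ (scale_constant * (raverage r (fun y => `|F y|) (ival (b', k.+1)) *
    raverage r (fun x => `|G x|) (ival (b', k.+1)) * (2 ^ k.+1)%:R))); last first.
  apply: ler_wpM2l; first exact: scale_constant_ge0.
  apply: ler_wpM2r; first by rewrite ler0n.
  by apply: ler_pM (raverage_ge0 _ _ _) (raverage_ge0 _ _ _) _ _; apply: mono.
apply: le_trans (single_scale_local F G b'); apply: le_of_eq.
congr (`| _ |); apply: eq_big_seq => x xN.
rewrite (bigID (fun y => y \in points (triple (ival (b', k.+1))))) /= [X in _ + X]big1 ?addr0; last first.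
  move=> y yt; rewrite convolver_eq0 ?mul0r //.
  by move: xN yt; rewrite !mem_pointsE /=; clear; lia.
rewrite [RHS](bigID (fun y => y \in points (ival (b, K)))) /= [X in _ = _ + X]big1 ?addr0; last first.
  move=> y; have [->|/suppF -> //] := eqVneq (F y) 0.
  by rewrite mulr0 mul0r.
by apply: eq_sum_sub; rewrite ?uniq_points // => y; rewrite andbC.
Qed.

End SingleScale.
End Interpolation.

(** * Exponential moments and the Borel-Cantelli lemma *)
Section Probability.
Variables (R : realType) (d : measure_display) (T : measurableType d) (P : probability T R).

Lemma finite_union_bound (I : finType) (A : I -> set T) :
  (forall i, measurable (A i)) ->
  measurable (\big[setU/set0]_(i : I) A i) /\
  (P (\big[setU/set0]_(i : I) A i) <= \sum_(i : I) P (A i))%E.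
Proof.
move=> mA; apply: (big_ind2 (fun B e => measurable B /\ (P B <= e)%E)).
- by split; [exact: measurable0|rewrite measure0].
- move=> B1 e1 B2 e2 [m1 h1] [m2 h2]; split; first exact: measurableU.
  by apply: (le_trans (measureU2 _ _ _)) => //; exact: leeD.
- by move=> i _; split.
Qed.

Lemma bigsetU_mem (I : finType) (A : I -> set T) (p : pred I) i w :
  p i -> A i w -> (\big[setU/set0]_(i : I | p i) A i) w.
Proof. by move=> pi Aw; rewrite (bigD1 i) //=; left. Qed.

Lemma expR_le_quadratic (v : R) : v <= 2^-1 -> expR v <= 1 + v + 2 * v ^+ 2.
Proof.
move=> v2; have h : 1 - v <= expR (- v) by exact: expR_ge1Dx.
have v1 : 0 < 1 - v by lra.
rewrite -[v]opprK expRN opprK; apply: (@le_trans _ _ ((1 - v)^-1)).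
  by rewrite lef_pV2 ?posrE // expR_gt0.
rewrite -[X in X <= _]mul1r ler_pdivrMr //.
have : 0 <= v ^+ 2 * (1 - 2 * v) by rewrite mulr_ge0 ?sqr_ge0 //; lra.
move=> h0; rewrite -subr_ge0 (_ : _ - _ = v ^+ 2 * (1 - 2 * v)) //; ring.
Qed.

Variable X : int -> {RV P >-> bool}.
Hypothesis indX : mutually_independent [set n : int | n != 0] X.

Section JointLaw.
Variables (m : nat) (e : 'I_m -> int) (p : 'I_m -> R).
Hypotheses (e_inj : injective e) (e0 : forall i, e i != 0).
Hypothesis Xp : forall i, P [set w | X (e i) w = true] = (p i)%:E.

Definition bernoulli_weight (i : 'I_m) (b : bool) : R := if b then p i else 1 - p i.

Definition cylinder (om : {ffun 'I_m -> bool}) : set T := [set w | forall i, X (e i) w = om i].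

Lemma measurable_level n b : measurable [set w | X n w = b].
Proof. by rewrite -[X in measurable X]/(X n @^-1` [set b]); apply: measurable_funPTI. Qed.

Lemma level_weight i b : P [set w | X (e i) w = b] = (bernoulli_weight i b)%:E.
Proof.
case: b => //=; rewrite (_ : [set w | _] = ~` [set w | X (e i) w = true]).
  by rewrite probability_setC ?Xp ?EFinB //; exact: measurable_level.
by apply/seteqP; split=> w /=; case: (X (e i) w).
Qed.

(** Independence of the selectors in the form that is used: the joint law of finitely
many of them is the product of Bernoulli weights. It turns the expectation in
the exponential moment method into a finite sum over patterns of zeros and ones. *)
Lemma cylinder_law om : measurable (cylinder om) /\
  P (cylinder om) = (\prod_i bernoulli_weight i (om i))%:E.
Proof.
pose J := [fset x in map e (enum 'I_m)]%fset.
pose A (n : int) : set bool := [set b | forall i, e i = n -> b = om i].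
have Ae i : A (e i) = [set om i].
  apply/seteqP; split=> b /=; first by move=> /(_ i erefl).
  by move=> -> j /e_inj ->.
have E : cylinder om = \bigcap_(n in [set` J]) (X n @^-1` A n).
  apply/seteqP; split => w /=.
    by move=> h n; rewrite /= inE /= => /mapP[i _ ->]; rewrite Ae /= h.
  move=> h i; have := h (e i); rewrite /= Ae /=; apply.
  by rewrite inE /=; apply: map_f; rewrite mem_enum.
split.
  rewrite E; apply: fin_bigcap_measurable; first exact: finite_fset.
  by move=> n _; apply: measurable_funPTI.
rewrite E indX //; last by move=> n /=; rewrite inE /= => /mapP[i _ ->].
rewrite (perm_big (map e (enum 'I_m))) /=; last first.
  apply: uniq_perm; [exact: fset_uniq|by rewrite (map_inj_uniq e_inj) enum_uniq|].
  by move=> x; rewrite inE.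
rewrite big_map big_enum /= -prodEFin; apply: eq_bigr => i _.
by rewrite Ae; exact: level_weight.
Qed.

(** The exponential moment method. The exceptional event is the finite union of the
cylinders on which the sum exceeds [lam]; its probability is at most
[exp (- t lam) E exp (t S)], and the expectation factors over the indices. Each
factor is at most [1 + 2 t ^ 2 p u ^ 2] because [|t u| <= 1/2] and the linear terms
cancel. *)
Lemma chernoff (u : 'I_m -> R) (t lam : R) :
  0 <= t -> (forall i, 0 <= p i <= 1) -> (forall i, `|t * u i| <= 2^-1) ->
  exists E : set T, [/\ measurable E,
    (P E <= (expR (2 * t ^+ 2 * \sum_i p i * u i ^+ 2 - t * lam))%:E)%E &
    forall w, ~ E w -> \sum_i ((X (e i) w)%:R - p i) * u i <= lam].
Proof.
move=> t0 p01 tu.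
pose Z (om : {ffun 'I_m -> bool}) := \sum_i ((om i)%:R - p i) * u i.
pose E := \big[setU/set0]_(om : {ffun 'I_m -> bool})
   (if lam < Z om then cylinder om else set0).
have mE om : measurable (if lam < Z om then cylinder om else set0).
  by case: ifP => // _; have [] := cylinder_law om.
have [mU PU] := finite_union_bound mE; exists E; split=> //.
  apply: (le_trans PU).
  pose W i b := bernoulli_weight i b * expR (t * ((b%:R - p i) * u i)).
  have w0 i b : 0 <= bernoulli_weight i b.
    by have /andP[? ?] := p01 i; rewrite /bernoulli_weight; case: b => //; rewrite subr_ge0.
  apply: (@le_trans _ _ (\sum_(om : {ffun 'I_m -> bool})
      (expR (- (t * lam)) * \prod_i W i (om i))%:E)%E).
    apply: lee_sum => om _; case: ifP => hom; last first.
      by rewrite measure0 lee_fin mulr_ge0 ?expR_ge0 // prodr_ge0 // => i _; rewrite mulr_ge0 ?expR_ge0.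
    have [_ ->] := cylinder_law om; rewrite lee_fin big_split /= mulrCA.
    rewrite -expR_sum -expRD -mulr_sumr -/(Z om) addrC ler_peMr ?prodr_ge0 //.
    by rewrite -expR0 ler_expR subr_ge0 ler_wpM2l // ltW.
  rewrite sumEFin lee_fin -mulr_sumr -(bigA_distr_bigA W) addrC expRD.
  rewrite ler_wpM2l ?expR_ge0 // mulr_sumr expR_sum; apply: ler_prod => i _.
  rewrite big_bool /= /W /=; have /andP[p0 p1] := p01 i.
  rewrite addr_ge0 ?mulr_ge0 ?expR_ge0 ?subr_ge0 //=.
  have := tu i; rewrite ler_norml => /andP[tu1 tu2].
  set v := t * u i in tu1 tu2 *.
  have h1 : expR (t * ((1 - p i) * u i)) <= 1 + (1 - p i) * v + 2 * ((1 - p i) * v) ^+ 2.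
    by rewrite mulrCA -/v; apply: expR_le_quadratic; nra.
  have h2 : expR (t * ((0 - p i) * u i)) <= 1 + (0 - p i) * v + 2 * ((0 - p i) * v) ^+ 2.
    by rewrite mulrCA -/v; apply: expR_le_quadratic; nra.
  apply: (@le_trans _ _ (1 + 2 * t ^+ 2 * (p i * u i ^+ 2))); last exact: expR_ge1Dx.
  apply: (le_trans (lerD (ler_wpM2l p0 h1) (ler_wpM2l (_ : 0 <= 1 - p i) h2))).
    by rewrite subr_ge0.
  have -> : 2 * t ^+ 2 * (p i * u i ^+ 2) = 2 * (p i * v ^+ 2) by rewrite /v; ring.
  have := mulr_ge0 (mulr_ge0 p0 p0) (sqr_ge0 v).
  move=> h; rewrite -subr_ge0 (_ : _ - _ = 2 * (p i * p i * v ^+ 2)); last by ring.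
  by rewrite mulr_ge0.
move=> w nEw; rewrite leNgt; apply/negP => hlt; apply: nEw.
pose om := [ffun i => X (e i) w].
have ZE : Z om = \sum_i ((X (e i) w)%:R - p i) * u i.
  by apply: eq_bigr => i _; rewrite ffunE.
apply: (@bigsetU_mem _ _ _ om) => //; rewrite ZE hlt => i; by rewrite ffunE.
Qed.

End JointLaw.

Lemma borel_cantelli (E : nat -> set T) (C : R) :
  (forall k, measurable (E k)) -> (forall k, P (E k) <= (C * 2^-1 ^+ k)%:E)%E ->
  {ae P, forall w, exists K, forall k, (K <= k)%N -> ~ E k w}.
Proof.
move=> mE PE.
have C0 : 0 <= C.
  by have := PE 0%N; rewrite expr0 mulr1 => /(le_trans (measure_ge0 _ _)); rewrite lee_fin.
exists (lim_sup_set E); split.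
- by apply: bigcap_measurable => // n _; apply: bigcup_measurable => j _; exact: mE.
- apply: lim_sup_set_cvg0 => //; apply: (@le_lt_trans _ _ (2 * C)%:E); last exact: ltry.
  apply: lime_le; first by apply: is_cvg_nneseries => n _ _; exact: measure_ge0.
  apply: nearW => n; apply: (@le_trans _ _ (\sum_(0 <= k < n) (C * 2^-1 ^+ k)%:E)%E).
    by apply: lee_sum => k _; exact: PE.
  rewrite sumEFin lee_fin -mulr_sumr mulrC ler_wpM2r // big_mkord.
  apply: le_trans (geometric_le n (_ : 0 <= 2^-1 < 1)) _; first by apply/andP; split; lra.
  by rewrite (_ : 1 - 2^-1 = 2^-1) ?invrK //; lra.
- move=> w /= nw n _; apply: contrapT => h; apply: nw; exists n => k nk Ew.
  by apply: h; exists k.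
Qed.

End Probability.

(** * Fourier transforms of the random blocks *)
Section Selectors.
Variables (R : realType) (alpha : R).
Hypothesis alpha01 : 0 < alpha < 1.

(** The two half-lines are treated separately: [s] is [true] for the positive
integers. *)
Definition signed (s : bool) (n : nat) : int := if s then n%:Z else - n%:Z.

Definition fluctuation (X : int -> bool) (s : bool) (n : nat) : R :=
  ((X (signed s n))%:R - n%:R `^ (- alpha)) * n%:R `^ (alpha - 1).

Lemma fluctuationE (X : int -> bool) s n : (0 < n)%N ->
  fluctuation X s n = (X (signed s n))%:R * n%:R `^ (alpha - 1) - n%:R^-1.
Proof.
move=> n0; rewrite /fluctuation mulrBl -powRD; last by rewrite pnatr_eq0 -lt0n n0 implybT.
by rewrite (_ : - alpha + (alpha - 1) = -1) ?powR_inv1 //; ring.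
Qed.

Definition block_scale (k : nat) : R := (2 ^ k)%:R `^ (alpha - 1).

Lemma powR_npow_le (m n : nat) (p : R) : (0 < m <= n)%N -> p <= 0 ->
  n%:R `^ p <= m%:R `^ p :> R.
Proof.
move=> /andP[m0 mn]; rewrite -[p]opprK oppr_le0; move: (- p) => q q0.
have n0 : (0 < n)%N by exact: leq_trans mn.
rewrite !powRN lef_pV2 ?posrE ?powR_gt0 ?ltr0n //.
by apply: ge0_ler_powR; rewrite ?nnegrE ?ler0n // ler_nat.
Qed.

Lemma block_scale_bounds k : 0 < block_scale k <= 1.
Proof.
have /andP[a0 a1] := alpha01.
rewrite powR_gt0 ?ltr0n ?expn_gt0 //=.
have := @powR_npow_le 1 (2 ^ k) (alpha - 1); rewrite powR1; apply; last by lra.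
by rewrite expn_gt0.
Qed.

Lemma weight_bounds n : (0 < n)%N -> 0 <= (n%:R : R) `^ (- alpha) <= 1.
Proof.
have /andP[a0 a1] := alpha01.
move=> n0; rewrite powR_ge0 /=.
by have := @powR_npow_le 1 n (- alpha); rewrite powR1; apply; [rewrite n0|lra].
Qed.

Lemma block_weight_le k n : n \in block k -> (n%:R : R) `^ (alpha - 1) <= block_scale k.
Proof.
have /andP[a0 a1] := alpha01.
rewrite mem_block => /andP[h _]; apply: powR_npow_le; last by lra.
by rewrite expn_gt0.
Qed.

Lemma block_gt0 k n : n \in block k -> (0 < n)%N.
Proof. by rewrite mem_block => /andP[h _]; apply: leq_trans h; rewrite expn_gt0. Qed.

Lemma fluctuation_le X s k n : n \in block k -> `|fluctuation X s n| <= block_scale k.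
Proof.
move=> nb; have /andP[p0 p1] := weight_bounds (block_gt0 nb).
rewrite normrM -[leRHS]mul1r ler_pM //.
  by rewrite ler_norml; case: (X _) => /=; lra.
by rewrite ger0_norm ?powR_ge0 // block_weight_le.
Qed.

Lemma sum_block (V : nmodType) k (h : nat -> V) :
  \sum_(n <- block k) h n = \sum_(i < 2 ^ k) h (2 ^ k + i)%N.
Proof.
rewrite /block -{1}[(2 ^ k)%N]add0n big_addn expnS mul2n -addnn addnK big_mkord.
by apply: eq_bigr => i _; rewrite addnC.
Qed.

Variables (d : measure_display) (T : measurableType d) (P : probability T R).
Variable X : int -> {RV P >-> bool}.
Hypothesis selX : selectors alpha X.

(** The variance of the block is at most [block_scale k]: there are [2 ^ k] terms of
variance at most [2 ^ (- k alpha) * 2 ^ (2 k (alpha - 1))]. Moreover each term is at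
most the variance, which is at most its square root; so [t] may be of the order
of the inverse of the latter in [chernoff], and the deviation of [4 (k + 1)]
times its square root has probability at most [exp (1/2 - 2 (k + 1))]. *)
Lemma block_deviation k s (v : nat -> R) : (forall n, `|v n| <= 1) ->
  exists E : set T, [/\ measurable E, (P E <= (expR (2^-1 - 2 * k.+1%:R))%:E)%E &
    forall w, ~ E w -> \sum_(n <- block k) fluctuation (fun n => X n w) s n * v n <=
       4 * k.+1%:R * Num.sqrt (block_scale k)].
Proof.
move=> v1; have [indX pX] := selX; have /andP[a0 a1] := alpha01.
set B := block_scale k; have /andP[B0 B1] := block_scale_bounds k.
pose e (i : 'I_(2 ^ k)) := signed s (2 ^ k + i)%N.
pose p (i : 'I_(2 ^ k)) : R := (2 ^ k + i)%N%:R `^ (- alpha).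
pose u (i : 'I_(2 ^ k)) : R := (2 ^ k + i)%N%:R `^ (alpha - 1) * v (2 ^ k + i)%N.
have n0 (i : 'I_(2 ^ k)) : (0 < 2 ^ k + i)%N by rewrite ltn_addr // expn_gt0.
have nb (i : 'I_(2 ^ k)) : (2 ^ k + i)%N \in block k.
  by rewrite mem_block leq_addr expnS mul2n -addnn ltn_add2l /=.
have e_inj : injective e.
  by move=> i j; rewrite /e /signed; case: (s) => h; apply: ord_inj; lia.
have e0 i : e i != 0 by have := n0 i; rewrite /e /signed; case: (s) => h; lia.
have eabs i : `|e i|%N = (2 ^ k + i)%N by rewrite /e /signed; case: (s); lia.
have Xp i : P [set w | X (e i) w = true] = (p i)%:E by rewrite pX ?e0 // eabs.
have uB i : `|u i| <= B.
  rewrite normrM -[leRHS]mulr1 ler_pM // ger0_norm ?powR_ge0 //.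
  exact: block_weight_le.
pose q := Num.sqrt B.
have q0 : 0 < q by rewrite sqrtr_gt0.
have qq : q ^+ 2 = B by rewrite sqr_sqrtr // ltW.
have q1 : q <= 1 by rewrite -sqrtr1 ler_wsqrtr.
pose t := (2 * q)^-1.
have t0 : 0 < t by rewrite invr_gt0 mulr_gt0.
have [||i|E [mE PE HE]] := @chernoff R d T P X indX _ e p e_inj e0 Xp u t (4 * k.+1%:R * q).
- exact: ltW.
- by move=> i; apply: weight_bounds.
- rewrite normrM gtr0_norm // /t invfM -[leRHS]mulr1 -mulrA ler_pM2l ?invr_gt0 //.
  by rewrite ler_pdivrMl // mulr1 (le_trans (uB i)) // -qq expr2 ler_piMl // ltW.
exists E; split=> //.
  apply: (le_trans PE); rewrite lee_fin ler_expR.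
  have -> : t * (4 * k.+1%:R * q) = 2 * k.+1%:R.
    by rewrite /t; move: (k.+1%:R : R) => x; field; rewrite gt_eqF.
  rewrite lerB //.
  have S : \sum_i p i * u i ^+ 2 <= B.
    apply: (@le_trans _ _ (\sum_(i < 2 ^ k) (2 ^ k)%:R `^ (- alpha) * B ^+ 2)).
      apply: ler_sum => i _; apply: ler_pM; rewrite ?powR_ge0 ?sqr_ge0 //.
        by apply: powR_npow_le; [rewrite expn_gt0 leq_addr|lra].
      by rewrite -[u i ^+ 2]real_normK ?num_real // ler_sqr ?nnegrE ?(ltW B0) // uB.
    rewrite sumr_const card_ord -[leLHS]mulr_natl.
    have N0 : (2 ^ k)%:R != 0 :> R by rewrite pnatr_eq0 expn_eq0.
    have h : (2 ^ k)%:R * (2 ^ k)%:R `^ (- alpha) * B = 1 :> R.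
      rewrite -{1}[(2 ^ k)%:R](powRr1 (ler0n _ _)) /B /block_scale -!powRD ?N0 ?implybT //.
      by rewrite (_ : _ + _ = 0) ?powRr0 //; lra.
    by rewrite expr2 !mulrA h mul1r.
  apply: (@le_trans _ _ (2 * t ^+ 2 * B)).
    by rewrite ler_wpM2l // mulr_ge0 // sqr_ge0.
  rewrite -qq le_eqVlt /t; apply/orP; left; apply/eqP; field.
  by rewrite gt_eqF.
move=> w /HE; apply: le_trans; rewrite sum_block; apply: le_of_eq.
by apply: eq_bigr => i _; rewrite /fluctuation /u mulrA.
Qed.

Lemma normc_le (a b l : R) : `|a| <= l -> `|b| <= l -> `|a +i* b| <= (2 * l)%:C.
Proof.
move=> al bl; have l0 : 0 <= l by apply: le_trans al.
rewrite normc_def /= lecR -[leRHS]ger0_norm ?mulr_ge0 // -sqrtr_sqr ler_wsqrtr //.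
have ha : a ^+ 2 <= l ^+ 2 by rewrite -[a ^+ 2]real_normK ?num_real // ler_sqr ?nnegrE.
have hb : b ^+ 2 <= l ^+ 2 by rewrite -[b ^+ 2]real_normK ?num_real // ler_sqr ?nnegrE.
by rewrite exprMn; have := sqr_ge0 l; lra.
Qed.

(** A union bound over the [2 ^ (k+3)] frequencies, the two half-lines, the two signs
and the real and imaginary parts: the probability [exp (- 2 k)] wins over the
number of events. *)
Lemma block_fourier_deviation k (z : R[i]) : `|z| = 1 ->
  exists E : set T, [/\ measurable E,
    (P E <= (128 * expR 1 * 2^-1 ^+ k)%:E)%E &
    forall w, ~ E w -> forall s xi, (xi < 2 ^ k.+3)%N ->
      `|\sum_(n <- block k) (fluctuation (fun n => X n w) s n)%:C * (z ^+ n) ^+ xi| <=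
      (8 * k.+1%:R * Num.sqrt (block_scale k))%:C].
Proof.
move=> z1; set l := 4 * k.+1%:R * Num.sqrt (block_scale k).
pose Idx : finType := (bool * 'I_(2 ^ k.+3) * (bool * bool))%type.
pose v (i : Idx) (n : nat) : R := (-1) ^+ (i.2.1) *
   (if i.2.2 then complex.Re ((z ^+ n) ^+ i.1.2) else complex.Im ((z ^+ n) ^+ i.1.2)).
have z11 n xi : `|(z ^+ n) ^+ xi| = 1 by rewrite !normrX z1 !expr1n.
have ReIm (y : R[i]) : `|y| = 1 -> `|complex.Re y| <= 1 /\ `|complex.Im y| <= 1.
  case: y => a b; rewrite normc_def /= => -[h].
  have h2 : a ^+ 2 + b ^+ 2 = 1.
    by rewrite -[LHS]sqr_sqrtr ?addr_ge0 ?sqr_ge0 // h expr1n.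
  have := sqr_ge0 a; have := sqr_ge0 b.
  by move=> ? ?; split; rewrite -(@expr_le1 _ 2) // real_normK ?num_real //; lra.
have v1 i n : `|v i n| <= 1.
  rewrite /v normrM normrX normrN1 expr1n mul1r.
  by have [? ?] := ReIm _ (z11 n i.1.2); case: i.2.2.
have /choice[E HE] : forall i : Idx, exists E : set T, [/\ measurable E,
    (P E <= (expR (2^-1 - 2 * k.+1%:R))%:E)%E &
    forall w, ~ E w -> \sum_(n <- block k) fluctuation (fun n => X n w) i.1.1 n * v i n <= l].
  by move=> i; apply: block_deviation => n; exact: v1.
have mE i : measurable (E i) by have [] := HE i.
have [mU PU] := finite_union_bound P mE.
exists (\big[setU/set0]_(i : Idx) E i); split=> //.
  apply: (le_trans PU).
  apply: (@le_trans _ _ (\sum_(i : Idx) (expR (2^-1 - 2 * k.+1%:R))%:E)%E).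
    by apply: lee_sum => i _; have [] := HE i.
  rewrite sumEFin lee_fin sumr_const -[leLHS]mulr_natl.
  have -> : #|Idx| = (64 * 2 ^ k)%N.
    by rewrite !card_prod card_bool card_ord !expnS; lia.
  have e4 : 4 <= expR 2 :> R.
    have h2 : 2 <= expR 1 :> R by have := expR_ge1Dx (1 : R); lra.
    have -> : 2 = 1 + 1 :> R by lra.
    by rewrite expRD; nra.
  rewrite expRD natrM.
  have h1 : expR (- (2 * k.+1%:R)) <= 4^-1 ^+ k.+1 :> R.
    rewrite (_ : - (2 * k.+1%:R) = k.+1%:R * (- 2)); last by ring.
    rewrite expRM_natl expRN; apply: lerXn2r; rewrite ?nnegrE ?invr_ge0 ?expR_ge0 //.
    by rewrite lef_pV2 ?posrE ?expR_gt0.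
  have h0 : expR 2^-1 <= expR 1 :> R by rewrite ler_expR; lra.
  apply: (@le_trans _ _ (64 * (2 ^ k)%:R * (expR 1 * 4^-1 ^+ k.+1))).
    by rewrite ler_wpM2l ?mulr_ge0 // ler_pM ?expR_ge0.
  rewrite exprS natrX.
  have -> : 4^-1 ^+ k = 2^-1 ^+ k * 2^-1 ^+ k :> R by rewrite -exprMn; congr (_ ^+ _); lra.
  have e2 : 2 ^+ k * 2^-1 ^+ k = 1 :> R by rewrite -exprMn divff ?expr1n.
  rewrite (_ : 64 * _ * _ = (2 ^+ k * 2^-1 ^+ k) * (16 * expR 1 * 2^-1 ^+ k)); last first.
    by move: (2 ^+ k : R) (2^-1 ^+ k : R) (expR 1 : R) => x y e; field.
  rewrite e2 mul1r ler_wpM2r ?exprn_ge0 // ler_wpM2r ?expR_ge0 //; lra.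
move=> w nE s xi xin.
have part (b c : bool) : (-1) ^+ b * \sum_(n <- block k) fluctuation (fun n => X n w) s n *
    (if c then complex.Re ((z ^+ n) ^+ xi) else complex.Im ((z ^+ n) ^+ xi)) <= l.
  pose i : Idx := (s, Ordinal xin, (b, c)).
  have nEi : ~ E i w by move=> Ei; apply: nE; apply: (@bigsetU_mem _ _ _ _ predT i).
  have [_ _ /(_ w nEi)] := HE i; apply: le_trans.
  rewrite mulr_sumr; apply: le_of_eq; apply: eq_bigr => n _.
  by rewrite /v /= mulrCA.
have -> : \sum_(n <- block k) (fluctuation (fun n => X n w) s n)%:C * (z ^+ n) ^+ xi =
   (\sum_(n <- block k) fluctuation (fun n => X n w) s n * complex.Re ((z ^+ n) ^+ xi)) +i*
   (\sum_(n <- block k) fluctuation (fun n => X n w) s n * complex.Im ((z ^+ n) ^+ xi)).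
  elim/big_rec3: _ => // n a b c _ ->; case: ((z ^+ n) ^+ xi) => p q /=.
  by simpc.
have -> : 8 * k.+1%:R * Num.sqrt (block_scale k) = 2 * l by rewrite /l; ring.
apply: normc_le; rewrite ler_norml.
  have := part true true; have := part false true; rewrite expr0 expr1; lra.
have := part true false; have := part false false; rewrite expr0 expr1; lra.
Qed.

(** The frequencies are sampled at [2 ^ (k+3)] points, enough for functions on the
intervals of length [2 ^ (k+1)] and their triples. The constant absorbs the
finitely many blocks for which the deviation bound may fail. *)
Lemma random_fourier (z : nat -> R[i]) : (forall k, `|z k| = 1) ->
  {ae P, forall w, exists C : R, 1 <= C /\ forall s k xi, (xi < 2 ^ k.+3)%N ->
      `|\sum_(n <- block k) (fluctuation (fun n => X n w) s n)%:C * (z k ^+ n) ^+ xi| <=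
      (C * k.+1%:R * Num.sqrt (block_scale k))%:C}.
Proof.
move=> z1.
have /choice[E HE] := fun k => block_fourier_deviation k (z1 k).
have mE k : measurable (E k) by have [] := HE k.
have := @borel_cantelli R d T P E _ mE (fun k => let: And3 _ h _ := HE k in h).
apply: filterS => w [K HK].
(* In the blocks below [K] the trivial bound, the number of terms times
   [block_scale k], is at most [2 ^ K] times the square root of [block_scale k]. *)
exists (8 + (2 ^ K)%:R); split; first by have := ler0n R (2 ^ K); lra.
move=> s k xi xik; have [Kk|kK] := leqP K k.
  have [_ _ /(_ w (HK k Kk) s xi xik)] := HE k; move/le_trans; apply.
  rewrite lecR -!mulrA ler_wpM2r ?mulr_ge0 ?sqrtr_ge0 // lerDl ler0n //.
have /andP[B0 B1] := block_scale_bounds k.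
apply: (@le_trans _ _ (\sum_(n <- block k) (block_scale k)%:C)).
  apply: (le_trans (ler_norm_sum _ _ _)).
  apply: ler_sum_seq => n nb _.
  rewrite normrM !normrX z1 !expr1n mulr1.
  have -> : `|(fluctuation (fun n => X n w) s n)%:C| = (`|fluctuation (fun n => X n w) s n|)%:C :> R[i].
    by rewrite normc_def /= expr0n addr0 sqrtr_sqr.
  by rewrite lecR fluctuation_le.
rewrite sum_block sumr_const card_ord -rmorphMn /= lecR -mulr_natl.
apply: (@le_trans _ _ ((2 ^ K)%:R * (1 * Num.sqrt (block_scale k)))).
  rewrite mul1r; apply: ler_pM => //; first exact: ltW.
    by rewrite ler_nat leq_exp2l // ltnW.
  rewrite -{1}[block_scale k]sqr_sqrtr ?(ltW B0) // expr2 ler_piMl ?sqrtr_ge0 //.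
  by rewrite -sqrtr1 ler_wsqrtr.
rewrite -mulrA; apply: ler_pM; rewrite ?mulr_ge0 ?sqrtr_ge0 //.
  by rewrite lerDr.
by rewrite ler_wpM2r ?sqrtr_ge0 // ler1n.
Qed.

End Selectors.

(** * The random Hilbert form *)
Section Assembly.
Variables (R : realType) (alpha r : R).
Hypothesis alpha01 : 0 < alpha < 1.
Hypothesis ralpha : 1 + alpha < r < 2.

(** Admissible exponents satisfy [(2 - r) / r < theta < (1 - alpha) / (1 + alpha)]: the
first inequality makes the interpolation converge, and the second one makes the constants of
the blocks decay. The interval is nonempty exactly when [r > 1 + alpha]; the
midpoint will do. *)
Lemma interpolation_exponent : exists theta : R, [/\ 0 < theta < 1, (2 - r) / r < theta &
  (alpha - 1) * ((1 - theta) / 2) + alpha * theta < 0].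
Proof.
have /andP[a0 a1] := alpha01; have /andP[r1 r2] := ralpha.
have r0 : 0 < r by lra.
pose t0 := (2 - r) / r; pose t1 := (1 - alpha) / (1 + alpha).
have t0E : t0 * r = 2 - r by rewrite /t0 divfK // gt_eqF.
have t1E : t1 * (1 + alpha) = 1 - alpha by rewrite /t1 divfK // gt_eqF //; lra.
have t00 : 0 < t0 by rewrite divr_gt0 //; lra.
have t11 : t1 < 1 by rewrite ltr_pdivrMr; lra.
have t01 : t0 < t1 by rewrite /t0 /t1 ltr_pdivrMr // mulrAC ltr_pdivlMr; nra.
exists ((t0 + t1) / 2); split; [apply/andP; split; lra|rewrite -/t0; lra|].
have h : (t0 + t1) / 2 < t1 by lra.
have : (t0 + t1) / 2 * (1 + alpha) < 1 - alpha by rewrite -t1E ltr_pM2r //; lra.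
by lra.
Qed.

Lemma sum_arith_geometric (q : R) K : 0 <= q < 1 ->
  \sum_(k < K) k.+1%:R * q ^+ k <= (1 - q)^-1 ^+ 2.
Proof.
move=> /andP[q0 q1]; have p0 : 0 < 1 - q by lra.
rewrite exprVn -[leRHS]mul1r ler_pdivlMr ?exprn_gt0 //.
have -> : (\sum_(k < K) k.+1%:R * q ^+ k) * (1 - q) ^+ 2 =
    1 - K.+1%:R * q ^+ K + K%:R * q ^+ K.+1.
  elim: K => [|K IH]; first by rewrite big_ord0 mul0r expr0; ring.
  by rewrite big_ord_recr /= mulrDl IH !exprS -!natr1; ring.
have qK : q ^+ K.+1 <= q ^+ K by rewrite exprS ler_piMl ?exprn_ge0 // ltW.
have := ler_wpM2l (ler0n R K) qK; have := exprn_ge0 K q0; rewrite -natr1.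
by move: (q ^+ K) (q ^+ K.+1) (K%:R : R) => x y z; lra.
Qed.

Lemma arith_geometric_small (q C e : R) : 0 <= q < 1 -> 0 <= C -> 0 < e ->
  exists K, forall k, (K <= k)%N -> C * (k.+1%:R * (q ^+ k * q ^+ k)) <= e.
Proof.
move=> q01 C0 e0; have /andP[q0 q1] := q01.
pose B := (1 - q)^-1 ^+ 2; have B0 : 0 <= B by rewrite sqr_ge0.
have one k : k.+1%:R * q ^+ k <= B.
  apply: le_trans (sum_arith_geometric k.+1 q01); rewrite big_ord_recr /= lerDr.
  by apply: sumr_ge0 => i _; rewrite mulr_ge0 ?exprn_ge0.
exists (Num.bound (C * B * B / e)) => k Kk.
have h0 : 0 <= C * B * B / e.
  by apply: divr_ge0 (ltW e0); apply: mulr_ge0 => //; apply: mulr_ge0.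
have h : C * B * B / e < k.+1%:R.
  by apply: (lt_le_trans (archi_boundP h0)); rewrite ler_nat leqW.
have k0 : 0 < k.+1%:R :> R by rewrite ltr0n.
rewrite ltr_pdivrMr // in h.
rewrite -(ler_pM2l k0); apply: le_trans (ltW h).
have -> : k.+1%:R * (C * (k.+1%:R * (q ^+ k * q ^+ k))) = C * ((k.+1%:R * q ^+ k) * (k.+1%:R * q ^+ k)).
  by ring.
rewrite -[leRHS]mulrA ler_wpM2l //; apply: ler_pM; rewrite ?mulr_ge0 ?exprn_ge0 //.
Qed.

Lemma pow2_powR k (p : R) : (2 ^ k)%:R `^ p = (2 `^ p) ^+ k.
Proof. by rewrite natrX powR_expr. Qed.

(** With [M1 = 2 ^ (k (alpha - 1))] and [M2 = C (k + 1) sqrt M1] the constant of block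
[k] is of order [(k + 1) * rho ^ k], where the logarithm of [rho] in base 2 is the
negative exponent of [interpolation_exponent]. *)
Lemma scale_constant_sum (theta : R) : 0 < theta < 1 -> (2 - r) / r < theta ->
  (alpha - 1) * ((1 - theta) / 2) + alpha * theta < 0 ->
  exists2 S0 : R, 0 <= S0 & forall (C : R) K, 1 <= C ->
  \sum_(k < K) scale_constant r theta k (block_scale alpha k)
     (C * k.+1%:R * Num.sqrt (block_scale alpha k)) <= C * S0.
Proof.
move=> th01 th dec; have /andP[t0 t1] := th01; have /andP[a0 a1] := alpha01.
have /andP[r1 r2] := ralpha; have r12 : 1 < r < 2 by rewrite r2 andbT; lra.
set q := interpolation_ratio r theta.
pose rho : R := 2 `^ ((alpha - 1) * ((1 - theta) / 2) + alpha * theta).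
have rho01 : 0 <= rho < 1.
  rewrite powR_ge0 /= /rho /powR pnatr_eq0 /= -[X in _ < X]expR0 ltr_expR.
  by rewrite pmulr_llt0 // ln_gt0 // ltr1n.
pose A : R := (1 - q)^-1 ^+ 2 * (24 `^ theta * 3).
have A0 : 0 <= A by rewrite mulr_ge0 ?sqr_ge0 // mulr_ge0 ?powR_ge0.
exists (A * (1 - rho)^-1 ^+ 2); first by rewrite mulr_ge0 ?sqr_ge0.
move=> C K C1; have C0 : 0 <= C by lra.
apply: (@le_trans _ _ (\sum_(k < K) C * A * (k.+1%:R * rho ^+ k))); last first.
  by rewrite -mulr_sumr -mulrA ler_wpM2l // ler_wpM2l // sum_arith_geometric.
apply: ler_sum => k _; rewrite /scale_constant -/q.
set B := block_scale alpha k; have /andP[B0 B1] := block_scale_bounds alpha01 k.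
have N0 : (2 ^ k)%:R != 0 :> R by rewrite pnatr_eq0 expn_eq0.
have BN : B * (2 ^ k)%:R = (2 ^ k)%:R `^ alpha.
  rewrite /B /block_scale -{2}[(2 ^ k)%:R](powRr1 (ler0n _ _)) -powRD ?N0 ?implybT //.
  by rewrite subrK.
have k1 : 1 <= C * k.+1%:R.
  have : 1 <= k.+1%:R :> R by rewrite ler1n.
  by move: (k.+1%:R : R) => y; nra.
rewrite BN; set N := (2 ^ k)%:R in N0 BN *.
have N00 : 0 <= N by rewrite ler0n.
rewrite (powRM _ (le_trans ler01 k1) (sqrtr_ge0 _)) (powRM _ (ler0n R 24) (powR_ge0 _ _)).
have h : (C * k.+1%:R) `^ (1 - theta) <= C * k.+1%:R by apply: ler1_powR => //; lra.
have e : Num.sqrt B `^ (1 - theta) * (N `^ alpha) `^ theta = rho ^+ k.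
  rewrite -(powR12_sqrt (ltW B0)) /B /block_scale -!powRrM -powRD; last by rewrite N0 implybT.
  by rewrite /N pow2_powR /rho; congr (_ `^ _ ^+ _); ring.
rewrite (_ : _ * (_ * _ * _ * 3) = A * ((C * k.+1%:R) `^ (1 - theta) *
   (Num.sqrt B `^ (1 - theta) * (N `^ alpha) `^ theta))); last first.
  rewrite /A; move: ((1 - q)^-1 ^+ 2) (24 `^ theta) ((N `^ alpha) `^ theta).
  by move: ((C * k.+1%:R) `^ (1 - theta)) (Num.sqrt B `^ (1 - theta)) => x1 x2 x3 x4 x5; ring.
rewrite e (_ : C * A * _ = A * (C * k.+1%:R * rho ^+ k)); last by ring.
rewrite ler_wpM2l // ler_wpM2r // exprn_ge0 //; by case/andP: rho01.
Qed.

Lemma sum_convolver (c : nat -> R) K (m : int) : m < (2 ^ K)%N%:Z ->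
  \sum_(k < K) convolver c (block k) m = if 0 < m then c `|m|%N else 0.
Proof.
move=> mK; case: ifP => m0; last first.
  rewrite big1 // => k _; rewrite convolver_eq0 //.
  by have := expn_gt0 2 k; move: m0; clear; lia.
set n := `|m|%N; have n0 : (0 < n)%N by rewrite /n; move: m0; clear; lia.
have nK : (n < 2 ^ K)%N by rewrite /n; move: m0 mK; clear; lia.
have mE : m = n%:Z by rewrite /n; move: m0; clear; lia.
have kK : (trunc_log 2 n < K)%N.
  by rewrite -(@ltn_exp2l 2) //; apply: leq_ltn_trans nK; apply: trunc_logP.
have nb : n \in block (trunc_log 2 n) by rewrite mem_block trunc_logP //= trunc_log_ltn.
rewrite (bigD1 (Ordinal kK)) //= big1 ?addr0; last first.
  move=> k kne; rewrite convolver_eq0 // mE; apply/negP => h.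
  have h' : (2 ^ k <= n < 2 ^ k.+1)%N by move: h; clear; lia.
  case/andP: h' => h1 h2; move/eqP: kne; apply; apply: ord_inj => /=.
  by rewrite (@trunc_log_eq 2 k n) // h1.
rewrite /convolver (bigD1_seq n) ?iota_uniq //= big1 ?addr0; last first.
  move=> i ine; rewrite (_ : (m == i%:Z) = false) ?mulr0 //.
  by apply/negbTE; move: ine; apply: contra; rewrite mE; clear; lia.
by rewrite mE eqxx mulr1.
Qed.

Section Deterministic.
Variables (X : int -> bool) (C theta S0 : R).
Variable z : nat -> R[i].
Hypotheses (C1 : 1 <= C) (th01 : 0 < theta < 1) (th : (2 - r) / r < theta).
Hypothesis zN : forall k, (2 ^ k.+3).-primitive_root (z k).
Hypothesis FX : forall s k xi, (xi < 2 ^ k.+3)%N ->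
  `|\sum_(n <- block k) (fluctuation alpha X s n)%:C * (z k ^+ n) ^+ xi| <=
  (C * k.+1%:R * Num.sqrt (block_scale alpha k))%:C.
Hypothesis S0P : forall K, \sum_(k < K) scale_constant r theta k (block_scale alpha k)
     (C * k.+1%:R * Num.sqrt (block_scale alpha k)) <= C * S0.

Let r12 : 1 < r < 2.
Proof. by have /andP[? ?] := alpha01; have /andP[r1 r2] := ralpha; rewrite r2 andbT; lra. Qed.

Let fl s := fluctuation alpha X s.
Let sc k := scale_constant r theta k (block_scale alpha k)
     (C * k.+1%:R * Num.sqrt (block_scale alpha k)).

Lemma random_scale s k (F G u v : int -> R) (D : R) b K :
  (forall x, `|F x| <= u x) -> (forall x, `|G x| <= v x) ->
  (forall x, F x != 0 -> x \in points (ival (b, K))) ->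
  sparse_bound 4^-1 r u v D -> 0 <= D ->
  `|\sum_(x <- points (ival (b, K))) \sum_(y <- points (ival (b, K)))
      convolver (fl s) (block k) (x - y) * F y * G x| <= sc k * D.
Proof.
move=> Fu Gv sF HD D0.
have /andP[B0 B1] := block_scale_bounds alpha01 k.
apply: (single_scale_sparse r12 th01 th (ltW B0) (zN k) _ _ Fu Gv sF HD D0).
- by move=> n; apply: fluctuation_le.
- by move=> xi; apply: FX.
Qed.

Lemma sparse_boundC (u v : int -> R) D : sparse_bound 4^-1 r u v D -> sparse_bound 4^-1 r v u D.
Proof.
move=> H S /H; apply: le_trans; rewrite le_eqVlt; apply/orP; left; apply/eqP.
by apply: eq_esum => I _; rewrite (mulrC (raverage r v I)).
Qed.

(** At zero the sign vanishes, and so does the kernel. *)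
Definition hilbert_kernel (m : int) : R :=
  (X m)%:R / ((sgz m)%:~R * (`|m|%N%:R : R) `^ (1 - alpha)).

Lemma hilbert_kernel_split (m : int) K : (`|m| < 2 ^ K)%N ->
  hilbert_kernel m = m%:~R^-1 +
   (\sum_(k < K) convolver (fl true) (block k) m -
    \sum_(k < K) convolver (fl false) (block k) (- m)).
Proof.
move=> mK; have [m1 m2] : m < (2 ^ K)%N%:Z /\ - m < (2 ^ K)%N%:Z by move: mK; clear; lia.
rewrite !sum_convolver //.
have key n : (n.+1%:R `^ (1 - alpha))^-1 = n.+1%:R `^ (alpha - 1) :> R.
  by rewrite -powRN opprB.
rewrite /hilbert_kernel /fl; case: m {m1 m2 mK} => [[|n]|n].
- by rewrite sgz0 /= invr0 mul0r invr0 mulr0 subr0 addr0.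
- rewrite /= fluctuationE // -key subr0 mul1r -pmulrn; ring.
- rewrite NegzE opprK /= fluctuationE // -key sub0r /=.
  by rewrite !rmorphN /= rmorph1 mulN1r !invrN -pmulrn; ring.
Qed.

(** On an interval that contains both supports, the truncation of the Hilbert form is
vacuous and the sum over the scales is finite. The negative half-line is the
positive one with the roles of [F] and [G] exchanged. *)
Lemma hilbert_bound (F G u v : int -> R) (D : R) b K :
  (forall x, `|F x| <= u x) -> (forall x, `|G x| <= v x) ->
  (forall x, F x != 0 -> x \in points (ival (b, K))) ->
  (forall x, G x != 0 -> x \in points (ival (b, K))) ->
  sparse_bound 4^-1 r u v D -> 0 <= D ->
  `|\sum_(x <- points (ival (b, K))) \sum_(y <- points (ival (b, K)))
      hilbert_kernel (x - y) * F y * G x| <=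
  (local_constant R * ball_constant R * ball_constant R + 2 * (C * S0)) * D.
Proof.
move=> Fu Gv sF sG HD D0; set s := points _.
have u0 x : 0 <= u x by apply: le_trans (Fu x).
have v0 x : 0 <= v x by apply: le_trans (Gv x).
have near (x y : int) : x \in s -> y \in s -> (`|x - y| < 2 ^ K)%N.
  by rewrite /s !mem_pointsE /=; clear; lia.
have /andP[r1 r2] := r12.
have hdet : `|truncated_form F G (ival (b, K))| <= local_constant R * ball_constant R * ball_constant R * D.
  exact: (hilbert_sparse r1 u0 v0 HD b K Fu Gv).
have hpos : `|\sum_(k < K) \sum_(x <- s) \sum_(y <- s) convolver (fl true) (block k) (x - y) * F y * G x|
    <= C * S0 * D.
  apply: (le_trans (ler_norm_sum _ _ _)).
  apply: (@le_trans _ _ (\sum_(k < K) sc k * D)).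
    by apply: ler_sum => k _; apply: random_scale Fu Gv sF HD D0.
  by rewrite -mulr_suml ler_wpM2r.
have hneg : `|\sum_(k < K) \sum_(y <- s) \sum_(x <- s) convolver (fl false) (block k) (y - x) * G x * F y|
    <= C * S0 * D.
  apply: (le_trans (ler_norm_sum _ _ _)).
  apply: (@le_trans _ _ (\sum_(k < K) sc k * D)).
    by apply: ler_sum => k _; apply: random_scale Gv Fu sG (sparse_boundC HD) D0.
  by rewrite -mulr_suml ler_wpM2r.
have -> : \sum_(x <- s) \sum_(y <- s) hilbert_kernel (x - y) * F y * G x =
  truncated_form F G (ival (b, K)) +
  (\sum_(k < K) \sum_(x <- s) \sum_(y <- s) convolver (fl true) (block k) (x - y) * F y * G x -
   \sum_(k < K) \sum_(y <- s) \sum_(x <- s) convolver (fl false) (block k) (y - x) * G x * F y).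
  rewrite [X in _ + (X - _)]exchange_big [X in _ + (_ - X)]exchange_big /=.
  have -> : \sum_(y <- s) \sum_(k < K) \sum_(x <- s) convolver (fl false) (block k) (y - x) * G x * F y =
     \sum_(x <- s) \sum_(y <- s) \sum_(k < K) convolver (fl false) (block k) (y - x) * G x * F y.
    by rewrite [RHS]exchange_big /=; apply: eq_bigr => y _; rewrite exchange_big.
  rewrite /truncated_form -sumrB -big_split /=.
  apply: eq_big_seq => x xs.
  rewrite exchange_big /= -sumrB.
  have -> : \sum_(y <- points (triple (ival (b, K))) | (`|x - y| < 2 ^ K)%N) F y * G x * kernel R x y =
      \sum_(y <- s) F y * G x * kernel R x y.
    rewrite (bigID (fun y => y \in s)) /= [X in _ + X]big1 ?addr0; last first.
      move=> y /andP[_ ys]; have [->|/sF] := eqVneq (F y) 0; first by rewrite !mul0r.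
      by rewrite -/s (negbTE ys).
    rewrite [RHS]big_seq; apply: eq_sum_sub; rewrite ?uniq_points // => y.
    have [ys|ys] := boolP (y \in s); rewrite ?andbF //= andbT (near _ _ xs ys) andbT.
    by move: ys; rewrite /s !mem_pointsE /=; clear; lia.
  rewrite -big_split; apply: eq_big_seq => y ys /=.
  rewrite (hilbert_kernel_split (near _ _ xs ys)) opprB /kernel -!mulr_suml; ring.
apply: (le_trans (ler_normD _ _)); rewrite mulrDl; apply: lerD => //.
apply: (le_trans (ler_normB _ _)).
by rewrite (_ : 2 * (C * S0) * D = C * S0 * D + C * S0 * D); [apply: lerD|ring].
Qed.

End Deterministic.
End Assembly.

(** * Growth of the number of selected integers *)
Section Counting.
Variables (R : realType) (alpha : R).
Hypothesis alpha01 : 0 < alpha < 1.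

Lemma block_scaleE k : block_scale alpha k = (2 `^ (alpha - 1)) ^+ k.
Proof. exact: pow2_powR. Qed.

Lemma scale_ratio_bounds : 2^-1 <= 2 `^ (alpha - 1) :> R /\ 2 `^ (alpha - 1) < 1 :> R.
Proof.
have /andP[a0 a1] := alpha01.
have h p q : p < q -> 2 `^ p < 2 `^ q :> R.
  move=> pq; rewrite /powR pnatr_eq0 /= ltr_expR ltr_pM2r //.
  by rewrite ln_gt0 // ltr1n.
split; last by rewrite -[ltRHS](powRr0 2); apply: h; lra.
have -> : 2^-1 = 2 `^ (-1) :> R by rewrite powR_inv1.
by apply/ltW/h; lra.
Qed.

Lemma sum_blocks (V : nmodType) (h : nat -> V) J :
  \sum_(1 <= n < 2 ^ J) h n = \sum_(j < J) \sum_(n <- block j) h n.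
Proof.
elim: J => [|J IH]; first by rewrite big_ord0 expn0 big_geq.
by rewrite big_ord_recr /= -IH /block [LHS](@big_cat_nat _ _ _ (2 ^ J)%N) ?expn_gt0 ?leq_exp2l.
Qed.

Lemma selector_count_mono (X : int -> bool) m n : (m <= n)%N ->
  (selector_count X m <= selector_count X n)%N.
Proof.
by move=> mn; rewrite /selector_count [leqRHS](@big_cat_nat _ _ _ m.+1) //= leq_addr.
Qed.

(** The zero frequency controls the weighted number of selected integers in a block:
its mean [\sum 1/n] is at least [1/2] and its fluctuation is small for large
[k]. For the remaining [k] it suffices that the integer 1 is selected. *)
Lemma selector_count_growth (X : int -> bool) (C : R) : 1 <= C -> X 1 ->
  (forall k, `|\sum_(n <- block k) fluctuation alpha X true n| <=
     C * k.+1%:R * Num.sqrt (block_scale alpha k)) ->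
  exists2 c : R, 0 < c & forall k, c <= (selector_count X (2 ^ k))%:R * block_scale alpha k.
Proof.
move=> C1 X1 FX; have C0 : 0 <= C by lra.
have /andP[a0 a1] := alpha01.
have [rho2 rho1] := scale_ratio_bounds.
have bs0 k : 0 < block_scale alpha k by case/andP: (block_scale_bounds alpha01 k).
have bs1 k : block_scale alpha k <= 1 by case/andP: (block_scale_bounds alpha01 k).
pose q : R := 2 `^ ((alpha - 1) / 4).
have q01 : 0 <= q < 1.
  rewrite powR_ge0 /= /q /powR pnatr_eq0 /= -[X in _ < X]expR0 ltr_expR.
  by rewrite pmulr_llt0 ?ln_gt0 ?ltr1n //; lra.
have sqrtE k : Num.sqrt (block_scale alpha k) = q ^+ k * q ^+ k.
  rewrite -(powR12_sqrt (ltW (bs0 k))) /block_scale -powRrM pow2_powR -exprMn -powRD ?pnatr_eq0 ?implybT //.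
  by congr (_ `^ _ ^+ _); field.
have e0 : 0 < 4^-1 :> R by lra.
have [K HK] := arith_geometric_small q01 C0 e0.
(* Below the threshold [K], the count is at least 1 and [block_scale] is at least its
   value at [K]; above it, the weighted count is at least [1/2 - 1/4]. *)
pose c := Num.min 4^-1 (block_scale alpha K).
have c0 : 0 < c by rewrite lt_min e0 bs0.
have S1 k : 1 <= (selector_count X (2 ^ k))%:R :> R.
  rewrite ler1n; apply: (leq_trans _ (@selector_count_mono X 1 _ _)); last by rewrite expn_gt0.
  by rewrite /selector_count big_nat1 X1.
have step k : c <= (selector_count X (2 ^ k.+1))%:R * block_scale alpha k.
  have [kK|Kk] := ltnP k K.
    apply: (@le_trans _ _ (block_scale alpha K)); first by rewrite ge_min lexx orbT.
    apply: (@le_trans _ _ (block_scale alpha k)); last by rewrite ler_peMl // ltW.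
    rewrite !block_scaleE; apply: ler_wiXn2l; [lra|lra|exact: ltnW].
  apply: (@le_trans _ _ 4^-1); first by rewrite ge_min lexx.
  have hf := FX k; have hK := HK k Kk; rewrite sqrtE in hf.
  have {hf hK} hf : `|\sum_(n <- block k) fluctuation alpha X true n| <= 4^-1.
    by apply: le_trans hf _; rewrite -mulrA.
  have wE : \sum_(n <- block k) fluctuation alpha X true n =
      \sum_(n <- block k) (X n%:Z)%:R * n%:R `^ (alpha - 1) - \sum_(n <- block k) n%:R^-1.
    rewrite -sumrB big_seq [RHS]big_seq; apply: eq_bigr => n /block_gt0 n0.
    by rewrite fluctuationE.
  have half : 2^-1 <= \sum_(n <- block k) (n%:R : R)^-1.
    apply: (@le_trans _ _ (\sum_(n <- block k) ((2 ^ k.+1)%:R : R)^-1)).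
      by rewrite sum_block sumr_const card_ord -[leRHS]mulr_natr expnS natrM invfM -mulrA mulVf ?mulr1.
    apply: ler_sum_seq => n nb _; have n0 := block_gt0 nb.
    rewrite lef_pV2 ?posrE ?ltr0n ?expn_gt0 // ler_nat ltnW //.
    by move: nb; rewrite mem_block => /andP[].
  have up : \sum_(n <- block k) (X n%:Z)%:R * n%:R `^ (alpha - 1) <=
      (selector_count X (2 ^ k.+1))%:R * block_scale alpha k.
    apply: (@le_trans _ _ (\sum_(n <- block k) (X n%:Z)%:R * block_scale alpha k)).
      apply: ler_sum_seq => n nb _.
      by rewrite ler_wpM2l // block_weight_le.
    rewrite -mulr_suml ler_wpM2r ?(ltW (bs0 k)) // /selector_count.
    have -> : \sum_(n <- block k) (X n%:Z)%:R = (\sum_(n <- block k) (X n%:Z : nat))%N%:R :> R.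
      by rewrite natr_sum.
    rewrite ler_nat.
    rewrite [leqRHS]big_nat_recr /=; last by rewrite expn_gt0.
    by rewrite sum_blocks big_ord_recr /= -addnA addnCA leq_addr.
  by move: hf; rewrite wE ler_norml => /andP[h _]; lra.
exists (c / 2); first by rewrite divr_gt0.
case=> [|k].
  rewrite block_scaleE expr0 mulr1; apply: le_trans (S1 0%N).
  have : c <= 4^-1 by rewrite ge_min lexx.
  by lra.
rewrite block_scaleE exprSr -block_scaleE mulrA; apply: ler_pM => //.
by rewrite ltW.
Qed.

End Counting.

(** * The random maximal function *)
Section MaximalBound.
Variables (R : realType) (alpha r : R).
Hypothesis alpha01 : 0 < alpha < 1.
Hypothesis ralpha : 1 + alpha < r < 2.
Variables (X : int -> bool) (C theta S0 : R).
Variable z : nat -> R[i].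
Hypotheses (C1 : 1 <= C) (th01 : 0 < theta < 1) (th : (2 - r) / r < theta).
Hypothesis zN : forall k, (2 ^ k.+3).-primitive_root (z k).
Hypothesis FX : forall s k xi, (xi < 2 ^ k.+3)%N ->
  `|\sum_(n <- block k) (fluctuation alpha X s n)%:C * (z k ^+ n) ^+ xi| <=
  (C * k.+1%:R * Num.sqrt (block_scale alpha k))%:C.
Hypothesis S0P : forall K, \sum_(k < K) scale_constant r theta k (block_scale alpha k)
     (C * k.+1%:R * Num.sqrt (block_scale alpha k)) <= C * S0.

Local Notation rho := (2 `^ (alpha - 1) : R).

Definition selected_average (u : int -> R) (N : nat) (x : int) : R :=
  ((selector_count X N)%:R)^-1 * \sum_(1 <= n < N.+1) (X n%:Z)%:R * u (x - n%:Z).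

Definition selected_block (u : int -> R) (j : nat) (x : int) : R :=
  \sum_(n <- block j) (X n%:Z)%:R * n%:R `^ (alpha - 1) * u (x - n%:Z).

Definition fluctuation_block (u : int -> R) (j : nat) (x : int) : R :=
  \sum_(n <- block j) fluctuation alpha X true n * u (x - n%:Z).

Lemma ball_average_ge0 (u : int -> R) j x : (forall x, 0 <= u x) -> 0 <= ball_average u j x.
Proof. by move=> u0; rewrite mulr_ge0 ?invr_ge0 ?ler0n // sumr_ge0. Qed.

Lemma selected_block_le u j x : (forall x, 0 <= u x) ->
  selected_block u j x <= `|fluctuation_block u j x| + 2 * ball_average u j.+1 x.
Proof.
move=> u0.
have -> : selected_block u j x =
    fluctuation_block u j x + \sum_(n <- block j) n%:R^-1 * u (x - n%:Z).
  rewrite -big_split /= /selected_block big_seq [RHS]big_seq; apply: eq_bigr => n /block_gt0 n0.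
  by rewrite fluctuationE //= mulrBl subrK.
apply: lerD; first exact: ler_norm.
apply: (@le_trans _ _ (\sum_(n <- block j) (2 ^ j)%:R^-1 * u (x - n%:Z))).
  apply: ler_sum_seq => n nb _; rewrite ler_wpM2r //.
  rewrite lef_pV2 ?posrE ?ltr0n ?expn_gt0 ?(block_gt0 nb) // ler_nat.
  by move: nb; rewrite mem_block => /andP[].
rewrite -mulr_sumr /ball_average expnS natrM invfM !mulrA divff // mul1r.
rewrite ler_wpM2l ?invr_ge0 ?ler0n //.
have -> : \sum_(n <- block j) u (x - n%:Z) =
    \sum_(y <- map (fun n : nat => x - n%:Z) (block j)) u y by rewrite big_map.
apply: sumr_le_sub => //.
  by rewrite map_inj_uniq ?iota_uniq // => m n; clear; lia.
move=> y /mapP[n]; rewrite mem_block expnS => nb -> _; rewrite mem_points andbT.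
by move: nb; clear; lia.
Qed.

(** The number of selected integers up to [N] is at least of order [2 ^ (J (1 - alpha))] with
[J] the logarithm of [N]; normalizing block [j] by its own size instead leaves the
weight [rho ^ (J - j)]. *)
Lemma selected_average_le (c : R) u N x : (forall x, 0 <= u x) -> 0 < c ->
  (forall k, c <= (selector_count X (2 ^ k))%:R * block_scale alpha k) -> (0 < N)%N ->
  selected_average u N x <=
    c^-1 * 2 * \sum_(j < (trunc_log 2 N).+1) rho ^+ (trunc_log 2 N - j) * selected_block u j x.
Proof.
move=> u0 c0 cP N0; have /andP[a0 a1] := alpha01.
have [rho2 rho1] := scale_ratio_bounds alpha01; have rho0 : 0 < rho by lra.
set J := trunc_log 2 N.
have JN : (2 ^ J <= N)%N by apply: trunc_logP.
have NJ : (N < 2 ^ J.+1)%N by apply: trunc_log_ltn.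
have rJ : 0 < rho ^+ J by rewrite exprn_gt0.
have cS : c <= (selector_count X N)%:R * rho ^+ J.
  rewrite -block_scaleE; apply: le_trans (cP J) _.
  by rewrite block_scaleE (ler_wpM2r (ltW rJ)) // ler_nat selector_count_mono.
have Sp : 0 < (selector_count X N)%:R :> R.
  by rewrite -(pmulr_lgt0 _ rJ); apply: lt_le_trans cS.
have Si : (selector_count X N)%:R^-1 <= c^-1 * rho ^+ J.
  by rewrite mulrC ler_pdivlMr // mulrC -ler_pdivlMr ?invr_gt0 // invrK mulrC.
apply: (@le_trans _ _ (c^-1 * rho ^+ J * \sum_(1 <= n < N.+1) (X n%:Z)%:R * u (x - n%:Z))).
  by rewrite ler_wpM2r // sumr_ge0 // => n _; rewrite mulr_ge0.
apply: (@le_trans _ _ (c^-1 * rho ^+ J * \sum_(1 <= n < 2 ^ J.+1) (X n%:Z)%:R * u (x - n%:Z))).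
  rewrite ler_wpM2l // ?mulr_ge0 ?invr_ge0 ?(ltW c0) ?(ltW rJ) //.
  rewrite [leRHS](@big_cat_nat _ _ _ N.+1) //= lerDl sumr_ge0 // => n _.
  by rewrite mulr_ge0.
rewrite sum_blocks -!mulrA ler_wpM2l ?invr_ge0 ?(ltW c0) // !mulr_sumr.
apply: ler_sum => j _.
have jJ : (j <= J)%N by rewrite -ltnS.
have -> : rho ^+ J = rho ^+ (J - j) * rho ^+ j by rewrite -exprD subnK.
rewrite mulrCA -mulrA ler_wpM2l ?exprn_ge0 ?(ltW rho0) //.
rewrite /selected_block 2!mulr_sumr big_seq [leRHS]big_seq; apply: ler_sum => n nb.
have h : rho ^+ j <= 2 * n%:R `^ (alpha - 1).
  have hn : rho ^+ j.+1 <= n%:R `^ (alpha - 1).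
    rewrite -block_scaleE /block_scale; apply: powR_npow_le; last by lra.
    by rewrite (block_gt0 nb) ltnW //; move: nb; rewrite mem_block => /andP[].
  have p0 : 0 < rho ^+ j by rewrite exprn_gt0.
  rewrite exprS in hn; have := le_trans (ler_wpM2r (ltW p0) rho2) hn.
  by move: (rho ^+ j) (n%:R `^ _) => p y; lra.
have X0 : 0 <= (X n%:Z)%:R * u (x - n%:Z) by rewrite mulr_ge0.
have := ler_wpM2r X0 h.
by rewrite (_ : 2 * n%:R `^ (alpha - 1) * ((X n%:Z)%:R * u (x - n%:Z)) =
  2 * ((X n%:Z)%:R * n%:R `^ (alpha - 1) * u (x - n%:Z))) //; ring.
Qed.

Lemma fluctuation_block_convolver (u : int -> R) (s : seq int) j x : uniq s ->
  (forall y, u y != 0 -> y \in s) ->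
  fluctuation_block u j x =
  \sum_(y <- s) convolver (fluctuation alpha X true) (block j) (x - y) * u y.
Proof.
move=> us su; rewrite /fluctuation_block /convolver.
under [RHS]eq_bigr => y _ do rewrite mulr_suml.
rewrite exchange_big /=; apply: eq_bigr => n _.
under [RHS]eq_bigr => y _ do rewrite -mulrA.
rewrite -mulr_sumr; congr (_ * _).
have e (y : int) : y != x - n%:Z -> (x - y == n%:Z)%:R * u y = 0.
  move=> h; rewrite (_ : (x - y == n%:Z) = false) ?mul0r //.
  by apply/negbTE; move: h; apply: contra; clear; lia.
have [xs|xs] := boolP (x - n%:Z \in s).
  rewrite (bigD1_seq _ xs us) /= big1 ?addr0; last exact: e.
  by rewrite (_ : (x - (x - n%:Z) == n%:Z) = true) ?mul1r //; clear; lia.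
have ux : u (x - n%:Z) = 0 by apply/eqP; apply: contraNT xs; apply: su.
rewrite ux big1_seq // => y _; have [->|/e //] := eqVneq y (x - n%:Z).
by rewrite ux mulr0.
Qed.

(** The sum of all fluctuations replaces their supremum over the scales: it is
summable after pairing. The averages are handled through their largest value [B],
at the expense of a geometric series. *)
Lemma selected_average_split (c : R) u b K N x : (forall x, 0 <= u x) -> 0 < c ->
  (forall k, c <= (selector_count X (2 ^ k))%:R * block_scale alpha k) -> (0 < N)%N ->
  (forall y, u y != 0 -> y \in points (ival (b, K))) -> x \in points (ival (b, K)) ->
  forall B : R, 0 <= B -> (forall j, (j < K)%N -> ball_average u j.+1 x <= B) ->
  selected_average u N x <=
    c^-1 * 2 * (\sum_(j < K) `|fluctuation_block u j x| + 2 * (1 - rho)^-1 * B).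
Proof.
move=> u0 c0 cP N0 su xs B B0 BP.
have [rho2 rho1] := scale_ratio_bounds alpha01; have rho0 : 0 < rho by lra.
apply: le_trans (selected_average_le x u0 c0 cP N0) _.
have c20 : 0 <= c^-1 * 2 by rewrite mulr_ge0 ?invr_ge0 // ltW.
rewrite (ler_wpM2l c20) //; set J := trunc_log 2 N.
have far j : (K <= j)%N -> selected_block u j x = 0.
  move=> Kj; rewrite /selected_block big1_seq // => n /andP[_ nb].
  suff -> : u (x - n%:Z) = 0 by rewrite mulr0.
  apply/eqP; apply: contraT => /su; move: xs; rewrite !mem_pointsE /=.
  have : (2 ^ K <= n)%N.
    by move: nb; rewrite mem_block => /andP[h _]; apply: leq_trans h; rewrite leq_exp2l.
  by move: (2 ^ K)%N; clear; lia.
have one j : rho ^+ (J - j) * selected_block u j x <=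
    (if (j < K)%N then `|fluctuation_block u j x| else 0) + rho ^+ (J - j) * (2 * B).
  case: ltnP => jK; last by rewrite far // mulr0 add0r !mulr_ge0 ?exprn_ge0 // ltW.
  apply: (@le_trans _ _ (rho ^+ (J - j) * (`|fluctuation_block u j x| + 2 * B))).
    rewrite ler_wpM2l ?exprn_ge0 ?(ltW rho0) //; apply: le_trans (selected_block_le j x u0) _.
    by rewrite lerD2l ler_wpM2l // BP.
  by rewrite mulrDr lerD2r ler_piMl // exprn_ile1 // ltW.
apply: (@le_trans _ _ (\sum_(j < J.+1) ((if (j < K)%N then `|fluctuation_block u j x| else 0) +
   rho ^+ (J - j) * (2 * B)))); first exact: ler_sum.
rewrite big_split /=; apply: lerD.
  rewrite -big_mkcond /= -(big_mkord (fun j => j < K)%N (fun j => `|fluctuation_block u j x|)).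
  rewrite -(big_mkord xpredT (fun j => `|fluctuation_block u j x|)).
  by apply: sumr_le_sub; rewrite ?iota_uniq // => j; rewrite !mem_index_iota => _ ->.
rewrite -mulr_suml mulrCA mulrA ler_wpM2r // ?mulr_ge0 // mulrC.
rewrite (reindex_inj rev_ord_inj) /=.
under eq_bigr => j _ do rewrite subSS subKn ?leq_ord //.
by rewrite mulrC ler_wpM2l //; apply: geometric_le; rewrite ltW.
Qed.

(** The scale of the ordinary average is chosen at each point so as to maximise it,
and the sign of each fluctuation is absorbed into the second function. Every
quantity [m] below all upper bounds of the averages is admitted, so as to cover
the supremum. *)
Lemma maximal_bound : X 1 -> exists CM : R, 0 <= CM /\
  forall (u v : int -> R) (D : R) b K (m : int -> R),
  (forall x, 0 <= u x) -> (forall x, 0 <= v x) ->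
  (forall x, u x != 0 -> x \in points (ival (b, K))) ->
  (forall x A, (forall N, (0 < N)%N -> selected_average u N x <= A) -> m x <= A) ->
  sparse_bound 4^-1 r u v D -> 0 <= D ->
  \sum_(x <- points (ival (b, K))) m x * v x <= CM * D.
Proof.
move=> X1.
have [rho2 rho1] := scale_ratio_bounds alpha01; have rho0 : 0 < rho by lra.
have FX0 k : `|\sum_(n <- block k) fluctuation alpha X true n| <=
     C * k.+1%:R * Num.sqrt (block_scale alpha k).
  have p : (0 < 2 ^ k.+3)%N by rewrite expn_gt0.
  rewrite -lecR; apply: le_trans (FX true p).
  under [X in _ <= `|X|]eq_bigr => n _ do rewrite expr0 mulr1.
  by rewrite -rmorph_sum; apply: le_trans (normc_ge_Re _).
have [c c0 cP] := selector_count_growth alpha01 C1 X1 FX0.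
have r1 : 1 < r by move: alpha01 ralpha => /andP[? _] /andP[? _]; lra.
have g0 : 0 <= (1 - rho)^-1 by rewrite invr_ge0; lra.
have S00 : 0 <= C * S0 by apply: le_trans (S0P 0); rewrite big_ord0.
exists (c^-1 * 2 * (C * S0 + 2 * (1 - rho)^-1 * (6 * ball_constant R))).
have c20 : 0 <= c^-1 * 2 by rewrite mulr_ge0 ?invr_ge0 // ltW.
split.
  apply: mulr_ge0 => //; apply: addr_ge0 => //; apply: mulr_ge0.
    by apply: mulr_ge0.
  by apply: mulr_ge0; rewrite ?ball_constant_ge0.
move=> u v D b K m u0 v0 su mP HD D0.
pose scale x : 'I_K.+1 := [arg max_(j > ord0) ball_average u j x]%O.
have scaleP x j : (j <= K)%N -> ball_average u j x <= ball_average u (scale x) x.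
  rewrite -ltnS => jK; rewrite /scale; case: arg_maxP => // i _ h.
  exact: (h (Ordinal jK)).
set s := points (ival (b, K)).
apply: (@le_trans _ _ (\sum_(x <- s) (c^-1 * 2) * (\sum_(j < K) `|fluctuation_block u j x| * v x +
     2 * (1 - rho)^-1 * (v x * ball_average u (scale x) x)))).
  apply: ler_sum_seq => x xs _.
  rewrite -mulr_suml [_ * (v x * _)]mulrCA -[X in _ + X]mulrC -mulrDl mulrA ler_wpM2r //.
  apply: mP => N N0; apply: (selected_average_split u0 c0 cP N0 su xs (ball_average_ge0 _ _ u0)).
  by move=> j jK; apply: scaleP.
rewrite -mulr_sumr -[leRHS]mulrA (ler_wpM2l c20) // big_split /= (mulrDl (C * S0)).
apply: lerD; last first.
  rewrite -mulr_sumr -[leRHS]mulrA ler_wpM2l ?mulr_ge0 //.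
  apply: le_trans (maximal_sparse r1 u0 v0 HD (fun x => scale x : nat) b K.+1).
  apply: (@le_trans _ _ (\sum_(x <- points (ival (b, K.+1)))  v x * ball_average u (scale x) x)).
    apply: sumr_le_sub; rewrite ?uniq_points //.
      move=> x; rewrite /s !mem_pointsE /= expnS; clear; lia.
    by move=> x; rewrite mulr_ge0 // ball_average_ge0.
  by apply: ler_sum => x _; rewrite ltn_ord.
rewrite exchange_big /=.
apply: (@le_trans _ _ (\sum_(k < K) scale_constant r theta k (block_scale alpha k)
     (C * k.+1%:R * Num.sqrt (block_scale alpha k)) * D)); last first.
  by rewrite -mulr_suml ler_wpM2r.
apply: ler_sum => j _.
pose G x := Num.sg (fluctuation_block u j x) * v x.
have -> : \sum_(x <- s) `|fluctuation_block u j x| * v x = \sum_(x <- s) \sum_(y <- s)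
   convolver (fluctuation alpha X true) (block j) (x - y) * u y * G x.
  apply: eq_bigr => x _; rewrite -mulr_suml -fluctuation_block_convolver ?uniq_points //.
  by rewrite /G mulrA; congr (_ * _); rewrite mulrC normrEsg.
apply: le_trans (ler_norm _) _.
apply: (random_scale alpha01 ralpha th01 th zN FX true j _ _ su HD D0) => x.
  by rewrite ger0_norm.
rewrite /G normrM normr_sg (ger0_norm (v0 x)) ler_piMl //.
by case: (_ == 0); rewrite ?lexx ?ler01.
Qed.

End MaximalBound.

(** * Complex functions of finite support *)
Section FiniteSums.
Variable R : realType.
Implicit Types (f g : int -> R[i]) (s : seq int).

Lemma modulusE (z : R[i]) : `|z| = (modulus z)%:C.
Proof. by []. Qed.

Lemma modulus_ge0 (z : R[i]) : 0 <= modulus z.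
Proof. by rewrite -lecR -modulusE; apply: (normr_ge0 z). Qed.

Lemma modulus0 : modulus (0 : R[i]) = 0.
Proof. by apply: (@complexI R); rewrite -modulusE normr0. Qed.

Lemma modulusM (y z : R[i]) : modulus (y * z) = modulus y * modulus z.
Proof. by apply: (@complexI R); rewrite rmorphM /= -!modulusE normrM. Qed.

Lemma modulusR (a : R) : modulus a%:C = `|a|.
Proof. by rewrite /modulus /= expr0n addr0 sqrtr_sqr. Qed.

Lemma modulus_real (a : R) : 0 <= a -> modulus a%:C = a.
Proof. by move=> a0; apply: (@complexI R); rewrite -modulusE ger0_norm // lecR. Qed.

Lemma modulus_sum (I : Type) (s : seq I) (F : I -> R[i]) :
  modulus (\sum_(i <- s) F i) <= \sum_(i <- s) modulus (F i).
Proof.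
rewrite -lecR -modulusE; apply: le_trans (ler_norm_sum _ _ _) _.
by rewrite rmorph_sum.
Qed.

Lemma modulus_ge_Re (z : R[i]) : `|complex.Re z| <= modulus z.
Proof. by rewrite -lecR -modulusE normc_ge_Re. Qed.

Lemma modulus_ge_Im (z : R[i]) : `|complex.Im z| <= modulus z.
Proof.
have := modulus_ge_Re ((0 +i* 1) * z); rewrite modulusM.
have -> : modulus (0 +i* 1 : R[i]) = 1 by rewrite /modulus /= expr0n expr1n add0r sqrtr1.
by case: z => a b /=; rewrite mul0r mul1r sub0r normrN mul1r.
Qed.

Lemma fsum_finite (V : nmodType) (h : int -> V) s : uniq s ->
  (forall x, h x != 0 -> x \in s) -> \sum_(x \in [set: int]) h x = \sum_(x <- s) h x.
Proof.
move=> us hs; rewrite (fsbigE s) //; last by move=> x _ xs; apply/eqP; apply: contraNT xs; apply: hs.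
by apply: eq_bigl => x; rewrite in_setT.
Qed.

Lemma support_interval f g : finitely_supported f -> finitely_supported g ->
  exists b K, (forall x, f x != 0 -> x \in points (ival (b, K))) /\
              (forall x, g x != 0 -> x \in points (ival (b, K))).
Proof.
move=> /finite_seqP[s fs] /finite_seqP[t gt].
pose M := (\sum_(x <- s ++ t) `|x|)%N.
have MP x : x \in s ++ t -> (`|x| <= M)%N.
  by move=> xs; rewrite /M (big_rem x xs) /= leq_addr.
exists (- M%:Z), (M.*2.+1).
have box x : x \in s ++ t -> x \in points (ival (- M%:Z, M.*2.+1)).
  move=> /MP; rewrite mem_pointsE /=; have : (M.*2.+1 < 2 ^ M.*2.+1)%N by apply: ltn_expl.
  by move: (2 ^ _)%N => n; rewrite -mul2n; clear; lia.
split=> x h; apply: box; rewrite mem_cat.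
  by have : [set x | f x != 0] x by []; rewrite fs /= => ->.
by have : [set x | g x != 0] x by []; rewrite gt /= => ->; rewrite orbT.
Qed.

Lemma pairing_finite (h g : int -> R[i]) s : uniq s -> (forall x, g x != 0 -> x \in s) ->
  pairing h g = \sum_(x <- s) h x * g x.
Proof.
move=> us gs; apply: fsum_finite => // x; apply: contraNT => xs.
suff -> : g x = 0 by rewrite mulr0.
by apply/eqP; apply: contraNT xs; apply: gs.
Qed.

Lemma hilbert_finite (alpha : R) X f x s : uniq s -> (forall x, f x != 0 -> x \in s) ->
  hilbert alpha X f x = \sum_(y <- s) (hilbert_kernel alpha X (x - y))%:C * f y.
Proof.
move=> us fs.
have -> : hilbert alpha X f x =
    \sum_(n \in [set: int]) (hilbert_kernel alpha X n)%:C * f (x - n).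
  apply: fsbig_widen => // n [_ /=] /negP; rewrite negbK => /eqP ->.
  by rewrite /hilbert_kernel sgz0 mul0r invr0 mulr0 mul0r.
rewrite (@fsum_finite _ _ (map (fun y => x - y) s)); first last.
- move=> n h; apply/mapP; exists (x - n); last by clear; lia.
  by apply: fs; apply: contraNneq h => ->; rewrite mulr0.
- by rewrite map_inj_uniq // => y y'; clear; lia.
rewrite big_map; apply: eq_bigr => y _; congr (_ * f _); clear; lia.
Qed.

Lemma sum_complex (I : Type) (s : seq I) (a b : I -> R) :
  \sum_(i <- s) (a i +i* b i) = (\sum_(i <- s) a i) +i* (\sum_(i <- s) b i).
Proof. by elim: s => [|i s IH]; rewrite ?big_nil // !big_cons IH. Qed.

(** A real bilinear form extends to complex functions through their real and imaginary
parts, which are dominated by the moduli. *)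
Lemma complex_form_bound (k : int -> int -> R) f g s (B : R) :
  (forall F G : int -> R, (forall x, `|F x| <= modulus (f x)) ->
     (forall x, `|G x| <= modulus (g x)) ->
     `|\sum_(x <- s) \sum_(y <- s) k x y * F y * G x| <= B) ->
  modulus (\sum_(x <- s) (\sum_(y <- s) (k x y)%:C * f y) * g x) <= 4 * B.
Proof.
move=> HB; pose fr x := complex.Re (f x); pose fi x := complex.Im (f x).
pose gr x := complex.Re (g x); pose gi x := complex.Im (g x).
pose form (F G : int -> R) := \sum_(x <- s) \sum_(y <- s) k x y * F y * G x.
have -> : \sum_(x <- s) (\sum_(y <- s) (k x y)%:C * f y) * g x =
   (form fr gr - form fi gi) +i* (form fr gi + form fi gr).
  rewrite /form -sumrB -big_split /= -sum_complex; apply: eq_bigr => x _.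
  rewrite -sumrB -big_split /= -sum_complex mulr_suml; apply: eq_bigr => y _.
  rewrite /fr /fi /gr /gi; case: (f y) => a b; case: (g x) => c d; simpc => /=.
  by congr (_ +i* _); ring.
rewrite -lecR -modulusE (_ : 4 * B = 2 * (2 * B)); last by ring.
have two (p q : R) : `|p| <= B -> `|q| <= B -> `|p + q| <= 2 * B.
  by move=> hp hq; apply: le_trans (ler_normD _ _) _; lra.
apply: normc_le; apply: two; rewrite ?normrN; apply: HB => x;
  by rewrite ?modulus_ge_Re ?modulus_ge_Im.
Qed.

Lemma maximal_le X f x A : 
  (forall N, (0 < N)%N -> selected_average X (fun y => modulus (f y)) N x <= A) ->
  maximal X f x <= A.
Proof.
move=> H; apply: ge_sup; first by exists (modulus (((selector_count X 1)%:R)^-1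
                    * \sum_(1 <= n < 2) (X n%:Z)%:R * f (x - n%:Z))); exists 1%N.
move=> _ [N /= N0 <-]; apply: le_trans (H N N0).
rewrite modulusM /selected_average; apply: ler_pM; rewrite ?modulus_ge0 //.
  rewrite (_ : _^-1 = ((selector_count X N)%:R^-1 : R)%:C); last by rewrite fmorphV rmorph_nat.
  by rewrite modulus_real ?invr_ge0 ?ler0n.
apply: le_trans (modulus_sum _ _) _; apply: ler_sum => n _.
rewrite modulusM (_ : _%:R = ((X n%:Z)%:R : R)%:C); last by rewrite rmorph_nat.
by rewrite modulus_real ?ler0n.
Qed.

(** If the set were unbounded, its supremum would be 0 by convention. *)
Lemma maximal_ge0 X f x : 0 <= maximal X f x.
Proof.
rewrite /maximal; set A := [set _ | _ in _].
have [hA|hA] := pselect (has_sup A); last by rewrite sup_out.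
have [[a Aa] ub] := hA; apply: le_trans (ub_le_sup ub Aa).
by case: Aa => N _ <-; apply: modulus_ge0.
Qed.

Lemma selected_average_le_sum X (u : int -> R) N x s : (forall x, 0 <= u x) ->
  (forall x, u x != 0 -> x \in s) -> selected_average X u N x <= \sum_(y <- s) u y.
Proof.
move=> u0 us; set A := \sum_(y <- s) u y; have A0 : 0 <= A by apply: sumr_ge0.
have uA y : u y <= A.
  have [->//|/us ys] := eqVneq (u y) 0.
  by rewrite /A (big_rem y ys) /= lerDl sumr_ge0.
rewrite /selected_average; have [->|S0] := posnP (selector_count X N).
  by rewrite invr0 mul0r.
rewrite mulrC ler_pdivrMr ?ltr0n // /selector_count natr_sum mulr_sumr.
by apply: ler_sum => n _; rewrite mulrC ler_wpM2r ?ler0n.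
Qed.

Lemma hilbert_kernel_le1 (alpha : R) X m : alpha <= 1 -> `|hilbert_kernel alpha X m| <= 1.
Proof.
move=> a1; have [->|m0] := eqVneq m 0.
  by rewrite /hilbert_kernel sgz0 mul0r invr0 mulr0 normr0.
rewrite /hilbert_kernel normrM normfV normrM (ger0_norm (powR_ge0 _ _)).
have -> : `|(sgz m)%:~R| = 1 :> R by rewrite -intr_norm normr_sgz m0.
rewrite mul1r; have p : 1 <= `|m|%N%:R `^ (1 - alpha) :> R.
  rewrite -[leLHS](powRr0 `|m|%N%:R) ler_powR //; last by lra.
  by rewrite ler1n absz_gt0.
apply: (@le_trans _ _ (1 * (`|m|%N%:R `^ (1 - alpha))^-1)).
  by rewrite ler_wpM2r ?invr_ge0 ?powR_ge0 //; case: (X m); rewrite ?normr1 ?normr0.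
by rewrite mul1r invf_le1 //; lra.
Qed.

End FiniteSums.

(** * Choice of the sparse family *)
Section Selection.
Variable R : realType.
Implicit Types (f g : int -> R[i]) (X : int -> bool).

Definition l1norm f : R := \sum_(x \in [set: int]) modulus (f x).

Lemma l1norm_finite f s : uniq s -> (forall x, f x != 0 -> x \in s) ->
  l1norm f = \sum_(x <- s) modulus (f x).
Proof.
move=> us fs; apply: fsum_finite => // x h; apply: fs; apply: contraNneq h => ->.
by rewrite modulus0.
Qed.

(** A bound that holds for every sample; it is only used for functions whose sparse
forms are unbounded. *)
Lemma pairing_hilbert_le (alpha : R) X f g : alpha <= 1 ->
  finitely_supported f -> finitely_supported g ->
  modulus (pairing (hilbert alpha X f) g) <= l1norm f * l1norm g.
Proof.
move=> a1 ff fg; have [b [K [fs gs]]] := support_interval ff fg.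
have us := uniq_points (ival (b, K)).
rewrite (pairing_finite _ us gs) (l1norm_finite us fs) (l1norm_finite us gs).
apply: le_trans (modulus_sum _ _) _; rewrite mulr_sumr; apply: ler_sum => x _.
rewrite modulusM ler_wpM2r ?modulus_ge0 // (hilbert_finite _ _ _ us fs).
apply: le_trans (modulus_sum _ _) _; apply: ler_sum => y _.
rewrite modulusM -[leRHS]mul1r ler_wpM2r ?modulus_ge0 //.
by rewrite modulusR hilbert_kernel_le1.
Qed.

Lemma pairing_maximal_le X f g : finitely_supported f -> finitely_supported g ->
  modulus (pairing (fun x => (maximal X f x)%:C) g) <= l1norm f * l1norm g.
Proof.
move=> ff fg; have [b [K [fs gs]]] := support_interval ff fg.
have us := uniq_points (ival (b, K)).
rewrite (pairing_finite _ us gs) (l1norm_finite us fs) (l1norm_finite us gs).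
apply: le_trans (modulus_sum _ _) _; rewrite mulr_sumr; apply: ler_sum => x _.
rewrite modulusM ler_wpM2r ?modulus_ge0 // modulus_real ?maximal_ge0 //.
apply: maximal_le => N _; apply: selected_average_le_sum => y; first exact: modulus_ge0.
by move=> h; apply: fs; apply: contraNneq h => ->; rewrite modulus0.
Qed.

Lemma sparse_form_ge0 (r : R) S f g : (0 <= sparse_form r S f g)%E.
Proof. by apply: esum_ge0 => I _; rewrite lee_fin !mulr_ge0 ?powR_ge0. Qed.

(** If the supremum of the sparse forms is finite and positive, a form above half of
it is chosen, which costs the factor 2; if it is zero, the estimate with [D = 0]
shows that [Q] is at most zero; if it is infinite, some form exceeds [N]. *)
Lemma near_maximizer (r N : R) f g : exists S : set zinterval, sparse (4^-1 : R) S /\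
  forall Q C : R, 1 <= C -> Q <= N ->
    (forall D, 0 <= D ->
       sparse_bound 4^-1 r (fun x => modulus (f x)) (fun x => modulus (g x)) D -> Q <= C * D) ->
    (Q%:E <= (2 * C)%:E * sparse_form r S f g)%E.
Proof.
pose A := [set sparse_form r S f g | S in [set S | sparse (4^-1 : R) S]].
have s0 : sparse (4^-1 : R) set0 by exists (fun _ => fset0).
have A0 : (0 <= ereal_sup A)%E.
  by apply: le_trans (sparse_form_ge0 r set0 f g) _; apply: ereal_sup_ubound; exists set0.
have bound D : (ereal_sup A <= D%:E)%E ->
    sparse_bound 4^-1 r (fun x => modulus (f x)) (fun x => modulus (g x)) D.
  by move=> h S sS; apply: le_trans h; apply: ereal_sup_ubound; exists S.
have grow (C : R) S : 1 <= C ->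
    (sparse_form r S f g <= (2 * C)%:E * sparse_form r S f g)%E.
  move=> C1; rewrite -[leLHS]mul1e lee_wpmul2r ?sparse_form_ge0 // lee_fin; lra.
case E : (ereal_sup A) A0 => [D| |] // A0.
- rewrite lee_fin in A0; have HD : sparse_bound 4^-1 r (fun x => modulus (f x)) (fun x => modulus (g x)) D.
    by apply: bound; rewrite E.
  move: A0; rewrite le_eqVlt => /orP[/eqP D0|D0].
    exists set0; split=> // Q C C1 _ /(_ D); rewrite -D0 mulr0 lexx => h.
    have Q0 : Q <= 0 by apply: h; rewrite // D0.
    apply: (@le_trans _ _ 0%E); first by rewrite lee_fin.
    by apply: mule_ge0 (sparse_form_ge0 _ _ _ _); rewrite lee_fin; lra.
  have : ((D / 2)%:E < ereal_sup A)%E by rewrite E lte_fin; lra.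
  move=> /ereal_sup_gt[_ [S sS <-] hS]; exists S; split=> // Q C C1 _ /(_ D (ltW D0) HD) h.
  apply: (@le_trans _ _ ((2 * C)%:E * (D / 2)%:E)%E).
    by rewrite -EFinM lee_fin (_ : 2 * C * (D / 2) = C * D) //; field.
  by apply: lee_wpmul2l (ltW hS); rewrite lee_fin; lra.
- have : (N%:E < ereal_sup A)%E by rewrite E ltry.
  move=> /ereal_sup_gt[_ [S sS <-] hS]; exists S; split=> // Q C C1 QN _.
  apply: le_trans (grow C S C1); apply: le_trans (ltW hS).
  by rewrite lee_fin.
Qed.

End Selection.

Theorem theorem1p5 (R : realType) :
  exists c : R, 0 < c < 1 /\
  forall (d : measure_display) (T : measurableType d) (P : probability T R)
    (alpha r : R) (X : int -> {RV P >-> bool}),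
    0 < alpha < 1 -> 1 + alpha < r < 2 -> selectors alpha X ->
    let H (w : T) (f : int -> R[i]) : int -> R[i] :=
      hilbert alpha (fun n => X n w) f in
    let M (w : T) (f : int -> R[i]) : int -> R[i] :=
      fun x => (maximal (fun n => X n w) f x)%:C in
    [/\ {ae P, forall w, exists C : R,
          forall f g : int -> R[i],
            finitely_supported f -> finitely_supported g ->
            exists S : set zinterval, sparse c S /\
              ((modulus (pairing (H w f) g))%:E
                 <= C%:E * sparse_form r S f g)%E},
        {ae P, forall w, exists C : R,
          forall f g : int -> R[i],
            finitely_supported f -> finitely_supported g ->
            exists S : set zinterval, sparse c S /\
              ((modulus (pairing (M w f) g))%:E
                 <= C%:E * sparse_form r S f g)%E},
        exists S : (int -> R[i]) -> (int -> R[i]) -> set zinterval,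
          (forall f g : int -> R[i],
             finitely_supported f -> finitely_supported g ->
             sparse c (S f g)) /\
          {ae P, forall w, exists C : R,
            forall f g : int -> R[i],
              finitely_supported f -> finitely_supported g ->
              ((modulus (pairing (H w f) g))%:E
                 <= C%:E * sparse_form r (S f g) f g)%E}
      & exists S : (int -> R[i]) -> (int -> R[i]) -> set zinterval,
          (forall f g : int -> R[i],
             finitely_supported f -> finitely_supported g ->
             sparse c (S f g)) /\
          {ae P, forall w, exists C : R,
            forall f g : int -> R[i],
              finitely_supported f -> finitely_supported g ->
              ((modulus (pairing (M w f) g))%:E
                 <= C%:E * sparse_form r (S f g) f g)%E}].
Proof.
exists 4^-1; split; first by apply/andP; split; lra.
move=> d T P alpha r X alpha01 ralpha selX H M.
have a1 : alpha <= 1 by case/andP: alpha01 => _ /ltW.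
have [z zN] := choice (fun k => pow2_prim_root R k.+2).
have [theta [th01 th dec]] := interpolation_exponent alpha01 ralpha.
have [S0 S00 S0P] := scale_constant_sum alpha01 ralpha th01 th dec.
have [S SP] := choice (fun fg : (int -> R[i]) * (int -> R[i]) =>
  near_maximizer r (l1norm fg.1 * l1norm fg.2) fg.1 fg.2).
have X1 : {ae P, forall w, X 1 w = true}.
  have m1 := measurable_level X 1 true.
  exists (~` [set w | X 1 w = true]); split => //; first exact: measurableC.
  rewrite probability_setC // (selX.2 1) // absz1 powR1 subee //.
have random := random_fourier alpha01 selX (fun k => prim_root_norm (zN k)).
have aeH : {ae P, forall w, exists C : R, forall f g : int -> R[i],
    finitely_supported f -> finitely_supported g ->
    ((modulus (pairing (H w f) g))%:E <= C%:E * sparse_form r (S (f, g)) f g)%E}.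
  apply: filterS random => w [C [C1 FX]].
  pose B := 4 * (local_constant R * ball_constant R * ball_constant R + 2 * (C * S0)).
  exists (2 * (1 + `|B|)) => f g ff fg; apply: (SP (f, g)).2.
  - by rewrite lerDl.
  - exact: pairing_hilbert_le.
  move=> D D0 HD; have [b [K [fs gs]]] := support_interval ff fg.
  have us := uniq_points (ival (b, K)); rewrite (pairing_finite _ us gs).
  apply: (@le_trans _ _ (B * D)); last first.
    rewrite ler_wpM2r //; apply: le_trans (ler_norm B) _; by rewrite lerDr.
  rewrite /B -mulrA.
  under eq_bigr => x _ do rewrite /H (hilbert_finite _ _ _ us fs).
  apply: complex_form_bound => F G Ff Gg.
  apply: (hilbert_bound alpha01 ralpha th01 th zN FX _ Ff Gg _ _ HD D0).
  - by move=> L; apply: S0P.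
  - move=> x h; apply: fs; apply: contraNneq h => f0.
    by have := Ff x; rewrite f0 modulus0 normr_le0.
  - move=> x h; apply: gs; apply: contraNneq h => g0.
    by have := Gg x; rewrite g0 modulus0 normr_le0.
have aeM : {ae P, forall w, exists C : R, forall f g : int -> R[i],
    finitely_supported f -> finitely_supported g ->
    ((modulus (pairing (M w f) g))%:E <= C%:E * sparse_form r (S (f, g)) f g)%E}.
  apply: filterS2 random X1 => w [C [C1 FX]] X1.
  have [CM [CM0 HM]] := maximal_bound alpha01 ralpha C1 th01 th zN FX (fun L => S0P C L C1) X1.
  exists (2 * (1 + CM)) => f g ff fg; apply: (SP (f, g)).2.
  - by rewrite lerDl.
  - exact: pairing_maximal_le.
  move=> D D0 HD; have [b [K [fs gs]]] := support_interval ff fg.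
  have us := uniq_points (ival (b, K)); rewrite (pairing_finite _ us gs).
  apply: (@le_trans _ _ (CM * D)); last by rewrite ler_wpM2r // lerDr.
  apply: le_trans (modulus_sum _ _) _.
  under eq_bigr => x _ do rewrite modulusM /M modulus_real ?maximal_ge0 //.
  apply: (HM (fun x => modulus (f x)) (fun x => modulus (g x))) HD D0 => [x|x|x h|x A].
  - exact: modulus_ge0.
  - exact: modulus_ge0.
  - by apply: fs; apply: contraNneq h => ->; rewrite modulus0.
  - exact: maximal_le.
split.
- by apply: filterS aeH => w [C HC]; exists C => f g ff fg; exists (S (f, g)); split; [exact: (SP (f, g)).1|exact: HC].
- by apply: filterS aeM => w [C HC]; exists C => f g ff fg; exists (S (f, g)); split; [exact: (SP (f, g)).1|exact: HC].
- by exists (fun f g => S (f, g)); split=> // f g _ _; exact: (SP (f, g)).1.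
- by exists (fun f g => S (f, g)); split=> // f g _ _; exact: (SP (f, g)).1.
Qed.
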